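(* Let $2\le m\le n$, and let $X=(X_1,\dots,X_m)$ and $X^j=(X_1^j,\dots,X_m^j)$, $j\in\mathbb{N}$, be $m$-tuples of linearly independent smooth vector fields on $\mathbb{R}^n$ such that $X$ satisfies the Chow-Hörmander condition and its Carnot-Carathéodory balls are bounded in $\mathbb{R}^n$. Assume that, for every $i=1,\dots,m$, $X_i^j\to X_i$ in $C^\infty_{loc}(\mathbb{R}^n)$ as $j\to\infty$. Let $d$ and $d_j$ be the Carnot-Carathéodory distances associated with $X$ and $X^j$, respectively. Then the sequence $(d_j)_j$ converges to $d$ in $L^\infty_{loc}(\mathbb{R}^n\times\mathbb{R}^n)$ as $j\to+\infty$.
   Context: Smooth means $C^\infty$; linear independence of the vector fields is understood at every point of $\mathbb{R}^n$. Convergence in $C^\infty_{loc}(\mathbb{R}^n)$ means uniform convergence on compact sets of the coefficients and of all their derivatives. Chow-Hörmander condition for $X$: for every $x\in\mathbb{R}^n$, the vector space spanned by $X_1,\dots,X_m$ and their commutators (iterated Lie brackets) of any order, computed at $x$, is the whole $\mathbb{R}^n$. Carnot-Carathéodory (CC) distance: an absolutely continuous curve $\gamma:[0,T]\to\mathbb{R}^n$ is $X$-subunit joining $x$ and $y$ if $\gamma(0)=x$, $\gamma(T)=y$ and there exist (measurable) $h_1,\dots,h_m:[0,T]\to\mathbb{R}$ with $\sum_{i=1}^m h_i^2\le 1$ and $\dot\gamma(t)=\sum_{i=1}^m h_i(t)X_i(\gamma(t))$ for a.e. $t\in[0,T]$. Then $d(x,y)$ is the infimum of the $T\in(0,+\infty)$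 for which there is an $X$-subunit curve $\gamma:[0,T]\to\mathbb{R}^n$ joining $x$ and $y$, with $\inf\emptyset=+\infty$. The function $d_j$ is defined in the same way with $X^j$ in place of $X$ (so a priori it may take the value $+\infty$). The CC balls of $X$ are $B(x,r)=\{y:d(x,y)<r\}$; the assumption is that each of them is bounded in the Euclidean metric. Convergence in $L^\infty_{loc}(\mathbb{R}^n\times\mathbb{R}^n)$ means uniform convergence on compact sets: for every compact $K\subseteq\mathbb{R}^n$ and every $\varepsilon>0$ there is $J$ such that $d_j$ is finite on $K\times K$ and $|d_j(x,y)-d(x,y)|\le\varepsilon$ for all $x,y\in K$ and $j\ge J$. *)

(* Defs.v *)
From HB Require Import structures.
From mathcomp Require Import all_boot all_order all_algebra.
From mathcomp Require Import all_classical all_reals all_analysis.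

Set Implicit Arguments.
Unset Strict Implicit.
Unset Printing Implicit Defensive.

Import Order.TTheory GRing.Theory Num.Theory.
Import numFieldNormedType.Exports.

Local Open Scope classical_set_scope.
Local Open Scope ring_scope.

(* The norm of ['rV[R]_n] is the sup norm. It is only used through notions
   (boundedness, topology, local uniform convergence, absolute continuity) that
   do not change when it is replaced by the Euclidean norm. *)

Definition vfield (R : realType) (n : nat) := 'rV[R]_n -> 'rV[R]_n.

(* [iter_partial [:: i1; ...; ik] Y] is d_{i1} ... d_{ik} Y, taken
   coefficientwise; the total operator ['D_] is meaningful when the derivatives
   exist, as ensured by [smooth]. *)
Definition iter_partial (R : realType) (n : nat) (s : seq 'I_n)
    (Y : vfield R n) : vfield R n :=
  foldr (fun (i : 'I_n) (Z : vfield R n) (x : 'rV[R]_n) =>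
           'D_(delta_mx 0 i) Z x) Y s.

Definition smooth (R : realType) (n : nat) (Y : vfield R n) : Prop :=
  forall s : seq 'I_n,
    continuous (iter_partial s Y) /\
    forall (i : 'I_n) (x : 'rV[R]_n),
      derivable (iter_partial s Y) x (delta_mx 0 i).

Definition cvg_smooth_loc (R : realType) (n : nat)
    (Yj : nat -> vfield R n) (Y : vfield R n) : Prop :=
  forall (s : seq 'I_n) (K : set 'rV[R]_n), compact K ->
    {uniform K, (fun j => iter_partial s (Yj j)) @ \oo --> iter_partial s Y}.

Definition lin_indep (R : realType) (n m : nat) (X : 'I_m -> vfield R n) : Prop :=
  forall x : 'rV[R]_n, free [tuple X i x | i < m].

Definition lie_bracket (R : realType) (n : nat) (Y Z : vfield R n) : vfield R n :=
  fun x => 'D_(Y x) Z x - 'D_(Z x) Y x.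

Inductive commutator (R : realType) (n m : nat) (X : 'I_m -> vfield R n) :
    vfield R n -> Prop :=
| Commutator_base (i : 'I_m) : commutator X (X i)
| Commutator_bracket (Y Z : vfield R n) :
    commutator X Y -> commutator X Z -> commutator X (lie_bracket Y Z).

Definition linear_span (R : realType) (n : nat) (A : set 'rV[R]_n) :
    set 'rV[R]_n :=
  [set v | exists2 s : seq 'rV[R]_n,
     (forall u, u \in s -> A u) & v \in span s].

Definition chow_hormander (R : realType) (n m : nat) (X : 'I_m -> vfield R n) :
    Prop :=
  forall x : 'rV[R]_n,
    linear_span [set Y x | Y in [set Y | commutator X Y]] = setT.

Definition abs_continuous (R : realType) (n : nat) (a b : R)
    (g : R -> 'rV[R]_n) : Prop :=
  forall e : R, 0 < e -> exists2 d : R, 0 < d &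
    forall (N : nat) (u v : 'I_N -> R),
      (forall k, a <= u k /\ u k <= v k /\ v k <= b) ->
      trivIset setT (fun k : 'I_N => `]u k, v k[%classic) ->
      \sum_(k < N) (v k - u k) < d ->
      \sum_(k < N) `|g (v k) - g (u k)| < e.

(* Curves and controls are functions on the whole line of which only the
   restriction to [0, T] matters: the derivative is required almost everywhere
   only. Borel measurability of the controls is no restriction, since a Lebesgue
   measurable control can be set to zero outside a Borel set of full measure on
   which it agrees with a Borel function. *)
Definition subunit (R : realType) (n m : nat) (X : 'I_m -> vfield R n)
    (T : R) (g : R -> 'rV[R]_n) : Prop :=
  abs_continuous 0 T g /\
  exists h : 'I_m -> R -> R,
    [/\ forall i, measurable_fun `[0, T]%classic (h i),
        forall t : R, t \in `[0, T] -> \sum_(i < m) h i t ^+ 2 <= 1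
      & {ae lebesgue_measure, forall t : R, t \in `[0, T] ->
           is_derive t 1 g (\sum_(i < m) h i t *: X i (g t))}].

Definition cc_dist (R : realType) (n m : nat) (X : 'I_m -> vfield R n)
    (x y : 'rV[R]_n) : \bar R :=
  ereal_inf [set T%:E | T in [set T : R | 0 < T /\
    exists g : R -> 'rV[R]_n, [/\ subunit X T g, g 0 = x & g T = y]]].

Definition cc_ball (R : realType) (n m : nat) (X : 'I_m -> vfield R n)
    (x : 'rV[R]_n) (r : R) : set 'rV[R]_n :=
  [set y | (cc_dist X x y < r%:E)%E].

Definition cvg_Linfty_loc (R : realType) (n : nat)
    (dj : nat -> 'rV[R]_n -> 'rV[R]_n -> \bar R)
    (d : 'rV[R]_n -> 'rV[R]_n -> \bar R) : Prop :=
  forall K : set 'rV[R]_n, compact K -> forall e : R, 0 < e ->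
    exists J : nat, forall j : nat, (J <= j)%N ->
      forall x y : 'rV[R]_n, K x -> K y ->
        dj j x y \is a fin_num /\ (`|dj j x y - d x y| <= e%:E)%E.

(* Main.v *)
(** Both inequalities follow from two facts, uniform in [j].

    (1) Uniform local Chow theorem: points close to each other are joined by
    [X^j]-horizontal curves of small length, for all large [j].  For a word in
    the flows of the [X_i^j] run for time [t], a function [f] at the endpoint has
    the expansion in [t] obtained by applying formal exponentials to [f]; for the
    word of an iterated commutator [Y] of degree [k] this gives a displacement
    [t^k Y^j + O(t^(k+1))], with constants controlled by finitely many
    derivatives of [X^j].  Hence every small displacement [v] can be realized up
    to an error [|v|/2] in time [O(|v|^al)], and iterating on the error and
    concatenating the resulting sequence of curves reaches the target exactly.
    Only the existence of integral curves is used, neither their uniqueness nor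
    their regularity in the initial point.

    (2) Stability: along a subunit curve of one family, the controls are averaged
    on short intervals, and the other family is run with the averaged constant
    controls.  This Euler scheme stays close to the original curve, and its
    endpoint is joined to the desired one by (1).  The balls of [X] being bounded,
    all the curves involved stay in a fixed compact set. *)

Require Import Defs.
From HB Require Import structures.
From mathcomp Require Import all_boot all_order all_algebra.
From mathcomp Require Import all_classical all_reals all_analysis.
From mathcomp Require Import measurable_realfun ring lra.

Set Implicit Arguments.
Unset Strict Implicit.
Unset Printing Implicit Defensive.

Import Order.TTheory GRing.Theory Num.Theory.
Import numFieldNormedType.Exports.

Local Open Scope classical_set_scope.
Local Open Scope ring_scope.

(** * Differential calculus on row vectors *)

(** Uniformity in [j] comes from treating the sequence and its limit as one family indexed by
    [option nat]: convergence with all derivatives bounds each derivative on a ball for all indices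
    at once, and the class of such families is closed under products, Lie derivatives and brackets.
    Local Chow cannot rely on an inverse function theorem, as nothing is known on the dependence of
    the flows on the initial point. Displacements are added one direction at a time instead, which
    works because each of them is realized from every starting point near [x0] and for every large
    [j]. In the stability part, nothing is known on the balls of [X^j]. One of the two families
    compared is always [X]; its curve is confined and the other curve stays at distance at most 1
    from it. The order of the inequalities matters: [d] is bounded on compact sets by Chow, the
    first comparison then bounds [d_j], and only this provides a time horizon for the second
    comparison. Averaging the controls takes a mean value theorem for curves differentiable almost
    everywhere only; it rests on Cousin's lemma. *)

Lemma continuous_sumr {K : numFieldType} {T : topologicalType}
    {V : normedModType K} (I : Type) (r : seq I) (F : I -> T -> V) :
  (forall i, continuous (F i)) -> continuous (fun x => \sum_(i <- r) F i x).
Proof.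
move=> cF; elim: r => [|i r IH] x.
  rewrite (_ : (fun _ => _) = cst 0); first exact: cvg_cst.
  by apply/funext => y; rewrite big_nil.
rewrite (_ : (fun _ => _) = fun y => F i y + \sum_(j <- r) F j y).
  by apply: cvgD; [exact: cF|exact: IH].
by apply/funext => y; rewrite big_cons.
Qed.

Section RowVectorCalculus.
Context {R : realType} {n : nat}.
Implicit Types (x y v : 'rV[R]_n) (f : 'rV[R]_n -> R) (g : R -> 'rV[R]_n).

Lemma normr_rV_le x (e : R) : 0 <= e -> (forall i, `|x 0 i| <= e) -> `|x| <= e.
Proof.
move=> e0 H; rewrite [leLHS]/Num.Def.normr/= mx_normrE bigmax_le//= => -[i j] _.
by rewrite (ord1 i) H.
Qed.

Lemma ler_coord_normr x i : `|x 0 i| <= `|x|.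
Proof.
rewrite [leRHS]/Num.Def.normr/= mx_normrE.
exact: (le_bigmax _ (fun ij => `|x ij.1 ij.2|) (0, i)).
Qed.

Lemma is_derive_rVP g (t : R) v :
  is_derive t 1 g v <-> forall i, is_derive t 1 (fun s => g s 0 i) (v 0 i).
Proof.
split=> [[dg gv] i|H].
  split; first exact: (derivable_mxP _ _ _).1.
  by rewrite -gv derive_mx// mxE.
have dg : derivable g t 1.
  by apply/derivable_mxP => i j; rewrite (ord1 i); case: (H j).
split => //; rewrite derive_mx//; apply/rowP => i; rewrite mxE.
by case: (H i) => _ ->.
Qed.

Lemma is_derive_mulr (c s : R) : is_derive s 1 (fun r => r * c) c.
Proof.
have -> : (fun r => r * c) = c \*: id by apply/funext => r /=; rewrite mulrC.
by apply: is_derive_eq (is_deriveZ c (is_derive_id s 1)) _; rewrite [LHS]mulr1.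
Qed.

Lemma is_derive_line f x v (s : R) : derivable f (x + s *: v) v ->
  is_derive s 1 (fun r => f (x + r *: v)) ('D_v f (x + s *: v)).
Proof.
have E : (fun h : R => h^-1 *: ((fun r : R => f (x + r *: v)) \o shift s) (h *: 1)
    - h^-1 *: f (x + s *: v)) =
  (fun h => h^-1 *: (f \o shift (x + s *: v)) (h *: v) - h^-1 *: f (x + s *: v)).
  apply/funext => h /=; do 3!f_equal.
  by rewrite [h *: 1]mulr1 scalerDl addrCA.
have E' : (fun h : R => h^-1 *: (((fun r : R => f (x + r *: v)) \o shift s) (h *: 1)
    - f (x + s *: v))) =
  (fun h => h^-1 *: ((f \o shift (x + s *: v)) (h *: v) - f (x + s *: v))).
  apply/funext => h; rewrite !scalerBr.
  exact: (congr1 (fun F => F h) E).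
move=> d; split; first by rewrite /derivable E'.
by rewrite /derive E'.
Qed.

Lemma derive1_le (f df : R -> R) (a b M : R) : a <= b ->
  (forall t, a < t < b -> is_derive (t : R) 1 f (df t)) ->
  {within `[a, b], continuous f} ->
  (forall t, a < t < b -> `|df t| <= M) -> `|f b - f a| <= M * (b - a).
Proof.
rewrite le_eqVlt => /predU1P[->|ab] fd cf dM; first by rewrite !subrr normr0 mulr0.
have [c /[!in_itv]/= cab ->] : exists2 c, c \in `]a, b[%R & f b - f a = df c * (b - a).
  by apply: MVT => // t; rewrite in_itv /=; exact: fd.
rewrite normrM [`|b - a|]gtr0_norm ?subr_gt0//.
by rewrite ler_pM2r ?subr_gt0// dM.
Qed.

Lemma continuous_of_derivable (f : R -> R) (df : R -> R) (A : set R) :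
  (forall t, is_derive (t : R) 1 f (df t)) -> {within A, continuous f}.
Proof.
move=> d; apply: continuous_subspaceT => t.
by apply: differentiable_continuous; apply/derivable1_diffP; case: (d t).
Qed.

End RowVectorCalculus.

(** * Continuous partial derivatives: differentiability and symmetry of second derivatives *)

Lemma differentiable_of_increment {K : realType} {V W : normedModType K}
    (f : V -> W) (df : {linear V -> W}) (x : V) : continuous df ->
  (forall e : K, 0 < e -> exists2 d : K, 0 < d & forall h, `|h| < d ->
    `|f (h + x) - f x - df h| <= e * `|h|) ->
  differentiable f x /\ 'd f x = df :> (V -> W).
Proof.
move=> dfc H.
have dxf : f \o shift x = cst (f x) + df +o_ 0 id.
  apply/eqaddoP => _/posnumP[e].
  have [d d0 {}H] := H _ [gt0 of e%:num].
  apply/nbhs_normP; exists d => //= h; rewrite /= sub0r normrN => hd.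
  by rewrite !fctE opprD addrA; exact: H.
split; last exact: diff_unique.
apply/diffP => /=.
(* The differential of the library is a chosen linear map, so it has the required properties as soon
   as one map has them. *)
apply: (@getPex _ (fun (df : {linear V -> W}) => continuous df /\
  forall y, f y = f (lim (nbhs x)) + df (y - lim (nbhs x))
                  +o_(y \near x) (y - lim (nbhs x)))).
exists df; split=> //; apply: eqaddoEx => z.
have hdf h : (f \o shift x = cst (f x) + h +o_ 0 id) ->
    h = f \o shift x - cst (f x) +o_ 0 id.
  move=> hdf; apply: eqaddoE.
  rewrite hdf addrAC -!addrA addrC !addrA subrK.
  rewrite -[LHS]addr0 -addrA; congr (_ + _).
  by apply/eqP; rewrite eq_sym addrC addr_eq0 oppo.
rewrite (hdf _ dxf) !addrA lim_id // /(_ \o _) /= subrK [f _ + _]addrC addrK.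
rewrite -addrA -[LHS]addr0; congr (_ + _).
apply/eqP; rewrite eq_sym addrC addr_eq0 oppox; apply/eqP.
rewrite [in LHS]littleo_center0 (comp_centerK x id).
by rewrite -[- _ in RHS](comp_centerK x).
Qed.

Section Differentiability.
Context {R : realType} {n : nat}.
Implicit Types (x y v : 'rV[R]_n) (f : 'rV[R]_n -> R) (g : R -> 'rV[R]_n).

Definition pd (i : 'I_n) f : 'rV[R]_n -> R := fun x => 'D_(delta_mx 0 i) f x.

Definition C1 f := forall i,
  (forall x, derivable f x (delta_mx 0 i)) /\ continuous (pd i f).

(** The displacement [h] is split along the axes and the mean value inequality is applied on each
    edge; continuity of the partial derivatives at [x] controls all edges together. *)
Lemma C1_increment f x (e : R) : C1 f -> 0 < e -> exists2 d : R, 0 < d &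
  forall h : 'rV[R]_n, `|h| < d ->
    `|f (h + x) - f x - \sum_i h 0 i * pd i f x| <= e * `|h|.
Proof.
move=> C1f e0.
(* Dividing by [n.+1] rather than [n] keeps the threshold positive in dimension 0. *)
have [d d0 Hd] : exists2 d : R, 0 < d & forall i y, `|x - y| < d ->
    `|pd i f x - pd i f y| <= e / n.+1%:R.
  have : \forall y \near x, forall i, `|pd i f x - pd i f y| <= e / n.+1%:R.
    suff H i : \forall y \near x, `|pd i f x - pd i f y| <= e / n.+1%:R.
      exact: (@filter_forall _ _ _ (nbhs x) _ H).
    have /cvgrPdist_le := (C1f i).2 x; apply.
    by rewrite divr_gt0// ltr0n.
  move=> /nbhs_normP[d /= d0 H]; exists d => // i y xy.
  exact: H.
exists d => // h hd.
pose p k : 'rV[R]_n := \row_i (if (i < k)%N then h 0 i + x 0 i else x 0 i).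
have p0 : p 0%N = x by apply/rowP => i; rewrite mxE.
have pn : p n = h + x by apply/rowP => i; rewrite !mxE ltn_ord.
have pS (k : 'I_n) : p k.+1 = p k + h 0 k *: delta_mx 0 k.
  apply/rowP => i; rewrite !mxE eqxx/= ltnS.
  case: (ltngtP i k) => [ik|ik|/val_inj->].
  - by rewrite -val_eqE (ltn_eqF ik) mulr0 addr0.
  - by rewrite -val_eqE (gtn_eqF ik) mulr0 addr0.
  - by rewrite eqxx mulr1 addrC.
have -> : f (h + x) - f x = \sum_(k < n) (f (p k.+1) - f (p k)).
  by rewrite -(big_mkord xpredT (fun k => f (p k.+1) - f (p k))) telescope_sumr// pn p0.
rewrite -sumrB (le_trans (ler_norm_sum _ _ _))//.
have step (k : 'I_n) : `|f (p k.+1) - f (p k) - h 0 k * pd k f x| <= e / n.+1%:R * `|h|.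
  pose F (s : R) := f (p k + s *: delta_mx 0 k) - s * pd k f x.
  have -> : f (p k.+1) - f (p k) - h 0 k * pd k f x = F (h 0 k) - F 0.
    by rewrite /F pS scale0r addr0 mul0r subr0; ring.
  have dF (s : R) : is_derive s 1 F (pd k f (p k + s *: delta_mx 0 k) - pd k f x).
    apply: is_deriveB; first exact/is_derive_line/(C1f k).1.
    exact: is_derive_mulr.
  have bd (s : R) : `|s| <= `|h 0 k| ->
      `|pd k f (p k + s *: delta_mx 0 k) - pd k f x| <= e / n.+1%:R.
    move=> sh; rewrite distrC Hd//; apply: le_lt_trans hd.
    apply: normr_rV_le => // i; rewrite !mxE eqxx/=.
    case: ifPn => ik.
      have -> : i == k = false by rewrite -val_eqE (ltn_eqF ik).
      rewrite mulr0 addr0 opprD addrCA subrr addr0 normrN.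
      exact: ler_coord_normr.
    case: eqP => [->|_].
      by rewrite mulr1 opprD addrA subrr sub0r normrN (le_trans sh)// ler_coord_normr.
    by rewrite mulr0 addr0 subrr normr0.
  have cF A : {within A, continuous F} by exact: continuous_of_derivable dF.
  have le0 := ltW (divr_gt0 e0 (ltr0Sn R n)).
  have [h0|h0] := lerP 0 (h 0 k).
    have := derive1_le (M := e / n.+1%:R) h0 (fun t _ => dF t) (cF _).
    move=> /(_ _)/le_trans; apply.
      move=> t /andP[t0 th]; apply: bd.
      by rewrite !ger0_norm// ltW.
    rewrite subr0 ler_wpM2l// (le_trans _ (ler_coord_normr h k))//.
    by rewrite ler_norm.
  rewrite distrC.
  have := derive1_le (M := e / n.+1%:R) (ltW h0) (fun t _ => dF t) (cF _).
  move=> /(_ _)/le_trans; apply.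
    move=> t /andP[ht t0]; apply: bd.
    by rewrite !ltr0_norm// lerN2 ltW.
  rewrite sub0r ler_wpM2l// (le_trans _ (ler_coord_normr h k))//.
  by rewrite ler0_norm// ltW.
apply: le_trans (ler_sum _ (fun k _ => step k)) _.
rewrite sumr_const card_ord -[leLHS]mulr_natl mulrA ler_wpM2r//.
rewrite mulrCA ger_pMr// ler_pdivrMr ?ltr0n// mul1r ler_nat//.
Qed.

Lemma C1_differentiable f x : C1 f ->
  differentiable f x /\ forall v, 'D_v f x = \sum_i v 0 i * pd i f x.
Proof.
move=> C1f.
pose df0 (h : 'rV[R]_n) : R^o := \sum_i h 0 i * pd i f x.
have lin : linear df0.
  move=> a u w; rewrite /df0 scaler_sumr -big_split/=; apply: eq_bigr => i _.
  by rewrite !mxE mulrDl -mulrA.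
pose dfM := GRing.isLinear.Build _ _ _ _ _ lin.
pose df : {linear 'rV[R]_n -> R^o} := HB.pack df0 dfM.
have dfc : continuous df.
  apply: continuous_sumr => i h.
  exact: cvgMr_tmp (@coord_continuous _ _ _ 0 i h).
have [H1 H2] := differentiable_of_increment (f := f : _ -> R^o) dfc
  (fun e e0 => C1_increment x C1f e0).
by split => // v; rewrite deriveE// H2.
Qed.

Lemma is_derive_comp_curve f g (t : R) v : C1 f -> is_derive t 1 g v ->
  is_derive t 1 (fun s => f (g s)) (\sum_i v 0 i * pd i f (g t)).
Proof.
move=> C1f [/derivable1_diffP dg gv].
have [df Df] := C1_differentiable (g t) C1f.
have dfg : differentiable (f \o g) t by exact: differentiable_comp.
split; first exact/derivable1_diffP.
by rewrite deriveE// diff_comp//= -(deriveE (1 : R) dg) gv -Df deriveE.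
Qed.

Lemma C1_lipschitz f c (r C : R) x y : C1 f ->
  (forall i z, `|z - c| <= r -> `|pd i f z| <= C) ->
  `|x - c| <= r -> `|y - c| <= r -> `|f x - f y| <= n%:R * C * `|x - y|.
Proof.
move=> C1f fC xr yr.
pose F (s : R) := f (y + s *: (x - y)).
have -> : f x - f y = F 1 - F 0 by rewrite /F scale1r scale0r addr0 subrKC.
have dF (s : R) : is_derive s 1 F ('D_(x - y) f (y + s *: (x - y))).
  by apply: is_derive_line; apply/diff_derivable; exact: (C1_differentiable _ C1f).1.
have := derive1_le (M := n%:R * C * `|x - y|) ler01 (fun t _ => dF t)
  (continuous_of_derivable (A := _) dF).
rewrite subr0 mulr1; apply => t /andP[t0 t1].
rewrite (C1_differentiable _ C1f).2 (le_trans (ler_norm_sum _ _ _))//.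
have -> : n%:R * C * `|x - y| = \sum_(i < n) C * `|x - y|.
  by rewrite sumr_const card_ord -mulrA mulr_natl.
apply: ler_sum => i _; rewrite normrM mulrC ler_pM ?ler_coord_normr// fC//.
have -> : y + t *: (x - y) - c = t *: (x - c) + (1 - t) *: (y - c).
  by apply/rowP => k; rewrite !mxE; ring.
have t0' := ltW t0; have t1' : 0 <= 1 - t by rewrite subr_ge0 ltW.
rewrite (le_trans (ler_normD _ _))// !normrZ [`|t|]ger0_norm// [`|1 - t|]ger0_norm//.
have -> : r = t * r + (1 - t) * r by ring.
by rewrite lerD// ler_wpM2l.
Qed.

(** Two uses of the mean value theorem: along [u] for the increment of [f] in direction [w], then
    along [w] for [pd u f]. The second difference itself is symmetric in [u] and [w]. *)
Lemma second_difference f x (u w : 'I_n) (s : R) :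
  C1 f -> C1 (pd u f) -> 0 < s ->
  let e i : 'rV[R]_n := delta_mx 0 i in
  exists2 z : 'rV[R]_n, `|z - x| <= s + s &
   f (x + s *: e u + s *: e w) - f (x + s *: e u) - f (x + s *: e w) + f x =
   s * (s * pd w (pd u f) z).
Proof.
move=> C1f C1uf s0 e.
pose F (r : R) := f (x + s *: e w + r *: e u) - f (x + r *: e u).
have dF (r : R) : is_derive r 1 F
    (pd u f (x + s *: e w + r *: e u) - pd u f (x + r *: e u)).
  by apply: is_deriveB; exact/is_derive_line/(C1f u).1.
have [r] := MVT s0 (fun r _ => dF r) (continuous_of_derivable (A := _) dF).
rewrite in_itv/= => /andP[r0 rs] Fr.
pose G (q : R) := pd u f (x + r *: e u + q *: e w).
have dG (q : R) : is_derive q 1 G (pd w (pd u f) (x + r *: e u + q *: e w)).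
  by exact/is_derive_line/(C1uf w).1.
have [q] := MVT s0 (fun r _ => dG r) (continuous_of_derivable (A := _) dG).
rewrite in_itv/= => /andP[q0 qs] Gq.
exists (x + r *: e u + q *: e w).
  have ne i : `|e i| <= 1.
    by apply: normr_rV_le => // j; rewrite mxE eqxx/= ger0_norm ?ler0n// lern1 leq_b1.
  have -> : x + r *: e u + q *: e w - x = r *: e u + q *: e w.
    by apply/rowP => k; rewrite !mxE; ring.
  rewrite (le_trans (ler_normD _ _))// !normrZ !gtr0_norm//.
  by rewrite lerD// -[leRHS]mulr1 ler_pM// ltW.
move: Fr Gq; rewrite /F /G !subr0 !scale0r !addr0 => Fr Gq.
rewrite [s * pd _ _ _]mulrC -Gq mulrC [x + r *: _ + s *: _]addrAC -Fr.
by rewrite [x + s *: e w + _]addrAC; ring.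
Qed.

(** Schwarz's theorem: one second difference, evaluated in both orders, gives the two mixed
    derivatives a common value at points [z1], [z2] close to [x], and both are continuous. *)
Lemma pd_comm f x (u w : 'I_n) : C1 f -> (forall i, C1 (pd i f)) ->
  pd u (pd w f) x = pd w (pd u f) x.
Proof.
move=> C1f C1df; apply/eqP; rewrite -subr_eq0 -normr_eq0.
rewrite eq_le normr_ge0 andbT; apply/ler_addgt0Pl => e e0; rewrite addr0.
have e20 : 0 < e / 2 by rewrite divr_gt0.
have /cvgrPdist_le/(_ _ e20)/nbhs_normP[d1 /= d10 H1] := (C1df w u).2 x.
have /cvgrPdist_le/(_ _ e20)/nbhs_normP[d2 /= d20 H2] := (C1df u w).2 x.
pose s := Num.min d1 d2 / 4.
have m0 : 0 < Num.min d1 d2 by rewrite lt_min d10.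
have s0 : 0 < s by rewrite divr_gt0.
have ss : s + s < Num.min d1 d2 by rewrite /s; lra.
have := ss; rewrite lt_min => /andP[sd1 sd2].
have [z1 z1x E1] := @second_difference f x u w s C1f (C1df u) s0.
have [z2 z2x E2] := @second_difference f x w u s C1f (C1df w) s0.
have aux (a b p q q' r : R) : p - q - q' + r = s * (s * a) ->
    p - q' - q + r = s * (s * b) -> b = a.
  move=> Ha Hb; have s_neq0 := lt0r_neq0 s0.
  by apply: (mulfI s_neq0); apply: (mulfI s_neq0); rewrite -Ha -Hb; ring.
have tri (a b c : R) : `|a - c| <= e / 2 -> `|b - c| <= e / 2 -> `|a - b| <= e.
  move=> ac bc; rewrite -(subrKA c) (le_trans (ler_normD _ _))// [e]splitr.
  by rewrite lerD// distrC.
have E : pd u (pd w f) z2 = pd w (pd u f) z1.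
  move: E2; rewrite [x + s *: delta_mx 0 w + s *: delta_mx 0 u]addrAC.
  exact: aux E1.
apply: (tri _ _ (pd u (pd w f) z2)).
  by apply: H1 => /=; rewrite distrC (le_lt_trans z2x).
by rewrite E; apply: H2 => /=; rewrite distrC (le_lt_trans z1x).
Qed.

End Differentiability.

(** * Convergent families of smooth functions and vector fields *)

Lemma closed_norm_ball {R : realType} {n : nat} (r : R) :
  closed [set x : 'rV[R]_n | `|x| <= r].
Proof.
have -> : [set x : 'rV[R]_n | `|x| <= r] = (fun x => `|x|) @^-1` [set y | y <= r] by [].
by apply: preimage_closed => [x _|]; [exact: norm_continuous|exact: closed_le].
Qed.

Lemma compact_norm_ball {R : realType} {n : nat} (r : R) :
  compact [set x : 'rV[R]_n | `|x| <= r].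
Proof.
apply: bounded_closed_compact; last exact: closed_norm_ball.
by exists r; split; rewrite ?num_real// => s rs x /= /le_trans; apply; exact: ltW.
Qed.

Lemma continuous_norm_ball_bounded {R : realType} {n : nat} (V : normedModType R)
    (f : 'rV[R]_n -> V) (r : R) : continuous f ->
  exists2 C : R, 0 <= C & forall x, `|x| <= r -> `|f x| <= C.
Proof.
move=> cf.
have /compact_bounded[C [_ HC]] := continuous_compact
  (continuous_subspaceT (A := [set x : 'rV[R]_n | `|x| <= r]) cf) (@compact_norm_ball _ _ r).
exists (`|C| + 1); first by rewrite addr_ge0.
move=> x xr; apply: (HC (`|C| + 1)); last by exists x.
by rewrite (le_lt_trans (ler_norm _))// ltrDl.
Qed.

Section Families.
Context {R : realType} {n : nat}.
(* The index [Some j] is the j-th member of a sequence, [None] is its limit. *)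
Notation family := (option nat -> 'rV[R]_n -> R).
Implicit Types (f g : family) (a : option nat) (x : 'rV[R]_n).

Definition cvg_fam f := (forall a, continuous (f a)) /\
  forall r e : R, 0 < e -> exists J, forall j, (J <= j)%N ->
    forall x, `|x| <= r -> `|f (Some j) x - f None x| <= e.

Definition pd_fam (i : 'I_n) f : family := fun a => pd i (f a).

(** Convergence of all derivatives up to order [k], by recursion on partial derivatives rather than
    over multi-indices, so that closure properties follow by induction from the rules for a single
    derivative. *)
Fixpoint cvgC k f : Prop := cvg_fam f /\
  if k is k'.+1 then forall i, (forall a x, derivable (f a) x (delta_mx 0 i)) /\
    cvgC k' (pd_fam i f) else True.

Definition smooth_fam f := forall k, cvgC k f.

Lemma cvgC0 k f : cvgC k f -> cvg_fam f.
Proof. by case: k => [|k] []. Qed.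

Lemma cvgCW k f : cvgC k.+1 f -> cvgC k f.
Proof.
elim: k f => [|k IH] f [cf df]; first by split.
by split => // i; have [dfi cfi] := df i; split => //; exact: IH.
Qed.

(** The tail is within 1 of the limit, and the finitely many other members are bounded by
    compactness. The bounds independent of the index originate here. *)
Lemma cvg_fam_bounded f : cvg_fam f -> forall r, exists2 C : R, 0 <= C &
  forall a x, `|x| <= r -> `|f a x| <= C.
Proof.
move=> [cf fC] r; have [J HJ] := fC r 1 ltr01.
have [C0 C00 H0] := continuous_norm_ball_bounded r (cf None).
have [C1 C10 H1] : exists2 C1 : R, 0 <= C1 &
    forall j x, (j < J)%N -> `|x| <= r -> `|f (Some j) x| <= C1.
  elim: J {HJ} => [|J [C1 C10 H1]]; first by exists 0.
  have [C2 C20 H2] := continuous_norm_ball_bounded r (cf (Some J)).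
  exists (C1 + C2) => [|j x]; first exact: addr_ge0.
  rewrite ltnS leq_eqVlt => /predU1P[->|jJ] xr.
    by rewrite (le_trans (H2 _ xr))// lerDr.
  by rewrite (le_trans (H1 _ _ jJ xr))// lerDl.
exists (C0 + C1 + 1) => [|[j|] x xr]; first by rewrite !addr_ge0.
  have [/HJ H|jJ] := leqP J j.
    rewrite -(subrK (f None x) (f _ x)) (le_trans (ler_normD _ _))//.
    by have := H _ xr; have := H0 _ xr; lra.
  by have := H1 _ _ jJ xr; lra.
by have := H0 _ xr; lra.
Qed.

Lemma cvg_famD f g : cvg_fam f -> cvg_fam g -> cvg_fam (f + g).
Proof.
move=> [cf Hf] [cg Hg]; split=> [a x|r e e0].
  by apply: continuousD; [exact: cf|exact: cg].
have e20 : 0 < e / 2 by rewrite divr_gt0.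
have [J1 H1] := Hf r _ e20; have [J2 H2] := Hg r _ e20.
exists (maxn J1 J2) => j; rewrite geq_max => /andP[/H1 {}H1 /H2 {}H2] x xr.
have -> : (f + g) (Some j) x - (f + g) None x =
  (f (Some j) x - f None x) + (g (Some j) x - g None x) by rewrite !fctE; ring.
by rewrite (le_trans (ler_normD _ _))// [e]splitr lerD// ?H1 ?H2.
Qed.

Lemma cvg_famM f g : cvg_fam f -> cvg_fam g -> cvg_fam (f * g).
Proof.
move=> Cf Cg; have [cf Hf] := Cf; have [cg Hg] := Cg; split=> [a x|r e e0].
  by apply: continuousM; [exact: cf|exact: cg].
have [A A0 HA] := cvg_fam_bounded Cf r; have [B B0 HB] := cvg_fam_bounded Cg r.
pose d := e / (A + B + 1).
have AB : 0 < A + B + 1 by rewrite ltr_pwDr// addr_ge0.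
have d0 : 0 < d by rewrite divr_gt0.
have [J1 H1] := Hf r _ d0; have [J2 H2] := Hg r _ d0.
exists (maxn J1 J2) => j; rewrite geq_max => /andP[/H1 {}H1 /H2 {}H2] x xr.
have -> : (f * g) (Some j) x - (f * g) None x =
  f (Some j) x * (g (Some j) x - g None x) + (f (Some j) x - f None x) * g None x.
  by rewrite !fctE; ring.
have -> : e = A * d + d * B + d by rewrite /d; field; rewrite gt_eqF.
have ds := ltW d0.
rewrite ler_wpDr// (le_trans (ler_normD _ _))// !normrM.
by rewrite lerD// ler_pM// ?HA ?HB ?H1 ?H2.
Qed.

Lemma pd_famD i f g : (forall a x, derivable (f a) x (delta_mx 0 i)) ->
  (forall a x, derivable (g a) x (delta_mx 0 i)) ->
  pd_fam i (f + g) = pd_fam i f + pd_fam i g.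
Proof.
move=> df dg; apply/funext => a; apply/funext => x.
by rewrite /pd_fam /pd !fctE (deriveD (df a x) (dg a x)).
Qed.

Lemma pd_famM i f g : (forall a x, derivable (f a) x (delta_mx 0 i)) ->
  (forall a x, derivable (g a) x (delta_mx 0 i)) ->
  pd_fam i (f * g) = f * pd_fam i g + pd_fam i f * g.
Proof.
move=> df dg; apply/funext => a; apply/funext => x.
rewrite /pd_fam /pd !fctE (deriveM (df a x) (dg a x)).
by congr (_ + _); rewrite mulrC.
Qed.

Lemma cvgCD k f g : cvgC k f -> cvgC k g -> cvgC k (f + g).
Proof.
elim: k f g => [|k IH] f g [cf df] [cg dg]; split => //; try exact: cvg_famD.
move=> i; have [dfi cfi] := df i; have [dgi cgi] := dg i; split => [a x|].
  exact: derivableD.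
by rewrite pd_famD//; exact: IH.
Qed.

Lemma cvgCM k f g : cvgC k f -> cvgC k g -> cvgC k (f * g).
Proof.
elim: k f g => [|k IH] f g Cf Cg.
  by split => //; apply: cvg_famM; [case: Cf|case: Cg].
split => [|i]; first by apply: cvg_famM; [case: Cf|case: Cg].
have [_ /(_ i)[dfi cfi]] := Cf; have [_ /(_ i)[dgi cgi]] := Cg.
split => [a x|]; first exact: derivableM.
by rewrite pd_famM//; apply: cvgCD; apply: IH => //; exact: cvgCW.
Qed.

Lemma smooth_famD f g : smooth_fam f -> smooth_fam g -> smooth_fam (f + g).
Proof. by move=> sf sg k; exact: cvgCD. Qed.

Lemma smooth_famM f g : smooth_fam f -> smooth_fam g -> smooth_fam (f * g).
Proof. by move=> sf sg k; exact: cvgCM. Qed.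

Lemma smooth_fam_cst (c : R) : smooth_fam (fun _ _ => c).
Proof.
have cC (d : R) : cvg_fam (fun _ _ => d).
  split=> [a|r e e0]; first exact: cst_continuous.
  by exists 0%N => j _ x _; rewrite subrr normr0 ltW.
move=> k; elim: k c => [|k IH] c; split => // i; split=> [a x|]; first exact: derivable_cst.
have -> : pd_fam i (fun _ _ => c) = fun _ _ => 0; last exact: IH.
by apply/funext => a; apply/funext => x; exact: derive_cst.
Qed.

Lemma smooth_fam0 : smooth_fam 0. Proof. exact: smooth_fam_cst. Qed.

Lemma smooth_famZ (c : R) f : smooth_fam f -> smooth_fam (c *: f).
Proof. by move=> sf; exact: (smooth_famM (smooth_fam_cst c) sf). Qed.

Lemma smooth_famN f : smooth_fam f -> smooth_fam (- f).
Proof. by move=> /(smooth_famZ (-1)); rewrite scaleN1r. Qed.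

Lemma smooth_famB f g : smooth_fam f -> smooth_fam g -> smooth_fam (f - g).
Proof. by move=> sf sg; exact/smooth_famD/smooth_famN. Qed.

Lemma smooth_fam_sum (I : Type) (r : seq I) (P : pred I) (F : I -> family) :
  (forall i, P i -> smooth_fam (F i)) -> smooth_fam (\sum_(i <- r | P i) F i).
Proof.
move=> sF; elim/big_ind: _ => //; [exact: smooth_fam0|exact: smooth_famD].
Qed.

Lemma smooth_fam_pd i f : smooth_fam f -> smooth_fam (pd_fam i f).
Proof. by move=> sf k; have [_ /(_ i)[]] := sf k.+1. Qed.

Lemma smooth_fam_cvg f : smooth_fam f -> cvg_fam f.
Proof. by move=> sf; exact: cvgC0 (sf 0%N). Qed.

Lemma smooth_fam_C1 f a : smooth_fam f -> C1 (f a).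
Proof.
move=> sf i; have [_ /(_ i)[d [[C _] _]]] := sf 1%N.
by split => //; exact: C.
Qed.

Lemma smooth_fam_derivable i f a x : smooth_fam f -> derivable (f a) x (delta_mx 0 i).
Proof. by move=> /smooth_fam_C1 => /(_ a i)[]. Qed.

Definition coord_fam (i : 'I_n) : family := fun _ x => x 0 i.

Lemma pd_coord i j : pd_fam i (coord_fam j) = fun _ _ => (j == i)%:R.
Proof.
apply/funext => a; apply/funext => x.
have := derive_mx (@derivable_id _ _ x (delta_mx 0 i : 'rV[R]_n)).
rewrite derive_id => /(congr1 (fun M : 'rV[R]_n => M 0 j)); rewrite !mxE eqxx/= => E.
exact: esym E.
Qed.

Lemma smooth_fam_coord i : smooth_fam (coord_fam i).
Proof.
have cC : cvg_fam (coord_fam i).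
  split=> [a x|r e e0]; first exact: coord_continuous.
  by exists 0%N => j _ x _; rewrite subrr normr0 ltW.
case=> [|k]; split => // j; split => [a x|].
  apply/(derivable_mxP (fun y : 'rV[R]_n => y) x (delta_mx 0 j)).1.
  exact: derivable_id.
by rewrite pd_coord; exact: smooth_fam_cst.
Qed.

End Families.

Notation family R n := (option nat -> 'rV[R]_n -> R).

(** * Lie derivatives and brackets of families *)

Section VectorFamilies.
Context {R : realType} {n : nat}.
Implicit Types (f g : family R n) (a : option nat) (x : 'rV[R]_n).
Implicit Types (V Y Z : option nat -> vfield R n).

Definition comp_fam V (i : 'I_n) : family R n := fun a x => V a x 0 i.

Definition smooth_vfam V := forall i, smooth_fam (comp_fam V i).

Definition lieD V f : family R n := \sum_i comp_fam V i * pd_fam i f.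

Lemma lieDE V f a x : lieD V f a x = \sum_i V a x 0 i * pd i (f a) x.
Proof. by rewrite /lieD !fct_sumE. Qed.

Lemma lieD_derive V f a x : smooth_fam f -> lieD V f a x = 'D_(V a x) (f a) x.
Proof.
by move=> sf; rewrite lieDE (C1_differentiable _ (smooth_fam_C1 a sf)).2.
Qed.

Lemma smooth_lieD V f : smooth_vfam V -> smooth_fam f -> smooth_fam (lieD V f).
Proof.
move=> sV sf; apply: smooth_fam_sum => i _; apply: smooth_famM => //.
exact: smooth_fam_pd.
Qed.

Lemma lieD_add V f g : smooth_fam f -> smooth_fam g ->
  lieD V (f + g) = lieD V f + lieD V g.
Proof.
move=> sf sg; rewrite /lieD -big_split/=; apply: eq_bigr => i _.
by rewrite pd_famD ?mulrDr// => a x; exact: smooth_fam_derivable.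
Qed.

Lemma lieD_cst V (c : R) : lieD V (fun _ _ => c) = 0.
Proof.
apply/funext => a; apply/funext => x.
by rewrite lieDE big1// => i _; rewrite /pd derive_cst mulr0.
Qed.

Lemma lieDZ V (c : R) f : smooth_fam f -> lieD V (c *: f) = c *: lieD V f.
Proof.
move=> sf; apply/funext => a; apply/funext => x.
rewrite lieDE.
rewrite (_ : (c *: lieD V f) a x = c * lieD V f a x)// lieDE mulr_sumr.
apply: eq_bigr => i _; rewrite mulrCA; congr (_ * _).
by rewrite /pd (deriveZ c (smooth_fam_derivable (i := i) (a := a) (x := x) sf)).
Qed.

Lemma lieDM V f g : smooth_fam f -> smooth_fam g ->
  lieD V (f * g) = f * lieD V g + lieD V f * g.
Proof.
move=> sf sg; rewrite /lieD mulr_sumr mulr_suml -big_split/=.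
apply: eq_bigr => i _.
rewrite pd_famM; [|by move=> a x; exact: smooth_fam_derivable..].
by rewrite mulrDr mulrCA; congr (_ + _); exact: mulrA.
Qed.

Lemma lieD_sum V (I : Type) (r : seq I) (P : pred I) (F : I -> family R n) :
  (forall i, smooth_fam (F i)) ->
  lieD V (\sum_(i <- r | P i) F i) = \sum_(i <- r | P i) lieD V (F i).
Proof.
move=> sF; elim: r => [|i r IH]; first by rewrite !big_nil; exact: lieD_cst.
rewrite !big_cons; case: ifP => // Pi.
by rewrite lieD_add ?IH//; exact: smooth_fam_sum.
Qed.

Definition bracket_fam Y Z : option nat -> vfield R n := fun a => lie_bracket (Y a) (Z a).

Lemma vfam_derivable V a x v : smooth_vfam V -> derivable (V a) x v.
Proof.
move=> sV; apply/derivable_mxP => k j; rewrite (ord1 k).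
exact/diff_derivable/(C1_differentiable _ (smooth_fam_C1 a (sV j))).1.
Qed.

Lemma comp_bracket Y Z i : smooth_vfam Y -> smooth_vfam Z ->
  comp_fam (bracket_fam Y Z) i = lieD Y (comp_fam Z i) - lieD Z (comp_fam Y i).
Proof.
move=> sY sZ; apply/funext => a; apply/funext => x.
rewrite [RHS](_ : _ = lieD Y (comp_fam Z i) a x - lieD Z (comp_fam Y i) a x)//.
rewrite !lieD_derive// /comp_fam /bracket_fam /lie_bracket !derive_mx ?mxE//.
  exact: vfam_derivable.
exact: vfam_derivable.
Qed.

Lemma smooth_bracket Y Z : smooth_vfam Y -> smooth_vfam Z ->
  smooth_vfam (bracket_fam Y Z).
Proof.
by move=> sY sZ i; rewrite comp_bracket//; apply: smooth_famB; exact: smooth_lieD.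
Qed.

(** In coordinates, the second-order terms of the two compositions agree by symmetry of second
    derivatives and cancel; the first-order terms left are the components of the bracket. *)
Lemma lieD_bracket Y Z f : smooth_vfam Y -> smooth_vfam Z -> smooth_fam f ->
  lieD (bracket_fam Y Z) f = lieD Y (lieD Z f) - lieD Z (lieD Y f).
Proof.
have main Y' Z' : smooth_vfam Y' -> smooth_vfam Z' -> smooth_fam f ->
    lieD Y' (lieD Z' f) = \sum_i \sum_j comp_fam Z' i * (comp_fam Y' j * pd_fam j (pd_fam i f))
      + \sum_i lieD Y' (comp_fam Z' i) * pd_fam i f.
  move=> sY sZ sf; rewrite {2}/lieD lieD_sum; last first.
    by move=> i; apply: smooth_famM => //; exact: smooth_fam_pd.
  rewrite -big_split/=; apply: eq_bigr => i _.
  rewrite lieDM//; last exact: smooth_fam_pd.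
  by rewrite {1}/lieD mulr_sumr.
move=> sY sZ sf; rewrite !main// exchange_big/=.
rewrite [X in _ = X + _ - _](_ : _ =
    \sum_i \sum_j comp_fam Y i * (comp_fam Z j * pd_fam j (pd_fam i f))); last first.
  apply: eq_bigr => i _; apply: eq_bigr => j _.
  rewrite (mulrCA (comp_fam Z j)).
  suff -> : pd_fam i (pd_fam j f) = pd_fam j (pd_fam i f) by [].
  apply/funext => a; apply/funext => x.
  apply: pd_comm; first exact: smooth_fam_C1.
  by move=> k; exact: (smooth_fam_C1 a (smooth_fam_pd k sf)).
have cancel (A B D : family R n) : A + B - (A + D) = B - D.
  by rewrite opprD addrACA subrr add0r.
apply: etrans (esym (cancel _ _ _)).
by rewrite /lieD -sumrB; apply: eq_bigr => i _; rewrite comp_bracket// mulrBl.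
Qed.

End VectorFamilies.

Section IterPartial.
Context {R : realType} {n : nat}.

Definition fam_of (Yj : nat -> vfield R n) (Y : vfield R n) (a : option nat) :
  vfield R n := if a is Some j then Yj j else Y.

Lemma smooth_vfam_of (Yj : nat -> vfield R n) (Y : vfield R n) :
  smooth Y -> (forall j, smooth (Yj j)) -> cvg_smooth_loc Yj Y ->
  smooth_vfam (fam_of Yj Y).
Proof.
move=> sY sYj cY i.
have sfam a : smooth (fam_of Yj Y a) by case: a.
(* Generalized to every iterated partial derivative: differentiating once lengthens [s] and lowers
   the order [k]. *)
suff H k s : cvgC k (comp_fam (fun a => iter_partial s (fam_of Yj Y a)) i).
  by move=> k; exact: (H k [::]).
elim: k s => [|k IH] s.
- split => //; split => [a x|r e e0].
    apply: (@continuous_comp _ _ _ (iter_partial s (fam_of Yj Y a))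
      (fun v : 'rV[R]_n => v 0 i)); first exact: (sfam a s).1.
    exact: coord_continuous.
  have := cY s _ (@compact_norm_ball _ _ r).
  have E : entourage [set xy : 'rV[R]_n * 'rV[R]_n | ball xy.1 e xy.2].
    exact: entourage_ball (PosNum e0).
  move=> /(_ [set h | forall y, `|y| <= r -> ball (iter_partial s Y y) e (h y)]).
  have nb : nbhs (iter_partial s Y : {uniform` [set x : 'rV[R]_n | `|x| <= r] -> _})
     [set h | forall y, `|y| <= r -> ball (iter_partial s Y y) e (h y)].
    by apply/uniform_nbhs; eexists; split; [exact: E|].
  move=> /(_ nb)[J _ HJ]; exists J => j /HJ /= H x /H.
  rewrite -ball_normE /= => /ltW; apply: le_trans.
  rewrite distrC; apply: le_trans (ler_coord_normr _ i).
  by rewrite !mxE.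
- split=> [|p]; first exact: cvgC0 (IH s).
  split=> [a x|].
    exact: ((derivable_mxP _ _ _).1 ((sfam a s).2 p x)).
  have -> : pd_fam p (comp_fam (fun a => iter_partial s (fam_of Yj Y a)) i) =
     comp_fam (fun a => iter_partial (p :: s) (fam_of Yj Y a)) i.
    apply/funext => a; apply/funext => x.
    by rewrite /comp_fam /= derive_mx ?mxE//; exact: (sfam a s).2.
  exact: IH.
Qed.

End IterPartial.

(** * Formal exponentials and commutator words *)

Lemma sum_triangle (V : zmodType) (G : nat -> nat -> V) k :
  \sum_(i < k.+1) \sum_(j < (k - i).+1) G i j =
  \sum_(q < k.+1) \sum_(i < q.+1) G i (q - i)%N.
Proof.
elim: k => [|k IH]; first by rewrite !big_ord1.
rewrite [RHS]big_ord_recr/= -IH [LHS]big_ord_recr/= subnn big_ord1.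
rewrite [\sum_(i < k.+2) _]big_ord_recr/= subnn addrA; congr (_ + _).
rewrite -big_split/=; apply: eq_bigr => i _.
by rewrite subSn ?big_ord_recr// -ltnS.
Qed.

(** The coefficient of degree [q] in exp(t) exp(-t) = 1, read off from the binomial expansion of (-1
    + 1)^q. *)
Lemma sum_exp_opp (K : numFieldType) q :
  \sum_(i < q.+1) (i`!%:R)^-1 * ((q - i)`!%:R^-1 * (-1) ^+ (q - i)) = (q == 0%N)%:R :> K.
Proof.
have fact_neq0 i : i`!%:R != 0 :> K by rewrite pnatr_eq0 -lt0n fact_gt0.
have := exprDn (-1 : K) 1 q; rewrite addNr expr0n => E.
apply: (mulfI (fact_neq0 q)); rewrite [RHS](_ : _ = (q == 0%N)%:R); last first.
  by case: q {E} => [|q] /=; rewrite ?mulr0// fact0 mulr1.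
rewrite E mulr_sumr; apply: eq_bigr => i _.
have Hi : (i <= q)%N by rewrite -ltnS.
have -> : q`!%:R = 'C(q, i)%:R * (i`!%:R * (q - i)`!%:R) :> K.
  by rewrite -!natrM bin_fact.
rewrite expr1n mulr1 -[RHS]mulr_natr.
have := fact_neq0 i; have := fact_neq0 (q - i)%N.
move: (i`!%:R) ((q - i)`!%:R) => u v v0 u0.
by field; rewrite v0.
Qed.

Section FormalSeries.
Context {R : realType} {n m : nat}.
Variable X : 'I_m -> option nat -> vfield R n.
Hypothesis sX : forall i, smooth_vfam (X i).

Notation series := (nat -> family R n).
Implicit Types (F G : series) (l : bool * 'I_m) (w : seq (bool * 'I_m)).

(** A letter carries a sign bit, [true] standing for the opposite field: flows are run for positive
    times only, so going backwards is a letter of its own. *)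
Definition letter_field l : option nat -> vfield R n :=
  fun a x => (-1) ^+ l.1 *: X l.2 a x.

Definition letter_inv l := (~~ l.1, l.2).

Definition word_inv w := rev (map letter_inv w).

Lemma letter_field_inv l a x : letter_field (letter_inv l) a x = - letter_field l a x.
Proof. by rewrite /letter_field/= signrN scaleNr. Qed.

Lemma smooth_letter l : smooth_vfam (letter_field l).
Proof.
move=> i; have -> : comp_fam (letter_field l) i = (-1) ^+ l.1 *: comp_fam (X l.2) i.
  by apply/funext => a; apply/funext => x; rewrite /comp_fam mxE.
exact/smooth_famZ/sX.
Qed.

Lemma lieD_letter_inv l f : lieD (letter_field (letter_inv l)) f = - lieD (letter_field l) f.
Proof.
apply/funext => a; apply/funext => x.
rewrite [RHS](_ : _ = - lieD (letter_field l) f a x)// !lieDE -sumrN.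
by apply: eq_bigr => i _; rewrite letter_field_inv mxE mulNr.
Qed.

Definition smooth_series F := forall k, smooth_fam (F k).

Lemma smooth_seriesB F G : smooth_series F -> smooth_series G -> smooth_series (F - G).
Proof. by move=> sF sG k; exact: smooth_famB. Qed.

Lemma smooth_iter_lieD l i f : smooth_fam f -> smooth_fam (iter i (lieD (letter_field l)) f).
Proof. by move=> sf; elim: i => //= i IH; exact/smooth_lieD/IH/smooth_letter. Qed.

Lemma iter_lieDD l i f g : smooth_fam f -> smooth_fam g ->
  iter i (lieD (letter_field l)) (f + g) =
  iter i (lieD (letter_field l)) f + iter i (lieD (letter_field l)) g.
Proof.
by move=> sf sg; elim: i => //= i ->; rewrite lieD_add//; exact: smooth_iter_lieD.
Qed.

Lemma iter_lieDZ l i (c : R) f : smooth_fam f ->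
  iter i (lieD (letter_field l)) (c *: f) = c *: iter i (lieD (letter_field l)) f.
Proof.
by move=> sf; elim: i => //= i ->; rewrite lieDZ//; exact: smooth_iter_lieD.
Qed.

Lemma iter_lieD0 l i : iter i (lieD (letter_field l)) 0 = 0 :> family R n.
Proof. by elim: i => //= i ->; exact: lieD_cst. Qed.

Lemma iter_lieD_sum l i (I : Type) (r : seq I) (H : I -> family R n) :
  (forall j, smooth_fam (H j)) ->
  iter i (lieD (letter_field l)) (\sum_(j <- r) H j) =
  \sum_(j <- r) iter i (lieD (letter_field l)) (H j).
Proof.
move=> sH; elim: r => [|j r IH]; first by rewrite !big_nil iter_lieD0.
by rewrite !big_cons iter_lieDD ?IH//; exact: smooth_fam_sum.
Qed.

Lemma iter_lieD_inv l i f : smooth_fam f ->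
  iter i (lieD (letter_field (letter_inv l))) f =
  (-1) ^+ i *: iter i (lieD (letter_field l)) f.
Proof.
move=> sf; elim: i => [|i IH]; first by rewrite expr0 scale1r.
rewrite !iterS IH lieD_letter_inv lieDZ ?exprS ?mulN1r ?scaleNr//.
exact: smooth_iter_lieD.
Qed.

(* The action of exp(t V) on formal power series in t whose coefficients are
   families of smooth functions; [F k] is the coefficient of [t ^ k]. *)
Definition texp l F : series := fun k =>
  \sum_(i < k.+1) (i`!%:R)^-1 *: iter i (lieD (letter_field l)) (F (k - i)%N).

(** The head letter acts last although its flow is run first: after the flow of V followed by that
    of W, the value of f at the endpoint is exp(tV) exp(tW) f at the start. *)
Definition tword w F := foldr texp F w.

Lemma smooth_texp l F : smooth_series F -> smooth_series (texp l F).
Proof.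
move=> sF k; apply: smooth_fam_sum => i _; apply: smooth_famZ.
exact: smooth_iter_lieD.
Qed.

Lemma smooth_tword w F : smooth_series F -> smooth_series (tword w F).
Proof. by move=> sF; elim: w => //= l w IH; exact: smooth_texp. Qed.

Lemma tword_cat w1 w2 F : tword (w1 ++ w2) F = tword w1 (tword w2 F).
Proof. by rewrite /tword foldr_cat. Qed.

Lemma texpD l F G : smooth_series F -> smooth_series G ->
  texp l (F + G) = texp l F + texp l G.
Proof.
move=> sF sG; apply/funext => k.
rewrite [RHS](_ : _ = texp l F k + texp l G k)// /texp -big_split/=.
by apply: eq_bigr => i _; rewrite -scalerDr -iter_lieDD.
Qed.

Lemma twordD w F G : smooth_series F -> smooth_series G ->
  tword w (F + G) = tword w F + tword w G.
Proof.
by move=> sF sG; elim: w => //= l w ->; rewrite texpD//; exact: smooth_tword.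
Qed.

Definition tshift F : series := fun k => if k is k'.+1 then F k' else 0.

Lemma texp_shift l F : texp l (tshift F) = tshift (texp l F).
Proof.
apply/funext => -[|k]; first by rewrite /texp big_ord1/= scaler0.
rewrite /texp big_ord_recr/= subnn/= iter_lieD0.
rewrite (lieD_cst (letter_field l) 0) scaler0 addr0.
by apply: eq_bigr => i _; rewrite subSn// -ltnS.
Qed.

Lemma tword_shift w F i : tword w (iter i tshift F) = iter i tshift (tword w F).
Proof.
elim: i F => // i IH F; rewrite iterSr IH iterSr; congr (iter _ _ _).
by elim: w {IH} => //= l w ->; rewrite texp_shift.
Qed.

(** Up to signs both exponentials involve powers of one derivation, so summing along i + j = q
    leaves the coefficients of exp(t) exp(-t). *)
Lemma texp_inv l F : smooth_series F -> texp l (texp (letter_inv l) F) = F.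
Proof.
move=> sF; apply/funext => k; rewrite {1}/texp.
pose D i f : family R n := iter i (lieD (letter_field l)) f.
pose G i j : family R n :=
  ((i`!%:R)^-1 * ((j`!%:R)^-1 * (-1) ^+ j)) *: D (i + j)%N (F (k - (i + j))%N).
transitivity (\sum_(i < k.+1) \sum_(j < (k - i).+1) G i j).
  apply: eq_bigr => i _; rewrite iter_lieD_sum; last first.
    by move=> j; apply: smooth_famZ; exact: smooth_iter_lieD.
  rewrite scaler_sumr; apply: eq_bigr => j _.
  rewrite iter_lieDZ; last exact: smooth_iter_lieD.
  rewrite iter_lieD_inv// iter_lieDZ; last exact: smooth_iter_lieD.
  by rewrite !scalerA /G /D iterD subnDA.
rewrite sum_triangle.
transitivity (\sum_(q < k.+1) ((q == 0 :> nat)%:R : R) *: D q (F (k - q)%N)).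
  apply: eq_bigr => q _; rewrite -sum_exp_opp scaler_suml.
  by apply: eq_bigr => i _; rewrite /G subnKC// -ltnS.
by rewrite big_ord_recl big1 ?addr0 ?scale1r ?subn0// => i _; rewrite scale0r.
Qed.

Lemma tword_inv w F : smooth_series F -> tword w (tword (word_inv w) F) = F.
Proof.
move=> sF; elim: w F sF => // l w IH F sF.
rewrite /word_inv/= rev_cons -cats1 tword_cat IH; last exact: smooth_texp.
exact: texp_inv.
Qed.

Lemma tword0 w F : tword w F 0%N = F 0%N.
Proof.
by elim: w => //= l w <-; rewrite /texp big_ord1/= subn0 fact0 invr1 scale1r.
Qed.

(* [tword w] is the identity plus [t ^ k U] up to higher order terms. *)
Definition leads w k (U : family R n -> family R n) := forall F, smooth_series F ->
  (forall i, (i < k)%N -> tword w F i = F i) /\ tword w F k = F k + U (F 0%N).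

(** A series starting at order [p] is t^p times another one. Multiplication by t commutes with
    [tword], so the two orders add up. *)
Lemma leads_vanishing w k U p G : leads w k U -> smooth_series G ->
  (forall i, (i < p)%N -> G i = 0) ->
  (forall i, (i < k + p)%N -> tword w G i = G i) /\
  tword w G (k + p)%N = G (k + p)%N + U (G p).
Proof.
move=> lw sG G0; pose H : series := fun i => G (i + p)%N.
have iterE (F : series) i : iter p tshift F i = if (i < p)%N then 0 else F (i - p)%N.
  elim: p {G0 H} i => [|p IH] i; first by rewrite subn0.
  by case: i => [|i] //=; rewrite IH ltnS subSS.
have GE : G = iter p tshift H.
  apply/funext => i; rewrite iterE; case: ltnP => [/G0//|pi].
  by rewrite /H subnK.
have [H1 H2] := lw H (fun i => sG _).
split=> [i ik|].
  rewrite {1}GE tword_shift iterE; case: ltnP => [/G0//|pi].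
  by rewrite H1 /H ?subnK// ltn_subLR// addnC.
rewrite {1}GE tword_shift iterE ltnNge leq_addl/= addnK H2.
by rewrite /H add0n.
Qed.

(* Writing [A], [B] for the two actions,
   [AB - BA = (A - 1)(B - 1) - (B - 1)(A - 1)], applied to [A^-1 B^-1 F]. *)
Lemma leads_commutator w1 w2 k1 k2 U1 U2 :
  leads w1 k1 U1 -> leads w2 k2 U2 ->
  leads (w1 ++ w2 ++ word_inv w1 ++ word_inv w2) (k1 + k2)
    (fun f => U1 (U2 f) - U2 (U1 f)).
Proof.
move=> l1 l2 F sF.
pose G := tword (word_inv w1) (tword (word_inv w2) F).
have sG : smooth_series G by do 2!apply: smooth_tword.
have G0 : G 0%N = F 0%N by rewrite /G !tword0.
have FE : F = tword w2 (tword w1 G).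
  by rewrite /G tword_inv ?tword_inv//; exact: smooth_tword.
rewrite !tword_cat -/G.
(* Up to order i + j, the product of the two actions on [G] is their sum minus [G], plus the term
   [U (V (G 0))] at order i + j. The symmetric part is the same for both orders of the factors, one
   of which gives back [F]. *)
have aux u v i j (U V : family R n -> family R n) : leads u i U -> leads v j V ->
    (forall q, (q < i + j)%N -> tword u (tword v G) q = tword u G q + tword v G q - G q) /\
    tword u (tword v G) (i + j)%N =
      tword u G (i + j)%N + tword v G (i + j)%N - G (i + j)%N + U (V (G 0%N)).
  move=> lu lv; pose B := tword v G - G.
  have sB : smooth_series B by apply: smooth_seriesB => //; exact: smooth_tword.
  have [v1 v2] := lv G sG.
  have B0 q : (q < j)%N -> B q = 0.
    by move=> qj; rewrite /B [LHS](_ : _ = tword v G q - G q)// v1// subrr.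
  have Bj : B j = V (G 0%N).
    by rewrite /B [LHS](_ : _ = tword v G j - G j)// v2 addrC addKr.
  have [H1 H2] := leads_vanishing lu sB B0.
  have E : tword u (tword v G) = tword u G + tword u B.
    by rewrite -twordD// /B subrKC.
  split=> [q qij|].
    rewrite E [LHS](_ : _ = tword u G q + tword u B q)// H1//.
    by rewrite [B q](_ : _ = tword v G q - G q)// addrA.
  rewrite E [LHS](_ : _ = tword u G (i + j)%N + tword u B (i + j)%N)// H2 Bj.
  by rewrite [B _](_ : _ = tword v G (i + j)%N - G (i + j)%N)// !addrA.
have [A1 A2] := aux _ _ _ _ _ _ l1 l2; have [B1 B2] := aux _ _ _ _ _ _ l2 l1.
rewrite FE !tword0; split=> [i ik|].
  by rewrite A1// B1 1?addnC// [tword w1 G i + _]addrC.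
rewrite A2 addnC B2 [tword w1 G _ + _]addrC -[RHS]addrA; congr (_ + _).
by rewrite subrKC.
Qed.

(** Formal iterated brackets of signed letters. A field does not remember how it was built, and
    [commutator] lives in [Prop]; the tree is the data from which the degree and the word are
    computed. *)
Inductive btree := Leaf of bool * 'I_m | Br of btree & btree.

Fixpoint teval e : option nat -> vfield R n :=
  match e with
  | Leaf l => letter_field l
  | Br e1 e2 => bracket_fam (teval e1) (teval e2)
  end.

Fixpoint tdeg e : nat :=
  match e with Leaf _ => 1%N | Br e1 e2 => (tdeg e1 + tdeg e2)%N end.

Fixpoint tree_word e : seq (bool * 'I_m) :=
  match e with
  | Leaf l => [:: l]
  | Br e1 e2 => tree_word e1 ++ tree_word e2 ++
      word_inv (tree_word e1) ++ word_inv (tree_word e2)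
  end.

(** Antisymmetry at the root yields the opposite field with the same degree. It is needed because a
    word displaces by t^k times its field with t > 0 only. *)
Definition tneg e : btree :=
  match e with Leaf l => Leaf (letter_inv l) | Br e1 e2 => Br e2 e1 end.

Lemma teval_neg e a x : teval (tneg e) a x = - teval e a x.
Proof.
case: e => [l|e1 e2] /=; first exact: letter_field_inv.
by rewrite /bracket_fam /lie_bracket opprB.
Qed.

Lemma tdeg_gt0 e : (0 < tdeg e)%N.
Proof. by elim: e => //= e1 H1 e2 H2; rewrite addn_gt0 H1. Qed.

Lemma smooth_teval e : smooth_vfam (teval e).
Proof.
by elim: e => [l|e1 H1 e2 H2] /=; [exact: smooth_letter|exact: smooth_bracket].
Qed.

Lemma leads_tree e : leads (tree_word e) (tdeg e) (lieD (teval e)).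
Proof.
elim: e => [l|e1 H1 e2 H2] /=.
  move=> F sF; split=> [i|]; first by rewrite ltnS leqn0 => /eqP ->; rewrite (tword0 [:: l]).
  by rewrite /= /texp big_ord_recl big_ord1/= fact0 /bump/= invr1 !scale1r.
move=> F sF; have [C1 C2] := leads_commutator H1 H2 sF; split => //.
rewrite C2 lieD_bracket//; exact: smooth_teval.
Qed.

Definition coord_series (p : 'I_n) : series :=
  fun k => if k == 0%N then coord_fam p else 0.

Lemma smooth_coord_series p : smooth_series (coord_series p).
Proof. by case=> [|k]; [exact: smooth_fam_coord|exact: smooth_fam0]. Qed.

(** A coordinate function is a series constant in t, so the action of the word on it is a
    displacement, and the orders strictly between 0 and [tdeg e] contribute nothing. *)
Lemma tree_expansion e p (t : R) a x :
  \sum_(k < (tdeg e).+1) t ^+ k * tword (tree_word e) (coord_series p) k a x =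
  x 0 p + t ^+ tdeg e * teval e a x 0 p.
Proof.
have [H1 H2] := leads_tree e (smooth_coord_series p).
rewrite big_ord_recr/= H2; have := tdeg_gt0 e; case: (tdeg e) H1 => // d H1 _.
rewrite big_ord_recl big1 => [|i _].
  rewrite H1//= addr0 expr0 mul1r; congr (_ + _ * _).
  rewrite [LHS](_ : _ = 0 + lieD (teval e) (coord_fam p) a x)// add0r lieDE.
  rewrite (bigD1 p)//= big1 ?addr0.
    by rewrite -/(pd_fam p (coord_fam p) a x) pd_coord eqxx mulr1.
  move=> i ip; rewrite -/(pd_fam i (coord_fam p) a x) pd_coord eq_sym.
  by rewrite (negbTE ip) mulr0.
by rewrite H1 ?mulr0//= /bump/= add1n ltnS.
Qed.

End FormalSeries.

(** * Local existence of integral curves *)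

Section Increments.
Context {R : realType} {V : normedModType R}.
Implicit Types (g : R -> V) (t : R) (v : V).

Lemma is_derive_of_increment g t v :
  (forall e : R, 0 < e -> exists2 d : R, 0 < d & forall h : R, `|h| < d ->
    `|g (h + t) - g t - h *: v| <= e * `|h|) -> is_derive t 1 g v.
Proof.
move=> H.
have lin : linear (fun h : R^o => h *: v).
  by move=> a x y; rewrite scalerDl -scalerA.
pose dfM := GRing.isLinear.Build _ _ _ _ _ lin.
pose df : {linear R^o -> V} := HB.pack (fun h : R^o => h *: v) dfM.
have dfc : continuous df by move=> x; exact: scalel_continuous.
have [H1 H2] := @differentiable_of_increment R R^o V g df t dfc H.
split; first exact/derivable1_diffP.
by rewrite deriveE// H2 /= scale1r.
Qed.

Lemma increment_of_is_derive g t v : is_derive t 1 g v ->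
  forall e : R, 0 < e -> exists2 d : R, 0 < d & forall h : R, `|h| < d ->
    `|g (h + t) - g t - h *: v| <= e * `|h|.
Proof.
move=> [dg gv] e e0.
have : h^-1 *: (g (h + t) - g t) @[h --> 0^'] --> v.
  rewrite -gv; have := dg; rewrite /derivable /derive => /cvg_ex[l].
  set F := (X in X @ _ --> _); move=> Fl.
  have -> : (fun h => h^-1 *: (g (h + t) - g t)) = F.
    by apply/funext => h; rewrite /F /= [h *: 1]mulr1.
  by rewrite (cvg_lim _ Fl).
move=> /cvgrPdist_le/(_ _ e0)[d /= d0 H]; exists d => // h hd.
have [->|h0] := eqVneq h 0.
  by rewrite add0r subrr scale0r subrr !normr0 mulr0.
have := H h; rewrite /ball_/= sub0r normrN => /(_ hd h0) {}H.
have -> : g (h + t) - g t - h *: v = - (h *: (v - h^-1 *: (g (h + t) - g t))).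
  by rewrite scalerBr scalerA mulfV// scale1r opprB.
by rewrite normrN normrZ mulrC ler_wpM2r.
Qed.

End Increments.

Lemma ler_norm3 {K : numDomainType} {V : normedZmodType K} (x y z : V) :
  `|x + y + z| <= `|x| + `|y| + `|z|.
Proof. by rewrite (le_trans (ler_normD _ _))// lerD2r ler_normD. Qed.

Lemma div_pow2_small {R : realType} (A e : R) : 0 <= A -> 0 < e ->
  exists N, forall k, (N <= k)%N -> A / 2 ^+ k <= e.
Proof.
move=> A0 e0; exists (Num.bound (A / e)) => k Nk.
rewrite ler_pdivrMr ?exprn_gt0// mulrC -ler_pdivrMr//.
rewrite (le_trans (ltW (archi_boundP _)))//; first by rewrite divr_ge0// ltW.
rewrite (le_trans (y := k%:R)) ?ler_nat//.
by rewrite -natrX ler_nat ltnW// ltn_expl.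
Qed.

Lemma geometric_cauchy {R : realType} {n : nat} (u : nat -> 'rV[R]_n) (A : R) :
  (forall k, `|u k.+1 - u k| <= A / 2 ^+ k) ->
  exists l, forall k, `|u k - l| <= 2 * A / 2 ^+ k.
Proof.
move=> uA.
have A0 : 0 <= A by have := le_trans (normr_ge0 _) (uA 0%N); rewrite expr0 divr1.
have step k p : `|u (p + k)%N - u k| <= 2 * A / 2 ^+ k - 2 * A / 2 ^+ (p + k).
  elim: p => [|p IH]; first by rewrite !subrr normr0.
  rewrite addSn -(subrKA (u (p + k)%N)) (le_trans (ler_normD _ _))//.
  apply: le_trans (lerD (uA _) IH) _.
  have -> : 2 * A / 2 ^+ (p + k) = A / 2 ^+ (p + k) + A / 2 ^+ (p + k) by field; rewrite expf_neq0.
  have -> : 2 * A / 2 ^+ (p + k).+1 = A / 2 ^+ (p + k).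
    by rewrite exprS; field; rewrite expf_neq0.
  lra.
have step' k q : (k <= q)%N -> `|u q - u k| <= 2 * A / 2 ^+ k.
  move=> kq; rewrite -(subnK kq) (le_trans (step _ _))// gerBl.
  by rewrite divr_ge0// ?mulr_ge0// exprn_ge0.
have A20 : 0 <= 2 * A by rewrite mulr_ge0.
have /cvg_ex[l ul] : cvg (u @ \oo).
  apply: cauchy_cvg; apply: cauchy_exP => e e0; rewrite /fmapE.
  have e20 : 0 < e / 2 by rewrite divr_gt0.
  have [N HN] := div_pow2_small A20 e20; exists (u N).
  exists N => // k /= Nk; rewrite -ball_normE /= distrC.
  apply: le_lt_trans (step' _ _ Nk) _; apply: le_lt_trans (HN _ (leqnn _)) _.
  by rewrite ltr_pdivrMr// ltr_pMr// ltr1n.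
exists l => k; apply/ler_addgt0Pr => e e0.
have /cvgrPdist_le/(_ _ e0)[N _ HN] := ul.
have /= H1 := HN (maxn N k) (leq_maxl _ _).
have H2 := step' _ _ (leq_maxr N k).
rewrite distrC -(subrKA (u (maxn N k))) (le_trans (ler_normD _ _))// addrC lerD//.
Qed.

Lemma primitive_exists {R : realType} (f : R -> R) (T : R) : continuous f ->
  0 < T -> exists F : R -> R, F 0 = 0 /\
    forall t, - T < t < T -> is_derive t 1 F (f t).
Proof.
move=> cf T0.
(* The integral starts at [- T], so that 0 is an interior point and the derivative there is
   two-sided. *)
pose F (x : R) := (\int[@lebesgue_measure R]_(t in `[- T, x]) f t)%R.
exists (fun x => F x - F 0); split; first by rewrite subrr.
move=> t /andP[Tt tT].
have fi : (@lebesgue_measure R).-integrable `[- T, T] (EFin \o f).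
  apply: continuous_compact_integrable; first exact: segment_compact.
  exact: continuous_subspaceT.
have [d1 d2] := continuous_FTC1_closed tT fi Tt (cf t).
have dF : is_derive t 1 F (f t) by split; [exact: d1|rewrite -derive1E; exact: d2].
by rewrite -[f t]subr0; apply: is_deriveB.
Qed.

Section Clamp.
Context {R : realType}.

Definition clamp (a b t : R) := Num.max a (Num.min b t).

Lemma clamp_itv (a b t : R) : a <= b -> a <= clamp a b t <= b.
Proof. by move=> ab; rewrite /clamp le_max lexx/= ge_max ab/= ge_min lexx. Qed.

Lemma clamp_id (a b t : R) : a <= t <= b -> clamp a b t = t.
Proof. by move=> /andP[ta tb]; rewrite /clamp min_r// max_r. Qed.

Lemma clamp_lipschitz (a b s t : R) : a <= b -> `|clamp a b s - clamp a b t| <= `|s - t|.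
Proof.
move=> ab; wlog st : s t / s <= t.
  move=> H; have [/H//|/ltW/H] := leP s t.
  by rewrite distrC (distrC t).
rewrite distrC [leRHS]distrC [leRHS]ger0_norm ?subr_ge0// ler_norml.
rewrite /clamp !maxElt !minElt.
by apply/andP; split; case: (ltP b t) => ?; case: (ltP b s) => ?;
  do !case: ltP => ?; lra.
Qed.

(** A 1-Lipschitz retraction onto the closed ball of the sup norm. Composing a field with it turns
    bounds on the ball into global ones. *)
Definition clampv {n} (c : 'rV[R]_n) (r : R) (y : 'rV[R]_n) : 'rV[R]_n :=
  \row_i clamp (c 0 i - r) (c 0 i + r) (y 0 i).

Lemma clampv_ball n (c : 'rV[R]_n) r y : 0 <= r -> `|clampv c r y - c| <= r.
Proof.
move=> r0; apply: normr_rV_le => // i; rewrite !mxE.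
have := @clamp_itv (c 0 i - r) (c 0 i + r) (y 0 i).
rewrite ler_norml; lra.
Qed.

Lemma clampv_id n (c : 'rV[R]_n) r y : `|y - c| <= r -> clampv c r y = y.
Proof.
move=> yr; apply/rowP => i; rewrite mxE clamp_id//.
have := le_trans (ler_coord_normr (y - c) i) yr; rewrite !mxE ler_norml; lra.
Qed.

Lemma clampv_lipschitz n (c : 'rV[R]_n) r y z : 0 <= r ->
  `|clampv c r y - clampv c r z| <= `|y - z|.
Proof.
move=> r0; apply: normr_rV_le => // i; rewrite !mxE.
apply: le_trans (clamp_lipschitz _ _ _) _; first by lra.
by have := ler_coord_normr (y - z) i; rewrite !mxE.
Qed.

End Clamp.

Section Lipschitz.
Context {R : realType} {n : nat}.
Implicit Types (g : R -> 'rV[R]_n).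

Definition lipschitz_curve (M : R) g := forall s t, `|g s - g t| <= M * `|s - t|.

Lemma lipschitz_curve_continuous M g : lipschitz_curve M g -> continuous g.
Proof.
move=> gM t; apply/cvgrPdist_le => e e0.
have M1 : 0 < `|M| + 1 by rewrite ltr_wpDl.
exists (e / (`|M| + 1)) => /=; first by rewrite divr_gt0.
move=> s /= st; apply: le_trans (gM _ _) _.
apply: (le_trans (y := (`|M| + 1) * `|t - s|)).
  by rewrite ler_wpM2r// (le_trans (ler_norm _))// lerDl.
by rewrite mulrC -ler_pdivlMr// ltW.
Qed.

Lemma derive1_rV_le g (dg : R -> 'rV[R]_n) (a b M : R) : a <= b -> 0 <= M ->
  continuous g ->
  (forall t : R, a < t < b -> is_derive t 1 g (dg t)) ->
  (forall t, a < t < b -> `|dg t| <= M) -> `|g b - g a| <= M * (b - a).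
Proof.
move=> ab M0 cg gd dM; apply: normr_rV_le => [|i].
  by rewrite mulr_ge0// subr_ge0.
rewrite !mxE; apply: (@derive1_le _ (fun t => g t 0 i) (fun t => dg t 0 i)) => //.
- by move=> t /gd/is_derive_rVP.
- apply: continuous_subspaceT => t.
  apply: (@continuous_comp _ _ _ g (fun v : 'rV[R]_n => v 0 i)); first exact: cg.
  exact: coord_continuous.
- by move=> t /dM; apply: le_trans; exact: ler_coord_normr.
Qed.

End Lipschitz.

Section Picard.
Context {R : realType} {n : nat}.
Variables (W : 'rV[R]_n -> 'rV[R]_n) (x : 'rV[R]_n) (M L T : R).
Hypotheses (T0 : 0 < T) (M0 : 0 <= M) (L0 : 0 <= L) (LT : L * T <= 1 / 2).
Hypothesis WM : forall y, `|W y| <= M.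
Hypothesis WL : forall y z, `|W y - W z| <= L * `|y - z|.

(** The new iterate is frozen outside [0, T], which makes it a Lipschitz curve on the whole line; it
    may have corners at 0 and [T], hence the open interval. *)
Definition picard_next (g g' : R -> 'rV[R]_n) :=
  [/\ lipschitz_curve M g', forall t, t <= 0 -> g' t = x,
      forall t, T <= t -> g' t = g' T &
      forall t : R, 0 < t < T -> is_derive t 1 g' (W (g t))].

Lemma picard_step g : lipschitz_curve M g -> exists g', picard_next g g'.
Proof.
move=> gM; have cg := lipschitz_curve_continuous gM.
have T1 : 0 < T + 1 by rewrite addr_gt0.
have cW i : continuous (fun t => W (g t) 0 i).
  move=> t; apply: (@continuous_comp _ _ _ (W \o g) (fun v : 'rV[R]_n => v 0 i)).
    apply: (@lipschitz_curve_continuous _ _ (L * M)) => r s.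
    by rewrite (le_trans (WL _ _))// -mulrA ler_wpM2l.
  exact: coord_continuous.
have [F HF] := choice (fun i => primitive_exists (cW i) T1).
pose G t : 'rV[R]_n := x + \row_i F i t.
have dG (t : R) : - (T + 1) < t < T + 1 -> is_derive t 1 G (W (g t)).
  move=> tT; apply/is_derive_rVP => i.
  have -> : (fun s => G s 0 i) = cst (x 0 i) + F i.
    by apply/funext => s; rewrite !mxE.
  have [_ /(_ t tT) dFi] := HF i.
  by apply: is_derive_eq; rewrite add0r.
exists (G \o clamp 0 T); split.
- have GL r s : 0 <= r <= T -> 0 <= s <= T -> r <= s -> `|G s - G r| <= M * (s - r).
    move=> /andP[r0 rT] /andP[s0 sT] rs; apply: normr_rV_le => [|i].
      by rewrite mulr_ge0// subr_ge0.
    rewrite !mxE; apply: (@derive1_le _ (fun t => (x 0 i + F i t : R)) (fun t => W (g t) 0 i)) => //.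
    + move=> t /andP[t0 tT]; have /dG/is_derive_rVP/(_ i) : - (T + 1) < t < T + 1 by lra.
      rewrite (_ : (fun s => G s 0 i) = (fun t => x 0 i + F i t))//.
      by apply/funext => q; rewrite !mxE.
    + apply: derivable_within_continuous => t; rewrite in_itv/= => /andP[t0 tT].
      have /dG/is_derive_rVP/(_ i)[+ _] : - (T + 1) < t < T + 1 by lra.
      rewrite (_ : (fun s => G s 0 i) = (fun t => x 0 i + F i t))//.
      by apply/funext => q; rewrite !mxE.
    + by move=> t _; rewrite (le_trans (ler_coord_normr _ _)).
  move=> r s /=; have Hr := clamp_itv r (ltW T0); have Hs := clamp_itv s (ltW T0).
  apply: le_trans (ler_wpM2l M0 (clamp_lipschitz r s (ltW T0))).
  have [rs|/ltW rs] := leP (clamp 0 T r) (clamp 0 T s).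
    by rewrite distrC [`|clamp 0 T r - _|]distrC [`|clamp 0 T s - _|]ger0_norm ?subr_ge0// GL.
  by rewrite [`|clamp 0 T r - _|]ger0_norm ?subr_ge0// GL.
- move=> t t0 /=; have -> : clamp 0 T t = 0.
    by rewrite /clamp min_r ?max_l// (le_trans t0)// ltW.
  by apply/rowP => i; rewrite !mxE (HF i).1 addr0.
- by move=> t tT /=; rewrite /clamp min_l// minxx.
- move=> t /andP[t0 tT]; apply: (near_eq_is_derive (f := G)).
  + near=> s; rewrite /= clamp_id//; apply/andP; split; apply: ltW.
      by near: s; exact: lt_nbhsr.
    by near: s; exact: lt_nbhsl.
  + by apply: dG; lra.
Unshelve. all: by end_near. Qed.

(** Since [L * T <= 1 / 2], the k-th iterates move by at most [M * T / 2 ^+ k]. The limit is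
    differentiated through the increments of the iterates: their deviation from the linear term is
    quadratic in |s - t|, up to a part that vanishes as [k] grows. *)
Lemma picard : exists g, [/\ lipschitz_curve M g, forall t, t <= 0 -> g t = x,
  forall t, T <= t -> g t = g T &
  forall t : R, 0 < t < T -> is_derive t 1 g (W (g t))].
Proof.
have gM0 : lipschitz_curve M (fun _ => x).
  by move=> s t; rewrite subrr normr0 mulr_ge0.
(* The value on a curve that is not Lipschitz is arbitrary and never reached. *)
have /choice[next Hnext] : forall g : R -> 'rV[R]_n, exists g', lipschitz_curve M g -> picard_next g g'.
  move=> g; have [/picard_step[g' Hg']|ng] := pselect (lipschitz_curve M g).
    by exists g'.
  by exists g.
pose u k := iter k next (fun _ => x).
have uM k : lipschitz_curve M (u k) by elim: k => //= k /Hnext[].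
have uS k : picard_next (u k) (u k.+1) by exact: (Hnext _ (uM k)).
have u0 k t : t <= 0 -> u k t = x by case: k => // k; have [_ + _ _] := uS k; exact.
have uT k t : T <= t -> u k t = u k T by case: k => // k; have [_ _ + _] := uS k; exact.
have MT0 : 0 <= M * T by rewrite mulr_ge0// ltW.
have bd0 k t : 0 <= t <= T -> `|u k.+1 t - u k t| <= M * T / 2 ^+ k.
  elim: k t => [|k IH] t /andP[t0 tT].
    have -> : u 0%N t = u 1%N 0 by rewrite (u0 1%N 0 (lexx _)).
    rewrite expr0 divr1; apply: le_trans (uM 1%N _ _) _.
    by rewrite subr0 ger0_norm// ler_wpM2l.
  have := @derive1_rV_le _ _ (u k.+2 - u k.+1)
    (fun s => W (u k.+1 s) - W (u k s)) 0 t (L * (M * T / 2 ^+ k)) t0.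
  have -> : (u k.+2 - u k.+1) 0 = 0.
    by rewrite [LHS](_ : _ = u k.+2 0 - u k.+1 0)// !u0// subrr.
  rewrite !subr0 => H.
  apply: le_trans (H _ _ _ _) _.
  - by rewrite mulr_ge0// divr_ge0// exprn_ge0.
  - move=> s; apply: continuousB; apply: lipschitz_curve_continuous; exact: uM.
  - move=> s /andP[s0 st]; have sT : 0 < s < T by rewrite s0 (lt_le_trans st).
    apply: is_deriveB; first by have [_ _ _] := uS k.+1; apply.
    by have [_ _ _] := uS k; apply.
  - move=> s /andP[s0 st]; rewrite (le_trans (WL _ _))// ler_wpM2l// IH//.
    by rewrite (ltW s0) (le_trans (ltW st)).
  have -> : M * T / 2 ^+ k.+1 = (1 / 2) * (M * T / 2 ^+ k).
    by rewrite exprS; field; rewrite expf_neq0.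
  rewrite mulrAC ler_wpM2r//; first by rewrite divr_ge0// exprn_ge0.
  by rewrite (le_trans _ LT)// ler_wpM2l.
have bd k t : `|u k.+1 t - u k t| <= M * T / 2 ^+ k.
  have [t0|t0] := leP t 0.
    by rewrite !u0// subrr normr0 divr_ge0// exprn_ge0.
  have [tT|/ltW tT] := leP t T; first by rewrite bd0// tT ltW.
  by rewrite !(uT _ _ tT) bd0// lexx ltW.
have /choice[g Hg] : forall t, exists l, forall k, `|u k t - l| <= 2 * (M * T) / 2 ^+ k.
  by move=> t; exact: (geometric_cauchy (bd ^~ t)).
have MT20 : 0 <= 2 * (M * T) by rewrite mulr_ge0.
have lim_le (c d : R) (F : nat -> R) : (forall k, c <= d + F k) ->
    (forall e, 0 < e -> exists k, F k <= e) -> c <= d.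
  move=> H1 H2; apply/ler_addgt0Pr => e /H2[k Hk].
  by rewrite (le_trans (H1 k))// lerD2l.
have small (C : R) : 0 <= C -> forall e, 0 < e -> exists k, C * (2 * (M * T) / 2 ^+ k) <= e.
  move=> C0 e e0; have [N HN] := div_pow2_small (mulr_ge0 C0 MT20) e0.
  by exists N; rewrite mulrA HN.
have gM : lipschitz_curve M g.
  move=> s t; apply: lim_le (small 2 _) => // k.
  have -> : g s - g t = - (u k s - g s) + (u k s - u k t) + (u k t - g t).
    by apply/rowP => i; rewrite !mxE; ring.
  rewrite (le_trans (ler_norm3 _ _ _))// normrN; have := Hg s k; have := Hg t k; have := uM k s t; lra.
have lim_eq (a b : 'rV[R]_n) : (forall k, `|a - b| <= 0 + 2 * (2 * (M * T) / 2 ^+ k)) -> a = b.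
  move=> H; apply/eqP; rewrite -subr_eq0 -normr_le0.
  exact: lim_le H (small 2 _).
have pos k : 0 <= 2 * (M * T) / 2 ^+ k by rewrite divr_ge0// exprn_ge0.
exists g; split => //.
- move=> t t0; apply: lim_eq => k; have := Hg t k; rewrite u0// distrC.
  have := pos k; lra.
- move=> t tT; apply: lim_eq => k; rewrite -(subrKA (u k t)) {2}(uT _ _ tT).
  rewrite (le_trans (ler_normD _ _))// distrC; have := Hg t k; have := Hg T k; lra.
- move=> t /andP[t0 tT].
  have dg s : 0 < s < T -> `|g s - g t - (s - t) *: W (g t)| <= L * M * `|s - t| * `|s - t|.
    move=> /andP[s0 sT].
    have st0 : 0 <= 2 + L * `|s - t| by rewrite addr_ge0// mulr_ge0.
    apply: lim_le (small (2 + L * `|s - t|) st0) => k.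
    have key : `|u k.+1 s - u k.+1 t - (s - t) *: W (g t)| <=
        (L * (2 * (M * T) / 2 ^+ k + M * `|s - t|)) * `|s - t|.
      pose h r := u k.+1 r - r *: W (g t).
      pose dh r := W (u k r) - W (g t).
      have ch : continuous h.
        move=> r; apply: continuousB; first by apply: lipschitz_curve_continuous; exact: uM.
        exact: scalel_continuous.
      have hd (r : R) : 0 < r < T -> is_derive r 1 h (dh r).
        move=> rT; apply: is_deriveB; first by have [_ _ _] := uS k; apply.
        apply: is_derive_of_increment => e e0; exists 1 => // q _.
        by rewrite scalerDl addrK subrr normr0 mulr_ge0// ltW.
      have hM (r : R) : `|r - t| <= `|s - t| -> `|dh r| <= L * (2 * (M * T) / 2 ^+ k + M * `|s - t|).
        move=> rs; rewrite (le_trans (WL _ _))// ler_wpM2l//.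
        rewrite -(subrKA (g r)) (le_trans (ler_normD _ _))// lerD//.
        by rewrite (le_trans (gM _ _))// ler_wpM2l.
      have c0 : 0 <= L * (2 * (M * T) / 2 ^+ k + M * `|s - t|).
        by rewrite mulr_ge0// addr_ge0// mulr_ge0.
      have -> : u k.+1 s - u k.+1 t - (s - t) *: W (g t) = h s - h t.
        by rewrite /h scalerBl; apply/rowP => i; rewrite !mxE; ring.
      have [ts|/ltW st] := leP t s.
        rewrite [X in _ * X]ger0_norm ?subr_ge0//.
        apply: derive1_rV_le ch _ _ => // r /andP[r1 r2].
          by apply: hd; rewrite (lt_trans t0 r1) (lt_trans r2).
        by apply: hM; rewrite !ger0_norm; lra.
      have -> : `|h s - h t| = `|h t - h s| by rewrite distrC.
      have E : `|s - t| = t - s by rewrite ler0_norm ?subr_le0// opprB.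
      move: c0 hM; rewrite E => c0 hM.
      apply: derive1_rV_le st c0 ch _ _ => r /andP[r1 r2].
        by apply: hd; rewrite (lt_trans s0 r1) (lt_trans r2).
      by apply: hM; rewrite ler0_norm; lra.
    have -> : g s - g t - (s - t) *: W (g t) = - (u k.+1 s - g s) + (u k.+1 t - g t) +
        (u k.+1 s - u k.+1 t - (s - t) *: W (g t)).
      by apply/rowP => i; rewrite !mxE; ring.
    rewrite (le_trans (ler_norm3 _ _ _))// normrN.
    have P2 : 2 * (M * T) / 2 ^+ k.+1 <= 2 * (M * T) / 2 ^+ k.
      by rewrite ler_wpM2l// lef_pV2 ?posrE ?exprn_gt0// ler_eXn2l ?ltr1n.
    have := Hg s k.+1; have := Hg t k.+1; move: key; lra.
  apply: is_derive_of_increment => e e0.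
  have LM : 0 < L * M + 1 by rewrite ltr_wpDl// mulr_ge0.
  exists (Num.min (e / (L * M + 1)) (Num.min t (T - t))).
    by rewrite !lt_min divr_gt0// t0 subr_gt0.
  move=> h; rewrite !lt_min => /and3P[h1 h2 h3].
  have := dg (h + t); rewrite addrK => H; apply: le_trans (H _) _.
    move: h2 h3; rewrite !ltr_norml; lra.
  rewrite ler_wpM2r//; apply: (le_trans (y := (L * M + 1) * `|h|)).
    by rewrite ler_wpM2r// lerDl.
  by rewrite mulrC -ler_pdivlMr// ltW.
Qed.

End Picard.

(** Picard iteration is run for the field truncated by [clampv]. As [M * T <= r], the solution does
    not leave the ball, where the truncation changes nothing. *)
Lemma ode_exists {R : realType} {n : nat} (V : 'rV[R]_n -> 'rV[R]_n) x (M L r T : R) :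
  0 < T -> 0 <= M -> 0 <= L -> L * T <= 1 / 2 -> M * T <= r ->
  (forall y, `|y - x| <= r -> `|V y| <= M) ->
  (forall y z, `|y - x| <= r -> `|z - x| <= r -> `|V y - V z| <= L * `|y - z|) ->
  exists g, [/\ lipschitz_curve M g, forall t, t <= 0 -> g t = x,
    forall t, T <= t -> g t = g T, forall t, `|g t - x| <= r &
    forall t : R, 0 < t < T -> is_derive t 1 g (V (g t))].
Proof.
move=> T0 M0 L0 LT MT VM VL.
have r0 : 0 <= r by rewrite (le_trans _ MT)// mulr_ge0// ltW.
have [||g [gM g0 gT dg]] := @picard _ _ (V \o clampv x r) x M L T T0 M0 L0 LT.
- by move=> y /=; apply: VM; exact: clampv_ball.
- move=> y z /=; apply: le_trans (VL _ _ _ _) _; try exact: clampv_ball.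
  by rewrite ler_wpM2l// clampv_lipschitz.
have gr t : `|g t - x| <= r.
  rewrite -(g0 0 (lexx _)).
  have in_ s : 0 <= s <= T -> `|g s - g 0| <= r.
    move=> /andP[s0 sT]; rewrite (le_trans (gM _ _))// subr0 ger0_norm// (le_trans _ MT)//.
    by rewrite ler_wpM2l.
  have [t0|t0] := leP t 0; first by rewrite !g0// subrr normr0.
  have [tT|/ltW tT] := leP t T; first by rewrite in_// tT ltW.
  by rewrite (gT t)// in_// lexx ltW.
exists g; split => // t /dg; by rewrite /= clampv_id.
Qed.

(** * Concatenation of horizontal curves *)

Lemma countable_setU2 {T : Type} (A B : set T) :
  countable A -> countable B -> countable (A `|` B).
Proof.
move=> cA cB; have -> : A `|` B = \bigcup_(b in [set: bool]) (if b then A else B).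
  apply/seteqP; split=> [x [Ax|Bx]|x [[]]]; [by exists true|by exists false|by left|by right].
by apply: bigcup_countable => [|[]] //; exact: countableP.
Qed.

Section HorizontalCurves.
Context {R : realType} {n m : nat}.
Variable F : 'I_m -> vfield R n.
Implicit Types (g : R -> 'rV[R]_n) (h : 'I_m -> R -> R) (x y z : 'rV[R]_n).

(* The derivative is required off a countable set only, which suffices for the
   curves built below and makes concatenation elementary. *)
Definition hcurve (M T : R) x y g h :=
  [/\ lipschitz_curve M g, forall t, t <= 0 -> g t = x, forall t, T <= t -> g t = y,
      (forall i, measurable_fun [set: R] (h i)) /\ (forall t, \sum_i h i t ^+ 2 <= 1) &
      countable [set t : R | 0 < t < T /\
        ~ is_derive t 1 g (\sum_i h i t *: F i (g t))]].

(** The Lipschitz constant [M] is recorded because infinitely many curves with a common constant can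
    be concatenated into one that still has a limit at its final time. *)
Definition reach (M T : R) x y := 0 < T /\ exists g h, hcurve M T x y g h.

Lemma hcurve_cst M T x : 0 <= M -> hcurve M T x x (fun _ => x) (fun _ _ => 0).
Proof.
move=> M0; split => //.
- by move=> s t; rewrite subrr normr0 mulr_ge0.
- by split=> [i|t]; [exact: measurable_cst|rewrite big1// => i _; rewrite expr0n].
- rewrite (_ : [set t | _] = set0); first exact: countable0.
  apply/seteqP; split => // t [_]; apply.
  rewrite big1 => [|i _]; last by rewrite scale0r.
  exact: is_derive_cst.
Qed.

Lemma reach_refl M T x : 0 <= M -> 0 < T -> reach M T x x.
Proof.
by move=> M0 T0; split => //; exists (fun _ => x), (fun _ _ => 0); exact: hcurve_cst.
Qed.

Lemma reach_weaken M M' T x y : M <= M' -> reach M T x y -> reach M' T x y.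
Proof.
move=> MM' [T0 [g [h [gM g0 gT gh gd]]]]; split => //; exists g, h; split => //.
by move=> s t; rewrite (le_trans (gM s t))// ler_wpM2r.
Qed.

Definition glue (T : Type) (c : R) (f1 f2 : R -> T) (t : R) :=
  if t <= c then f1 t else f2 (t - c).

Lemma hcurve_glue M T1 T2 x y z g1 h1 g2 h2 : 0 <= T1 -> 0 <= T2 -> 0 <= M ->
  hcurve M T1 x y g1 h1 -> hcurve M T2 y z g2 h2 ->
  hcurve M (T1 + T2) x z (glue T1 g1 g2) (fun i => glue T1 (h1 i) (h2 i)).
Proof.
move=> T10 T20 M0 [g1M g10 g1T [mh1 h11] c1] [g2M g20 g2T [mh2 h21] c2].
have gluey : glue T1 g1 g2 T1 = y by rewrite /glue lexx g1T.
have gle t : t <= T1 -> glue T1 g1 g2 t = g1 t by rewrite /glue => ->.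
have gge t : T1 <= t -> glue T1 g1 g2 t = g2 (t - T1).
  move=> Tt; rewrite /glue; have [tT|//] := leP t T1.
  have -> : t = T1 by apply/eqP; rewrite eq_le tT.
  by rewrite g1T// subrr g20.
split.
- move=> s t; wlog st : s t / s <= t.
    move=> H; have [/H//|/ltW/H] := leP s t.
    by rewrite distrC [`|t - s|]distrC.
  have [tT|/ltW Tt] := leP t T1; first by rewrite !gle// (le_trans st).
  have [sT|/ltW Ts] := leP s T1; last first.
    rewrite !gge//; apply: le_trans (g2M _ _) _.
    by have -> : s - T1 - (t - T1) = s - t by ring.
  rewrite -(subrKA (glue T1 g1 g2 T1)) (le_trans (ler_normD _ _))//.
  rewrite (gle s)// {1}(gle T1)// (gge t)// (gge T1)//.
  apply: le_trans (lerD (g1M _ _) (g2M _ _)) _.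
  rewrite -mulrDr ler_wpM2l// !ler0_norm ?subr_le0 ?lerD2r//.
  lra.
- by move=> t t0; rewrite gle ?g10// (le_trans t0).
- move=> t tT; rewrite gge; last by rewrite (le_trans _ tT)// lerDl.
  by rewrite g2T// lerBrDl.
- split=> [i|t].
    apply: measurable_fun_ifT; [|exact: mh1|].
      by apply: measurable_fun_ler => //; exact: measurable_cst.
    apply: (measurableT_comp (mh2 i)).
    by apply: measurable_funB => //; exact: measurable_cst.
  have [tT|tT] := leP t T1.
    by under eq_bigr do rewrite /glue tT; exact: h11.
  by under eq_bigr do rewrite /glue leNgt tT/=; exact: h21.
(* The junction time [T1] joins the exceptional set: the two velocities need not match there. *)
- apply: (@sub_countable _ _ _ ([set t : R | 0 < t < T1 /\
        ~ is_derive t 1 g1 (\sum_i h1 i t *: F i (g1 t))] `|` [set T1] `|`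
     (fun t => t + T1) @` [set t : R | 0 < t < T2 /\
        ~ is_derive t 1 g2 (\sum_i h2 i t *: F i (g2 t))])); last first.
    apply: countable_setU2; first by apply: countable_setU2.
    by apply: sub_countable c2; exact: card_image_le.
  apply: subset_card_le => t /= [/andP[t0 tT] nd].
  have [tT1|tT1|tT1] := ltgtP t T1; last by left; right.
    left; left; split; first by rewrite t0.
    move=> d; apply: nd; rewrite gle ?ltW//.
    rewrite (_ : \sum_i _ = \sum_i h1 i t *: F i (g1 t)); last first.
      by apply: eq_bigr => i _; rewrite /glue ltW.
    apply: near_eq_is_derive d; near=> s.
    by rewrite gle// ltW//; near: s; exact: lt_nbhsl.
  right; exists (t - T1); last by rewrite subrK.
  split; first by rewrite subr_gt0 tT1 ltrBlDl.
  move=> d; apply: nd; rewrite gge ?ltW//.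
  rewrite (_ : \sum_i _ = \sum_i h2 i (t - T1) *: F i (g2 (t - T1))); last first.
    by apply: eq_bigr => i _; rewrite /glue leNgt tT1.
  apply: (near_eq_is_derive (f := fun s => g2 (s - T1))).
    near=> s; rewrite gge// ltW//; near: s; exact: lt_nbhsr.
  apply: is_derive_of_increment => e e0.
  have [q q0 H] := increment_of_is_derive d e0.
  by exists q => // r rq; have := H r rq; rewrite addrA.
Unshelve. all: by end_near. Qed.

Lemma reach_trans M T1 T2 x y z : 0 <= M -> reach M T1 x y -> reach M T2 y z ->
  reach M (T1 + T2) x z.
Proof.
move=> M0 [T10 [g1 [h1 H1]]] [T20 [g2 [h2 H2]]]; split; first exact: addr_gt0.
exists (glue T1 g1 g2), (fun i => glue T1 (h1 i) (h2 i)).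
by apply: hcurve_glue H1 H2 => //; exact: ltW.
Qed.

(** The total time [Sup] is the supremum of the partial sums, never attained since every duration is
    positive. The common constant [M] and the convergence of the nodes make the extension by [z]
    from [Sup] on Lipschitz. *)
Lemma reach_lim M (T : nat -> R) (y : nat -> 'rV[R]_n) z (B : R) : 0 <= M ->
  (forall i, reach M (T i) (y i) (y i.+1)) ->
  (forall i, \sum_(k < i) T k <= B) -> y @ \oo --> z ->
  exists2 S, S <= B & reach M S (y 0%N) z.
Proof.
move=> M0 Hr HB yz.
have T0 i : 0 < T i by case: (Hr i).
have /choice[gh Hgh] : forall i, exists p : (R -> 'rV[R]_n) * ('I_m -> R -> R),
    hcurve M (T i) (y i) (y i.+1) p.1 p.2.
  by move=> i; have [_ [g [h H]]] := Hr i; exists (g, h).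
pose S i := \sum_(k < i) T k.
have SS i : S i.+1 = S i + T i by rewrite /S big_ord_recr.
have S_ge0 i : 0 <= S i by apply: sumr_ge0 => k _; exact: ltW.
have S_homo i j : (i <= j)%N -> S i <= S j.
  move=> /subnK <-; elim: (j - i)%N => // k IH.
  by rewrite addSn SS (le_trans IH)// lerDl ltW.
pose G := fix G i : (R -> 'rV[R]_n) * ('I_m -> R -> R) :=
  if i is k.+1 then (glue (S k) (G k).1 (gh k).1, fun q => glue (S k) ((G k).2 q) ((gh k).2 q))
  else ((fun _ => y 0%N), (fun _ _ => 0)).
have HG i : hcurve M (S i) (y 0%N) (y i) (G i).1 (G i).2.
  elim: i => [|i IH]; first exact: hcurve_cst.
  by rewrite SS; apply: hcurve_glue IH (Hgh i) => //; exact: ltW.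
have agree i j t : (i <= j)%N -> t <= S i ->
    (G j).1 t = (G i).1 t /\ forall q, (G j).2 q t = (G i).2 q t.
  move=> /subnK <- tS; elim: (j - i)%N => // k [IH1 IH2].
  have tk : t <= S (k + i)%N by rewrite (le_trans tS)// S_homo// leq_addl.
  by rewrite addSn /= /glue tk.
pose E := range S.
have hsE : has_sup E.
  by split; [exists (S 0%N), 0%N|exists B => _ [i _ <-]; exact: HB].
pose Sup := sup E.
have S_lt i : S i < Sup.
  apply: (lt_le_trans (y := S i.+1)); first by rewrite SS ltrDl.
  by apply: ub_le_sup; [exact: hsE.2|exists i.+1].
have lt_S t : t < Sup -> exists i, t < S i.
  by move=> /(sup_gt hsE.1)[_ [i _ <-] ti]; exists i.
exists Sup; first by apply: ge_sup; [exact: hsE.1|move=> _ [i _ <-]; exact: HB].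
split; first exact: le_lt_trans (S_ge0 0%N) (S_lt 0%N).
(* Before [Sup], position and controls at time [t] are read on any finite concatenation that lasts
   beyond [t], as these agree; from [Sup] on, they are [z] and 0. *)
have /choice[p Hp] : forall t, exists p : 'rV[R]_n * ('I_m -> R),
    (forall i, t <= S i -> p.1 = (G i).1 t /\ forall q, p.2 q = (G i).2 q t) /\
    (Sup <= t -> p.1 = z /\ forall q, p.2 q = 0).
  move=> t; have [St|/lt_S[i ti]] := leP Sup t.
    exists (z, fun _ => 0); split => // i.
    by rewrite leNgt (lt_le_trans (S_lt i)).
  exists ((G i).1 t, fun q => (G i).2 q t); split => [j tj|//].
    have [ij|/ltnW ji] := leqP i j.
      by have [-> H] := agree _ _ _ ij (ltW ti); split => // q; rewrite H.
    exact: agree.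
have Gz t e : 0 < e -> exists N, forall i, (N <= i)%N -> `|(p t).1 - (G i).1 t| <= e.
  move=> e0; have [H1 H2] := Hp t; have [St|/lt_S[i /ltW ti]] := leP Sup t.
    have /cvgrPdist_le/(_ _ e0)[N _ HN] := yz.
    exists N => i /HN; have [_ _ HT _ _] := HG i; rewrite (H2 St).1 HT//.
    by rewrite (le_trans _ St)// ltW.
  exists i => j ij; have [-> _] := H1 _ ti.
  by rewrite (agree _ _ _ ij ti).1 subrr normr0 ltW.
have pM : lipschitz_curve M (fun t => (p t).1).
  move=> s t; apply/ler_addgt0Pr => e e0.
  have e20 : 0 < e / 2 by rewrite divr_gt0.
  have [N1 H1] := Gz s _ e20; have [N2 H2] := Gz t _ e20.
  have [GM _ _ _ _] := HG (maxn N1 N2).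
  have := H1 _ (leq_maxl N1 N2); have := H2 _ (leq_maxr N1 N2); have := GM s t.
  set gs := (G _).1 s; set gt := (G _).1 t.
  have -> : (p s).1 - (p t).1 = ((p s).1 - gs) + (gs - gt) + - ((p t).1 - gt).
    by apply/rowP => i; rewrite !mxE; ring.
  move=> A1 A2 A3; rewrite (le_trans (ler_norm3 _ _ _))// normrN; lra.
exists (fun t => (p t).1), (fun i t => (p t).2 i); split => //.
- move=> t t0; have [H1 _] := Hp t; have [_ + _ _ _] := HG 0%N.
  by rewrite (H1 0%N _).1// (le_trans t0).
- by move=> t St; have [_ H2] := Hp t; rewrite (H2 St).1.
- split=> [q|t]; last first.
    have [H1 H2] := Hp t; have [/H2[_ {}H2]|/lt_S[i /ltW/H1[_ {}H1]]] := leP Sup t.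
      by rewrite big1// => i _; rewrite H2 expr0n.
    under eq_bigr do rewrite H1.
    by have [_ _ _ [_ H] _] := HG i.
  (* Measurability in the limit: the control is the pointwise limit of the controls of the finite
     concatenations, cut off after [S i]. *)
  pose H i (t : R) : R := if t <= S i then (G i).2 q t else 0.
  pose f (t : R) : R := (p t).2 q.
  apply: (@measurable_fun_cvg _ _ R [set: R] H f).
    move=> i; apply: measurable_fun_ifT; last exact: measurable_cst.
      by apply: measurable_fun_ler => //; exact: measurable_cst.
    by have [_ _ _ [+ _] _] := HG i; apply.
  move=> t _; have [H1 H2] := Hp t; have [St|/lt_S[i /ltW ti]] := leP Sup t.
    rewrite /f (H2 St).2 (_ : H ^~ t = cst 0); first exact: cvg_cst.
    by apply/funext => i; rewrite /H leNgt (lt_le_trans (S_lt i)).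
  apply: cvg_near_cst; exists i => // j /= ij.
  have tj : t <= S j by rewrite (le_trans ti)// S_homo.
  by rewrite /H /f tj; have [_ ->] := H1 _ tj.
- apply: (@sub_countable _ _ _ (\bigcup_i [set t : R | 0 < t < S i /\
        ~ is_derive t 1 (G i).1 (\sum_q (G i).2 q t *: F q ((G i).1 t))])); last first.
    by apply: bigcup_countable => // i _; have [] := HG i.
  apply: subset_card_le => t /= [/andP[t0 tS] nd].
  have [i ti] := lt_S _ tS; exists i => //; split; first by rewrite t0.
  move=> d; apply: nd; have [H1 _] := Hp t; have [-> H2] := H1 _ (ltW ti).
  under eq_bigr do rewrite H2.
  apply: near_eq_is_derive d; near=> s.
  have [H3 _] := Hp s; have [//|-> //] := H3 i _.
  by rewrite ltW//; near: s; exact: lt_nbhsl.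
Unshelve. all: by end_near. Qed.

Lemma flow_curve (a : 'I_m -> R) x (M L r T : R) : \sum_i a i ^+ 2 <= 1 ->
  let V y : 'rV[R]_n := \sum_i a i *: F i y in
  0 < T -> 0 <= M -> 0 <= L -> L * T <= 1 / 2 -> M * T <= r ->
  (forall y, `|y - x| <= r -> `|V y| <= M) ->
  (forall y z, `|y - x| <= r -> `|z - x| <= r -> `|V y - V z| <= L * `|y - z|) ->
  exists g, [/\ hcurve M T x (g T) g (fun i _ => a i), forall t, `|g t - x| <= r,
    forall t : R, 0 < t < T -> is_derive t 1 g (V (g t)) &
    `|g T - x - T *: V x| <= L * M * T * T].
Proof.
move=> a1 V T0 M0 L0 LT MT VM VL.
have [g [gM g0 gT gr dg]] := ode_exists T0 M0 L0 LT MT VM VL.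
exists g; split => //.
  split => //.
  rewrite (_ : [set t | _] = set0); first exact: countable0.
  by apply/seteqP; split => // t [/dg d]; apply.
have dlin (t : R) : is_derive t 1 (fun s : R => s *: V x) (V x).
  apply: is_derive_of_increment => e e0; exists 1 => // q _.
  by rewrite scalerDl addrK subrr normr0 mulr_ge0// ltW.
(* Without its linear part the curve has velocity [V (g t) - V x], of norm at most L M T; hence the
   quadratic error. *)
pose D (t : R) : 'rV[R]_n := g t - t *: V x.
have cD : continuous D.
  move=> t; apply: (@cvgB _ _ _ _ _ g (fun s : R => s *: V x)).
    exact: lipschitz_curve_continuous gM _.
  exact: scalel_continuous.
have -> : g T - x - T *: V x = D T - D 0.
  by rewrite /D scale0r subr0 (g0 0)// addrAC.
rewrite -[X in _ * X](subr0 T).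
have r0 : 0 <= r by rewrite (le_trans _ MT)// mulr_ge0// ltW.
apply: (@derive1_rV_le _ _ D (fun t => V (g t) - V x)) => //; first exact: ltW.
- by rewrite !mulr_ge0// ltW.
- by move=> t tT; apply: is_deriveB; exact: dg.
- move=> t /andP[t0 tT]; apply: le_trans (VL _ _ (gr t) _) _; first by rewrite subrr normr0.
  rewrite -mulrA ler_wpM2l//.
  have -> : g t - x = g t - g 0 by rewrite (g0 0).
  apply: le_trans (gM _ _) _; rewrite subr0 gtr0_norm// ler_wpM2l//; exact: ltW.
Qed.

End HorizontalCurves.

Lemma lipschitz_abs_continuous {R : realType} {n : nat} (M a b : R) (g : R -> 'rV[R]_n) :
  lipschitz_curve M g -> abs_continuous a b g.
Proof.
move=> gM e e0; have M1 : 0 < `|M| + 1 by rewrite ltr_wpDl.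
exists (e / (`|M| + 1)); first by rewrite divr_gt0.
move=> N u v uv _; rewrite ltr_pdivlMr// mulrC => H; apply: le_lt_trans H.
rewrite mulr_sumr ler_sum// => k _; have [_ [uvk _]] := uv k.
apply: le_trans (gM _ _) _; rewrite ger0_norm ?subr_ge0// ler_wpM2r ?subr_ge0//.
by rewrite (le_trans (ler_norm _))// lerDl.
Qed.

Lemma reach_cc_dist {R : realType} {n m : nat} (F : 'I_m -> vfield R n) M T x y :
  reach F M T x y -> (cc_dist F x y <= T%:E)%E.
Proof.
move=> [T0 [g [h [gM g0 gT [mh h1] cd]]]]; apply: ereal_inf_lbound.
exists T => //; split => //; exists g; split; [|exact: g0|exact: gT].
split; first exact: lipschitz_abs_continuous gM.
exists h; split => [i|t _|] //.
  exact: measurable_funTS.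
set E := [set t : R | _] in cd.
(* The times 0 and [T] are added, since [E] only collects times of the open interval. *)
have cE : countable (E `|` [set 0] `|` [set T]).
  by apply: countable_setU2 => //; exact: countable_setU2.
apply: negligibleS (_ : (@lebesgue_measure R).-negligible (E `|` [set 0] `|` [set T])).
  move=> t /= nd; have [//|nE] := pselect ((E `|` [set 0] `|` [set T]) t).
  exfalso; apply: nd; rewrite in_itv/= => /andP[t0 tT].
  apply: contrapT => nd; apply: nE; rewrite /E /=.
  have [|/eqP] := boolP (t == 0); first by move=> /eqP; left; right.
  move: tT; rewrite le_eqVlt => /predU1P[->|tT]; first by right.
  move: t0; rewrite le_eqVlt => /predU1P[<-//|t0 _].
  by left; left; split; first by rewrite t0.
apply/negligibleP; last exact: countable_lebesgue_measure0.
exact: countable_measurable.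
Qed.

(** * Taylor expansion along words of flows *)

Lemma is_derive_pow {R : realType} k (s : R) :
  is_derive s 1 (fun q => q ^+ k.+1) (k.+1%:R * s ^+ k).
Proof.
split; first exact: exprn_derivable.
by rewrite exp_derive /= [_ *: 1]mulr1.
Qed.

Lemma is_derive_taylor_poly {R : realType} (c : nat -> R) q (s : R) :
  is_derive s 1 (fun u => \sum_(i < q.+1) u ^+ i / i`!%:R * c i)
    (\sum_(i < q) s ^+ i / i`!%:R * c i.+1).
Proof.
elim: q => [|q IH].
  rewrite big_ord0 (_ : (fun u => _) = cst (c 0%N)); first exact: is_derive_cst.
  by apply/funext => u; rewrite big_ord1 expr0 fact0 divr1 mul1r.
have -> : (fun u => \sum_(i < q.+2) u ^+ i / i`!%:R * c i) =
  (fun u => \sum_(i < q.+1) u ^+ i / i`!%:R * c i) + (c q.+1 / q.+1`!%:R) \*: (fun u => u ^+ q.+1).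
  apply/funext => u; rewrite big_ord_recr/= !fctE; congr (_ + _).
  by rewrite [RHS](_ : _ = c q.+1 / q.+1`!%:R * u ^+ q.+1)//; ring.
rewrite big_ord_recr/=; apply: is_derive_eq.
  by apply: is_deriveD; apply: is_deriveZ; exact: is_derive_pow.
congr (_ + _); rewrite [LHS](_ : _ = c q.+1 / q.+1`!%:R * (q.+1%:R * s ^+ q))//.
have f0 : q`!%:R != 0 :> R by rewrite pnatr_eq0 -lt0n fact_gt0.
by rewrite factS natrM; field; rewrite f0 addrC natr1 pnatr_eq0.
Qed.

(** Here [f i] stands for the i-th derivative. The factor 1 / q! is given up in the remainder, so
    that each induction step is one use of the mean value inequality. *)
Lemma taylor_bound {R : realType} q (f : nat -> R -> R) (t C : R) : 0 <= t -> 0 <= C ->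
  (forall i, continuous (f i)) ->
  (forall i s, (i < q)%N -> 0 < s < t -> is_derive (s : R) 1 (f i) (f i.+1 s)) ->
  (forall s, 0 <= s <= t -> `|f q s| <= C) ->
  `|f 0%N t - \sum_(i < q) t ^+ i / i`!%:R * f i 0| <= C * t ^+ q.
Proof.
elim: q f t => [|q IH] f t t0 C0 cf df fC.
  by rewrite big_ord0 subr0 expr0 mulr1 fC// t0 lexx.
pose g s := f 0%N s - \sum_(i < q.+1) s ^+ i / i`!%:R * f i 0.
have g0 : g 0 = 0.
  rewrite /g big_ord_recl big1; last by move=> i _; rewrite expr0n/= !mul0r.
  by rewrite expr0 fact0 divr1 mul1r addr0 subrr.
have -> : f 0%N t - \sum_(i < q.+1) t ^+ i / i`!%:R * f i 0 = g t - g 0 by rewrite g0 subr0.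
rewrite exprSr mulrA -[X in _ * X]subr0.
pose dg s := f 1%N s - \sum_(i < q) s ^+ i / i`!%:R * f i.+1 0.
apply: (@derive1_le _ g dg) => //.
- move=> s st; apply: is_deriveB; first exact: df.
  exact: (is_derive_taylor_poly (fun i => f i 0)).
- apply: continuous_subspaceT => s; apply: continuousB; first exact: cf.
  apply: differentiable_continuous; apply/derivable1_diffP.
  by have [] := is_derive_taylor_poly (fun i => f i 0) q s.
- move=> s /andP[s0 st].
  apply: (@le_trans _ _ (C * s ^+ q)).
    apply: (IH (fun i => f i.+1)) => //; first exact: ltW.
    + by move=> i u iq /andP[u0 us]; apply: df => //; rewrite u0 (lt_trans us).
    + by move=> u /andP[u0 us]; apply: fC; rewrite u0 (le_trans us)// ltW.
  by rewrite ler_wpM2l// lerXn2r ?nnegrE// ltW.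
Qed.

Section Chains.
Context {R : realType} {n m : nat}.
Variable X : 'I_m -> option nat -> vfield R n.
Hypothesis sX : forall i, smooth_vfam (X i).
Implicit Types (a : option nat) (l : bool * 'I_m) (w : seq (bool * 'I_m)) (x y : 'rV[R]_n).

Lemma vfam_bounded V : smooth_vfam V -> forall r, exists2 C : R, 0 <= C &
  forall a x, `|x| <= r -> `|(V a x : 'rV[R]_n)| <= C.
Proof.
move=> sV r.
have /choice[C HC] : forall i : 'I_n, exists C : R, 0 <= C /\ forall a x, `|x| <= r -> `|V a x 0 i| <= C.
  by move=> i; have [C C0 H] := cvg_fam_bounded (smooth_fam_cvg (sV i)) r; exists C.
have S0 : 0 <= \sum_i C i by apply: sumr_ge0 => i _; have [] := HC i.
exists (\sum_i C i) => // a x xr; apply: normr_rV_le => // i.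
have [_ /(_ a x xr) H] := HC i; apply: le_trans H _.
by rewrite (bigD1 i)//= lerDl sumr_ge0// => j _; have [] := HC j.
Qed.

Lemma vfam_lipschitz V : smooth_vfam V -> forall r, exists2 L : R, 0 <= L &
  forall a x y, `|x| <= r -> `|y| <= r -> `|(V a x : 'rV[R]_n) - V a y| <= L * `|x - y|.
Proof.
move=> sV r.
have /choice[C HC] : forall p : 'I_n * 'I_n, exists C : R, 0 <= C /\
    forall a x, `|x| <= r -> `|pd p.1 (comp_fam V p.2 a) x| <= C.
  move=> p; have [C C0 H] := cvg_fam_bounded (smooth_fam_cvg (smooth_fam_pd p.1 (sV p.2))) r.
  by exists C.
pose L := \sum_p C p.
have S0 : 0 <= L by apply: sumr_ge0 => p _; have [] := HC p.
have CL p : C p <= L by rewrite /L (bigD1 p)//= lerDl sumr_ge0// => j _; have [] := HC j.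
exists (n%:R * L); first by rewrite mulr_ge0.
move=> a x y xr yr; apply: normr_rV_le => [|i]; first by rewrite !mulr_ge0.
rewrite !mxE; apply: (@C1_lipschitz _ _ (comp_fam V i a) 0 r); rewrite ?subr0//.
  exact: smooth_fam_C1.
move=> j z; rewrite subr0 => zr; apply: le_trans (CL (j, i)).
by have [_] := HC (j, i); apply.
Qed.

Lemma vfam_cvg V : smooth_vfam V -> forall r e : R, 0 < e -> exists J, forall j, (J <= j)%N ->
  forall x, `|x| <= r -> `|(V (Some j) x : 'rV[R]_n) - V None x| <= e.
Proof.
move=> sV r e e0.
have /choice[J HJ] : forall i : 'I_n, exists J, forall j, (J <= j)%N ->
    forall x, `|x| <= r -> `|V (Some j) x 0 i - V None x 0 i| <= e.
  by move=> i; have [_ H] := smooth_fam_cvg (sV i); exact: H.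
exists (\max_i J i)%N => j Jj x xr; apply: normr_rV_le => [|i]; first exact: ltW.
rewrite !mxE HJ//; apply: leq_trans Jj; exact: leq_bigmax.
Qed.

Lemma sqr_sum_le1 (c : 'I_m -> R) : \sum_i c i ^+ 2 <= 1 -> forall i, `|c i| <= 1.
Proof.
move=> c1 i; rewrite -(expr_le1 (n := 2))// -normrX ger0_norm ?sqr_ge0//.
apply: le_trans c1; rewrite (bigD1 i)//= lerDl sumr_ge0// => j _; exact: sqr_ge0.
Qed.

Definition comb (c : 'I_m -> R) a x : 'rV[R]_n := \sum_i c i *: X i a x.

Lemma ler_norm_comb (c : 'I_m -> R) (v : 'I_m -> 'rV[R]_n) : \sum_i c i ^+ 2 <= 1 ->
  `|\sum_i c i *: v i| <= \sum_i `|v i|.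
Proof.
move=> /sqr_sum_le1 c1; apply: le_trans (ler_norm_sum _ _ _) _.
by apply: ler_sum => i _; rewrite normrZ ler_piMl.
Qed.

Lemma comb_bounds r : exists M L : R, [/\ 0 <= M, 0 <= L &
  forall a (c : 'I_m -> R), \sum_i c i ^+ 2 <= 1 ->
    (forall x, `|x| <= r -> `|comb c a x| <= M) /\
    (forall x y, `|x| <= r -> `|y| <= r -> `|comb c a x - comb c a y| <= L * `|x - y|)].
Proof.
have /choice[M HM] : forall i, exists C : R, 0 <= C /\ forall a x, `|x| <= r -> `|X i a x| <= C.
  by move=> i; have [C C0 H] := vfam_bounded (sX i) r; exists C.
have /choice[L HL] : forall i, exists L : R, 0 <= L /\
    forall a x y, `|x| <= r -> `|y| <= r -> `|X i a x - X i a y| <= L * `|x - y|.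
  by move=> i; have [C C0 H] := vfam_lipschitz (sX i) r; exists C.
exists (\sum_i M i), (\sum_i L i); split.
- by apply: sumr_ge0 => i _; have [] := HM i.
- by apply: sumr_ge0 => i _; have [] := HL i.
move=> a c c1; split=> [x xr|x y xr yr].
  apply: le_trans (ler_norm_comb _ c1) _; apply: ler_sum => i _.
  by have [_] := HM i; apply.
rewrite /comb -sumrB; under eq_bigr do rewrite -scalerBr.
apply: le_trans (ler_norm_comb _ c1) _; rewrite mulr_suml; apply: ler_sum => i _.
by have [_] := HL i; apply.
Qed.

Lemma comb_cvg r e : 0 < e -> exists J, forall j, (J <= j)%N ->
  forall (c : 'I_m -> R) x, \sum_i c i ^+ 2 <= 1 -> `|x| <= r ->
  `|comb c (Some j) x - comb c None x| <= e.
Proof.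
move=> e0; have e1 : 0 < e / m.+1%:R by rewrite divr_gt0// ltr0n.
have /choice[J HJ] := fun i => vfam_cvg (sX i) r e1.
exists (\max_i J i)%N => j Jj c x c1 xr.
rewrite /comb -sumrB; under eq_bigr do rewrite -scalerBr.
apply: le_trans (ler_norm_comb _ c1) _.
apply: (@le_trans _ _ (\sum_(i < m) e / m.+1%:R)).
  apply: ler_sum => i _; apply: HJ => //; apply: leq_trans Jj; exact: leq_bigmax.
rewrite sumr_const card_ord -[leLHS]mulr_natl mulrCA ger_pMr//.
by rewrite ler_pdivrMr ?ltr0n// mul1r ler_nat.
Qed.

Definition letter_coef l (i : 'I_m) : R := if i == l.2 then (-1) ^+ l.1 else 0.

Lemma letter_coef_sqr l : \sum_i letter_coef l i ^+ 2 <= 1.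
Proof.
rewrite (bigD1 l.2)//= big1 => [|i il]; last by rewrite /letter_coef (negbTE il) expr0n.
by rewrite /letter_coef eqxx addr0 sqrr_sign.
Qed.

Lemma comb_letter l a x : comb (letter_coef l) a x = letter_field X l a x.
Proof.
rewrite /comb (bigD1 l.2)//= big1 => [|i il].
  by rewrite /letter_coef eqxx addr0.
by rewrite /letter_coef (negbTE il) scale0r.
Qed.

(** A relation rather than a flow map, as integral curves are only known to exist. The estimates
    below hold for every chain that stays in the ball of radius [r]. *)
Fixpoint chain (r : R) a (t : R) w x x' : Prop :=
  if w is l :: w' then exists g : R -> 'rV[R]_n, [/\ g 0 = x, continuous g,
    forall s, `|g s| <= r,
    forall s : R, 0 < s < t -> is_derive s 1 g (letter_field X l a (g s)) &
    chain r a t w' (g t) x']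
  else x' = x.

(** Along an integral curve of V the i-th derivative of f is V^i f. The constant bounds V^q f on the
    ball for all indices, so it depends neither on [a] nor on the curve. *)
Lemma letter_estimate r l (f : family R n) q : smooth_fam f ->
  exists2 C : R, 0 <= C & forall a (g : R -> 'rV[R]_n) t, 0 <= t -> continuous g ->
    (forall s, `|g s| <= r) ->
    (forall s : R, 0 < s < t -> is_derive s 1 g (letter_field X l a (g s))) ->
    `|f a (g t) - \sum_(i < q) t ^+ i / i`!%:R *
       iter i (lieD (letter_field X l)) f a (g 0)| <= C * t ^+ q.
Proof.
move=> sf; pose D i := iter i (lieD (letter_field X l)) f.
have sD i : smooth_fam (D i) by exact: smooth_iter_lieD.
have [C C0 HC] := cvg_fam_bounded (smooth_fam_cvg (sD q)) r.
exists C => // a g t t0 cg gr dg.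
apply: (taylor_bound (f := fun i s => D i a (g s))) => //.
- move=> i s; apply: (@continuous_comp _ _ _ g (D i a)); first exact: cg.
  by have [+ _] := smooth_fam_cvg (sD i); exact.
- move=> i s _ st.
  have := is_derive_comp_curve (smooth_fam_C1 a (sD i)) (dg s st).
  by rewrite -lieDE.
- by move=> s _; exact: HC.
Qed.

Lemma chain_estimate r w d (F : nat -> family R n) : smooth_series F ->
  exists2 C : R, 0 <= C & forall a t x x', 0 <= t -> chain r a t w x x' ->
  `|\sum_(k < d.+1) t ^+ k * F k a x' - \sum_(k < d.+1) t ^+ k * tword X w F k a x|
    <= C * t ^+ d.+1.
Proof.
elim: w => [|l w IH] sF.
  exists 0 => // a t x x' t0 /= ->; by rewrite subrr normr0 mul0r.
have [C1 C10 H1] := IH sF.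
pose G := tword X w F.
have sG : smooth_series G by exact: smooth_tword.
(* The coefficient of t^k is multiplied by t^k, so its own expansion stops at order [d - k]. *)
have /choice[C2 HC2] : forall k, exists C, 0 <= C /\
  forall a (g : R -> 'rV[R]_n) t, 0 <= t -> continuous g ->
    (forall s, `|g s| <= r) ->
    (forall s : R, 0 < s < t -> is_derive s 1 g (letter_field X l a (g s))) ->
    `|G k a (g t) - \sum_(i < (d - k).+1) t ^+ i / i`!%:R *
       iter i (lieD (letter_field X l)) (G k) a (g 0)| <= C * t ^+ (d - k).+1.
  by move=> k; have [C C0 H] := letter_estimate r l (d - k).+1 (sG k); exists C.
exists (C1 + \sum_(k < d.+1) C2 k).
  by rewrite addr_ge0// sumr_ge0// => k _; have [] := HC2 k.
move=> a t x x' t0 /= [g [g0 cg gr dg /(H1 _ _ _ _ t0) H]].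
rewrite -(subrKA (\sum_(k < d.+1) t ^+ k * G k a (g t))).
rewrite (le_trans (ler_normD _ _))// mulrDl lerD//.
have -> : \sum_(k < d.+1) t ^+ k * texp X l G k a x =
  \sum_(k < d.+1) t ^+ k * (\sum_(i < (d - k).+1) t ^+ i / i`!%:R *
       iter i (lieD (letter_field X l)) (G k) a (g 0)).
  pose H2 k i := t ^+ k * (t ^+ i / i`!%:R * iter i (lieD (letter_field X l)) (G k) a x).
  transitivity (\sum_(k < d.+1) \sum_(i < (d - k).+1) H2 k i); last first.
    by apply: eq_bigr => k _; rewrite mulr_sumr g0.
  rewrite sum_triangle; apply: eq_bigr => q _.
  rewrite /texp !fct_sumE mulr_sumr.
  rewrite (reindex_inj rev_ord_inj)/=; apply: eq_bigr => i _.
  have iq : (i <= q)%N by rewrite -ltnS.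
  rewrite subSS /H2 subKn// [in RHS]mulrA [in RHS]mulrA -exprD subnKC//.
  by rewrite -mulrA.
rewrite -sumrB mulr_suml; apply: le_trans (ler_norm_sum _ _ _) _.
apply: ler_sum => k _; rewrite -mulrBr normrM ger0_norm ?exprn_ge0//.
have [_ /(_ a g t t0 cg gr dg) H3] := HC2 k.
apply: le_trans (ler_wpM2l (exprn_ge0 k t0) H3) _.
rewrite mulrCA -exprD addnS subnKC//; by rewrite -ltnS.
Qed.

Section Existence.
Variables (r M L : R).
Hypotheses (M0 : 0 <= M) (L0 : 0 <= L).
Hypothesis bounds : forall a (c : 'I_m -> R), \sum_i c i ^+ 2 <= 1 ->
    (forall x, `|x| <= r -> `|comb c a x| <= M) /\
    (forall x y, `|x| <= r -> `|y| <= r -> `|comb c a x - comb c a y| <= L * `|x - y|).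

Lemma comb_flow a c x T : \sum_i c i ^+ 2 <= 1 -> 0 < T -> L * T <= 1 / 2 ->
  `|x| + M * T <= r ->
  exists g : R -> 'rV[R]_n, [/\ g 0 = x, continuous g,
    forall s, `|g s| <= `|x| + M * T,
    forall s : R, 0 < s < T -> is_derive s 1 g (comb c a (g s)) &
    reach (fun i => X i a) M T x (g T) /\
    `|g T - x - T *: comb c a x| <= L * M * T * T].
Proof.
move=> c1 T0 LT xr; have [bM bL] := bounds a c1.
have inr y : `|y - x| <= M * T -> `|y| <= `|x| + M * T.
  by move=> yx; rewrite -(subrKC x y) (le_trans (ler_normD _ _))// lerD2l.
have [|||g [gc gr dg gT]] := @flow_curve _ _ _ (fun i => X i a) c x M L (M * T) T c1 T0 M0 L0 LT.
- by [].
- by move=> y /inr yr; apply: bM; exact: le_trans xr.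
- by move=> y z /inr yr /inr zr; apply: bL; exact: le_trans xr.
exists g; have [gM g0 _ _ _] := gc; split.
- exact: g0.
- exact: lipschitz_curve_continuous gM.
- by move=> s; exact: inr.
- exact: dg.
- by split; [split => //; exists g, (fun i _ => c i)|exact: gT].
Qed.

Lemma chain_exists a t w x : 0 < t -> L * t <= 1 / 2 ->
  `|x| + (size w)%:R * (M * t) <= r ->
  exists x', chain r a t w x x' /\ reach (fun i => X i a) M ((size w).+1%:R * t) x x'.
Proof.
move=> t0 Lt; have Mt : 0 <= M * t by rewrite mulr_ge0// ltW.
elim: w x => [|l w IH] x xr.
  (* The empty word rests at [x] for a time [t], because [reach] asks for a positive duration; this
     is the extra unit in [(size w).+1]. *)
  by exists x; split => //=; rewrite mul1r; exact: reach_refl.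
move: xr; rewrite /= -[(size w).+1%:R]natr1 mulrDl mul1r => xr.
have w0 : 0 <= (size w)%:R * (M * t) by rewrite mulr_ge0.
have xr' : `|x| + M * t <= r by lra.
have [g [g0 cg gr dg [gre _]]] := comb_flow a (letter_coef_sqr l) t0 Lt xr'.
have [|x' [cx' rx']] := IH (g t); first by have := gr t; lra.
exists x'; split.
  exists g; split => //; first by move=> s; exact: le_trans xr'.
  by move=> s /dg; rewrite comb_letter.
rewrite -[(size w).+2%:R]natr1 mulrDl mul1r addrC; exact: reach_trans gre rx'.
Qed.

Lemma tree_move (e : btree (m := m)) r0 : r0 < r ->
  exists C t0 : R, [/\ 0 <= C, 0 < t0 & forall a x t, `|x| <= r0 -> 0 < t <= t0 ->
    exists x', reach (fun i => X i a) M ((size (tree_word e)).+1%:R * t) x x' /\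
      `|x' - x - t ^+ tdeg e *: teval X e a x| <= C * t ^+ (tdeg e).+1].
Proof.
move=> r0r; set w := tree_word e; set d := tdeg e.
have /choice[C HC] : forall p : 'I_n, exists C : R, 0 <= C /\
    forall a t x x', 0 <= t -> chain r a t w x x' ->
    `|\sum_(k < d.+1) t ^+ k * coord_series (R := R) p k a x' -
      \sum_(k < d.+1) t ^+ k * tword X w (coord_series p) k a x| <= C * t ^+ d.+1.
  move=> p; have [C C0 H] := chain_estimate r w d (smooth_coord_series p).
  by exists C.
(* For [t * K] at most the minimum below, both [L * t <= 1 / 2] and the confinement to radius [r]
   hold; the summand 1 makes [K] positive. *)
pose K : R := (size w)%:R * M + L + 1.
have K0 : 0 < K by rewrite ltr_wpDl// addr_ge0// mulr_ge0.
have S0 : 0 <= \sum_p C p by apply: sumr_ge0 => p _; have [] := HC p.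
pose t0 := Num.min (1 / 2) (r - r0) / K.
have m0 : 0 < Num.min (1 / 2) (r - r0) by rewrite lt_min subr_gt0 r0r divr_gt0.
exists (\sum_p C p), t0; split => //; first by rewrite divr_gt0.
move=> a x t xr0 /andP[t_gt0 tt0].
have : t * K <= Num.min (1 / 2) (r - r0) by rewrite -ler_pdivlMr.
rewrite le_min /K => /andP[Ht1 Ht2].
have wM : 0 <= (size w)%:R * M * t by rewrite !mulr_ge0// ltW.
have Lt0 : 0 <= L * t by rewrite mulr_ge0// ltW.
have [||x' [cx rx]] := @chain_exists a t w x t_gt0.
- lra.
- lra.
exists x'; split => //; apply: normr_rV_le => [|p].
  by rewrite mulr_ge0// exprn_ge0// ltW.
have [Cp0 /(_ a t x x' (ltW t_gt0) cx)] := HC p.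
have -> : \sum_(k < d.+1) t ^+ k * coord_series p k a x' = x' 0 p.
  by rewrite big_ord_recl big1 => [|i _]; rewrite ?mulr0// expr0 mul1r addr0.
rewrite (tree_expansion sX) opprD addrA !mxE => H; apply: le_trans H _.
rewrite ler_wpM2r ?exprn_ge0 ?(ltW t_gt0)//.
by rewrite (bigD1 p)//= lerDl sumr_ge0// => j _; have [] := HC j.
Qed.

End Existence.
End Chains.

(** * Uniform local Chow theorem *)

Definition from_index J (a : option nat) := if a is Some j then (J <= j)%N else true.

Lemma from_indexW J J' a : (J <= J')%N -> from_index J' a -> from_index J a.
Proof. by case: a => //= j; exact: leq_trans. Qed.

Lemma powR_ler_exp {R : realType} (x a b : R) : 0 < x <= 1 -> b <= a -> x `^ a <= x `^ b.
Proof. by move=> x1; exact: ger_powR. Qed.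

Lemma powR_mono {R : realType} (x y a : R) : 0 <= a -> 0 <= x -> x <= y -> x `^ a <= y `^ a.
Proof. by move=> a0 x0 xy; apply: ge0_ler_powR => //; rewrite nnegrE// (le_trans x0). Qed.

Section LocalChow.
Context {R : realType} {n m : nat}.
Variable X : 'I_m -> option nat -> vfield R n.
Hypothesis sX : forall i, smooth_vfam (X i).
Variables (x0 : 'rV[R]_n) (M L : R).
Hypotheses (M0 : 0 <= M) (L0 : 0 <= L).
Hypothesis bounds : forall a (c : 'I_m -> R), \sum_i c i ^+ 2 <= 1 ->
    (forall x, `|x| <= `|x0| + 2 -> `|comb X c a x| <= M) /\
    (forall x y, `|x| <= `|x0| + 2 -> `|y| <= `|x0| + 2 ->
       `|comb X c a x - comb X c a y| <= L * `|x - y|).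

Notation reachX a := (reach (fun i => X i a) M).

(* Horizontal curves issued from points near [x0] realize, up to [o(s)] and in
   time [O(s ^ alpha)], all the displacements in [A s], uniformly in the index. *)
Definition movable (A : R -> set 'rV[R]_n) := exists al C : R, [/\ 0 < al, 0 < C &
  forall e : R, 0 < e -> exists rho J, [/\ 0 < rho, rho <= 1 &
    forall a x s v, from_index J a -> `|x - x0| <= rho -> 0 < s <= rho -> A s v ->
    exists x' T, [/\ reachX a T x x', T <= C * s `^ al & `|x' - x - v| <= e * s]]].

Definition ray (u : 'rV[R]_n) (s : R) : set 'rV[R]_n := [set v | exists2 c : R, 0 <= c <= s & v = c *: u].

Lemma movableS (A B : R -> set 'rV[R]_n) : (forall s, 0 < s -> B s `<=` A s) ->
  movable A -> movable B.
Proof.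
move=> BA [al [C [al0 C0 H]]]; exists al, C; split => // e /H[rho [J [rho0 rho1 {}H]]].
exists rho, J; split => // a x s v aJ xr sr Bv; apply: H => //.
by apply: BA => //; case/andP: sr.
Qed.

Lemma movable_scale (A : R -> set 'rV[R]_n) (c : R) : 0 < c -> movable A ->
  movable (fun s => A (c * s)).
Proof.
move=> c0 [al [C [al0 C0 H]]]; exists al, (C * c `^ al); split => //.
  by rewrite mulr_gt0// powR_gt0.
move=> e e0; have ec0 : 0 < e / c by rewrite divr_gt0.
have [rho [J [rho0 rho1 {}H]]] := H _ ec0.
exists (Num.min rho (rho / c)), J; split.
- by rewrite lt_min rho0 divr_gt0.
- by rewrite ge_min rho1.
move=> a x s v aJ; rewrite !le_min => /andP[xr _] /and3P[s0 sr1 sr2] Av.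
have cs : 0 < c * s <= rho by rewrite mulr_gt0// mulrC -ler_pdivlMr.
have [x' [T [rT TC xT]]] := H a x (c * s) v aJ xr cs Av.
exists x', T; split => //.
  by rewrite (le_trans TC)// powRM ?(ltW c0) ?(ltW s0)// mulrA.
by rewrite (le_trans xT)// mulrA divfK// gt_eqF.
Qed.

(** The two displacements are performed one after the other. The second starts from a displaced
    point, which the bound [K * s] keeps close to [x0]; the smaller exponent prevails since
    [s <= 1]. *)
Lemma movable_add (A B : R -> set 'rV[R]_n) (K : R) : 0 <= K ->
  (forall s u, 0 < s -> A s u -> `|u| <= K * s) -> movable A -> movable B ->
  movable (fun s => [set v | exists u w, [/\ A s u, B s w & v = u + w]]).
Proof.
move=> K0 AK [al1 [C1 [al10 C10 H1]]] [al2 [C2 [al20 C20 H2]]].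
exists (Num.min al1 al2), (C1 + C2); split.
- by rewrite lt_min al10.
- exact: addr_gt0.
move=> e e0; have e20 : 0 < e / 2 by rewrite divr_gt0.
have [r1 [J1 [r10 r11 {}H1]]] := H1 _ e20; have [r2 [J2 [r20 r21 {}H2]]] := H2 _ e20.
(* The intermediate point is within [1 + K + e / 2] times the larger of [s] and the initial distance
   to [x0]. *)
have D0 : 0 < 1 + K + e / 2 by rewrite ltr_wpDl// addr_ge0.
exists (Num.min r1 (r2 / (1 + K + e / 2))), (maxn J1 J2); split.
- by rewrite lt_min r10 divr_gt0.
- by rewrite ge_min r11.
move=> a x s v aJ; rewrite !le_min => /andP[xr1 xr2] /and3P[s0 sr1 sr2] [u [w [Au Bw ->]]].
have [x1 [T1 [rT1 TC1 xT1]]] : exists x' T, [/\ reachX a T x x', T <= C1 * s `^ al1 & `|x' - x - u| <= e / 2 * s].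
  apply: H1 => //; first exact: from_indexW (leq_maxl _ _) aJ.
  by rewrite s0.
have q2 : (1 + K + e / 2) * Num.max s `|x - x0| <= r2.
  by rewrite mulrC -ler_pdivlMr// ge_max sr2.
have sm : s <= Num.max s `|x - x0| by rewrite le_max lexx.
have xm : `|x - x0| <= Num.max s `|x - x0| by rewrite le_max lexx orbT.
have xx1 : `|x1 - x0| <= r2.
  apply: le_trans q2; have -> : x1 - x0 = (x1 - x - u) + u + (x - x0).
    by apply/rowP => i; rewrite !mxE; ring.
  apply: le_trans (ler_norm3 _ _ _) _.
  have : `|u| <= K * Num.max s `|x - x0| by rewrite (le_trans (AK _ _ s0 Au))// ler_wpM2l.
  have : `|x1 - x - u| <= e / 2 * Num.max s `|x - x0|.
    by rewrite (le_trans xT1)// ler_wpM2l// ltW.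
  by lra.
have [x2 [T2 [rT2 TC2 xT2]]] : exists x' T, [/\ reachX a T x1 x', T <= C2 * s `^ al2 & `|x' - x1 - w| <= e / 2 * s].
  apply: H2 => //; first exact: from_indexW (leq_maxr _ _) aJ.
  have Ke : 0 <= K + e / 2 by rewrite addr_ge0// ltW.
  rewrite s0 (le_trans _ q2)// (le_trans sm)// ler_peMl ?(le_trans (ltW s0))// -addrA lerDl//.
have s01 : 0 < s <= 1 by rewrite s0 (le_trans sr1).
exists x2, (T1 + T2); split; first exact: reach_trans rT1 rT2.
  rewrite mulrDl lerD//.
    by rewrite (le_trans TC1)// ler_pM2l// powR_ler_exp// ge_min lexx.
  by rewrite (le_trans TC2)// ler_pM2l// powR_ler_exp// ge_min lexx orbT.
have -> : x2 - x - (u + w) = (x1 - x - u) + (x2 - x1 - w).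
  by apply/rowP => i; rewrite !mxE; ring.
by rewrite (le_trans (ler_normD _ _))// [e]splitr mulrDl lerD.
Qed.

Lemma movable0 : movable (fun _ => [set 0]).
Proof.
exists 1, 1; split => // e e0; exists 1, 0%N; split => // a x s v _ _ /andP[s0 s1] ->.
exists x, (1 * s `^ 1); split => //.
  by apply: reach_refl => //; rewrite mul1r powR_gt0.
by rewrite subrr subr0 normr0 mulr_ge0// ltW.
Qed.

(** The displacement [sg *: Y] takes letters of duration sg^(1/k), with k the degree; this is where
    the exponent 1/k comes from. The errors due to the higher order terms, to the index and to the
    base point are each at most [ep / 4 * sg]. *)
Lemma movable_tree (e : btree (m := m)) : movable (ray (teval X e None x0)).
Proof.
set k := tdeg e; set Y := teval X e.
have k0 : (0 < k)%N := tdeg_gt0 e.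
have k0R : 0 < k%:R^-1 :> R by rewrite invr_gt0 ltr0n.
exists k%:R^-1, (size (tree_word e)).+1%:R; split => // ep ep0.
have x01 : `|x0| + 1 < `|x0| + 2 by rewrite ltrD2l ltr1n.
have [C [t0 [C0 t00 HC]]] := tree_move sX M0 L0 bounds e x01.
have sY : smooth_vfam Y by exact: smooth_teval.
have [LY LY0 HLY] := vfam_lipschitz sY (`|x0| + 1).
have e40 : 0 < ep / 4 by rewrite divr_gt0.
have [J HJ] := vfam_cvg sY (`|x0| + 1) e40.
have C1 : 0 < C + 1 by rewrite ltr_wpDl.
have L1 : 0 < LY + 1 by rewrite ltr_wpDl.
pose tau := Num.min t0 (ep / 4 / (C + 1)).
have tau0 : 0 < tau by rewrite lt_min t00 !divr_gt0.
exists (Num.min 1 (Num.min (ep / 4 / (LY + 1)) (tau ^+ k))), J; split.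
- by rewrite !lt_min ltr01 !divr_gt0// exprn_gt0.
- by rewrite ge_min lexx.
move=> a x s v aJ; rewrite !le_min => /and3P[xr1 xr2 _] /and4P[s0 sr1 _ sr3].
move=> [sg /andP[sg0 sgs] ->].
(* For the zero displacement the curve rests, as the move along a tree needs t > 0. *)
have [->|sgn0] := eqVneq sg 0.
  exists x, ((size (tree_word e)).+1%:R * s `^ k%:R^-1); split => //.
    by apply: reach_refl => //; rewrite mulr_gt0// powR_gt0.
  by rewrite subrr scale0r subrr normr0 mulr_ge0// ltW.
have sg_gt0 : 0 < sg by rewrite lt_neqAle eq_sym sgn0.
pose t := sg `^ k%:R^-1.
have t_gt0 : 0 < t by rewrite powR_gt0.
have tk : t ^+ k = sg.
  by rewrite -powR_mulrn ?(ltW t_gt0)// -powRrM mulVf ?powRr1// pnatr_eq0 -lt0n.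
have ttau : t <= tau.
  by rewrite -(ler_pXn2r k0) ?nnegrE ?(ltW t_gt0) ?(ltW tau0)// tk (le_trans sgs).
have [tt0 ttC] : t <= t0 /\ t <= ep / 4 / (C + 1).
  by move: ttau; rewrite /tau le_min => /andP.
have xn : `|x| <= `|x0| + 1.
  by rewrite -(subrKC x0 x) (le_trans (ler_normD _ _))// lerD2l.
have x0n : `|x0| <= `|x0| + 1 by rewrite lerDl.
have [|x' [rx' Hx']] := HC a x t xn; first by rewrite t_gt0.
exists x', ((size (tree_word e)).+1%:R * t); split => //.
  by rewrite ler_pM2l ?ltr0n// powR_mono// ltW.
have YY : `|Y a x - Y None x0| <= ep / 4 + ep / 4.
  rewrite -(subrKA (Y None x)) (le_trans (ler_normD _ _))// lerD//.
    case: a aJ {HC rx' Hx'} => [j|_]; first by move/HJ; exact.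
    by rewrite subrr normr0 ltW.
  apply: le_trans (HLY None x x0 xn x0n) _.
  have : `|x - x0| * (LY + 1) <= ep / 4 by rewrite -ler_pdivlMr.
  by have := normr_ge0 (x - x0); lra.
have -> : x' - x - sg *: Y None x0 = (x' - x - t ^+ k *: Y a x) + sg *: (Y a x - Y None x0).
  by rewrite tk; apply/rowP => i; rewrite !mxE; ring.
rewrite (le_trans (ler_normD _ _))// normrZ gtr0_norm//.
have Ct : t * (C + 1) <= ep / 4 by rewrite -ler_pdivlMr.
have : `|x' - x - t ^+ k *: Y a x| <= ep / 4 * sg.
  apply: le_trans Hx' _; rewrite exprS tk mulrA ler_wpM2r//; lra.
have : sg * `|Y a x - Y None x0| <= (ep / 4 + ep / 4) * sg by rewrite mulrC ler_pM2r.
have : ep * sg <= ep * s by rewrite ler_pM2l.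
have : 0 <= ep * sg by rewrite mulr_ge0// ltW.
lra.
Qed.

Lemma movable_rayD u v : movable (ray u) -> movable (ray v) -> movable (ray (u + v)).
Proof.
move=> mu mv; apply: movableS (movable_add (normr_ge0 u) _ mu mv).
  move=> s s0 w [c cs ->]; exists (c *: u), (c *: v); split; last exact: scalerDr.
    by exists c.
  by exists c.
move=> s w s0 [c /andP[c0 cs] ->]; rewrite normrZ ger0_norm// mulrC.
by rewrite ler_wpM2l.
Qed.

Lemma movable_rayZ u c : 0 <= c -> movable (ray u) -> movable (ray (c *: u)).
Proof.
rewrite le_eqVlt => /predU1P[<-|c0] mu.
  apply: movableS movable0 => s s0 v [b _ ->].
  by rewrite /= scale0r scaler0.
apply: movableS (movable_scale c0 mu) => s s0 v [b /andP[b0 bs] ->].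
exists (c * b); last by rewrite scalerA mulrC.
by rewrite mulr_ge0 ?(ltW c0)//= ler_pM2l.
Qed.

(** Only nonnegative multiples of a movable ray come for free, so both signs of each generator are
    required; a negative coefficient uses the opposite ray. *)
Lemma movable_ray_span (s : seq 'rV[R]_n) v :
  (forall u, u \in s -> movable (ray u) /\ movable (ray (- u))) -> v \in span s ->
  movable (ray v).
Proof.
elim: s v => [|u s IH] v Hs.
  rewrite span_nil memv0 => /eqP ->; apply: movableS movable0 => r r0 w [c _ ->].
  by rewrite /= scaler0.
rewrite span_cons => /memv_addP[_ /vlineP[c ->] [w ws ->]].
apply: movable_rayD; last first.
  by apply: IH ws => u' u's; apply: Hs; rewrite inE u's orbT.
have [m1 m2] := Hs u (mem_head _ _).
have [c0|/ltW c0] := leP 0 c; first exact: movable_rayZ.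
by rewrite -(opprK c) scaleNr -scalerN; apply: movable_rayZ => //; rewrite oppr_ge0.
Qed.

Hypothesis chow : chow_hormander (fun i => X i None).

Lemma commutator_tree (Y : vfield R n) : commutator (fun i => X i None) Y ->
  exists e : btree (m := m), teval X e None = Y.
Proof.
elim=> [i|Y1 Y2 _ [e1 E1] _ [e2 E2]].
  exists (Leaf (false, i)); apply/funext => x.
  by rewrite /= /letter_field/= expr0 scale1r.
by exists (Br e1 e2); rewrite /= /bracket_fam E1 E2.
Qed.

Lemma movable_ray_all v : movable (ray v).
Proof.
have : linear_span [set Y x0 | Y in [set Y | commutator (fun i => X i None) Y]] v.
  by rewrite chow.
move=> [s sA vs]; apply: movable_ray_span vs => u /sA[Y /commutator_tree[e <-] <-].
split; first exact: movable_tree.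
have := movable_tree (tneg e).
by rewrite teval_neg.
Qed.

(** The threshold for a ray depends on its direction. Uniformity over the ball is obtained by
    decomposing vectors along the finitely many axes, adding one coordinate at each step. *)
Lemma movable_ball : movable (fun s => [set v | `|v| <= s]).
Proof.
suff H k : movable (fun s => [set v : 'rV[R]_n | `|v| <= s /\ forall i : 'I_n, (k <= i)%N -> v 0 i = 0]).
  apply: movableS (H n) => s s0 v vs; split => // i.
  by rewrite leqNgt ltn_ord.
elim: k => [|k IH].
  apply: movableS movable0 => s s0 v [_ v0].
  by apply/rowP => i; rewrite v0// mxE.
have [kn|nk] := ltnP k n; last first.
  apply: movableS IH => s s0 v [vs v0]; split => // i ki.
  by have := ltn_ord i; rewrite ltnNge (leq_trans nk).
pose e : 'rV[R]_n := delta_mx 0 (Ordinal kn).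
have ne : `|e| <= 1.
  by apply: normr_rV_le => // j; rewrite mxE eqxx/= ger0_norm ?ler0n// lern1 leq_b1.
have bd (u : 'rV[R]_n) s w : `|u| <= 1 -> 0 < s -> ray u s w -> `|w| <= 1 * s.
  move=> u1 s0 [c /andP[c0 cs] ->]; rewrite normrZ ger0_norm// mulrC.
  exact: ler_pM.
(* The coordinate along [e] is split into its positive and negative parts, each handled by one of
   the rays of [e] and [- e]. *)
have m1 := movable_add ler01 (fun s w => bd (- e) s w (eq_ind_r (fun r => r <= 1) ne (normrN e)))
  (movable_ray_all (- e)) IH.
have m2 := movable_add ler01 (fun s w => bd e s w ne) (movable_ray_all e) m1.
apply: movableS m2 => s s0 v [vs v0]; pose c := v 0 (Ordinal kn).
have cs : `|c| <= s by rewrite (le_trans _ vs)// ler_coord_normr.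
exists (Num.max c 0 *: e), (v - Num.max c 0 *: e); split; last by rewrite subrKC.
  exists (Num.max c 0) => //; rewrite le_max lexx orbT/= ge_max (ltW s0) andbT.
  by rewrite (le_trans (ler_norm _)).
exists (Num.max (- c) 0 *: - e), (v - c *: e); split.
- exists (Num.max (- c) 0) => //; rewrite le_max lexx orbT/= ge_max (ltW s0) andbT.
  by rewrite (le_trans _ cs)// -normrN ler_norm.
- split=> [|i].
    apply: normr_rV_le => [|i]; first exact: ltW.
    rewrite !mxE eqxx/=; case: eqP => [->|_].
      by rewrite mulr1 subrr normr0 ltW.
    by rewrite mulr0 subr0 (le_trans _ vs)// ler_coord_normr.
  rewrite leq_eqVlt => /predU1P[ki|ki]; rewrite !mxE eqxx/=.
    have -> : i = Ordinal kn by apply: val_inj.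
    by rewrite eqxx mulr1 subrr.
  rewrite v0//; have -> : i == Ordinal kn = false by rewrite -val_eqE/= gtn_eqF.
  by rewrite mulr0 subrr.
rewrite scalerN -scaleNr; apply/rowP => i; rewrite !mxE.
have : Num.max c 0 - Num.max (- c) 0 = c.
  by rewrite !maxElt; do !case: ltP => ?; lra.
move=> E; have -> : Num.max c 0 = c + Num.max (- c) 0 by rewrite -{2}E subrK.
ring.
Qed.

(** Aiming at [y] with error at most half the distance bound, repeatedly, leaves s / 2^i after i
    moves. The durations are dominated by a geometric series of ratio [th], whatever the exponent
    [al > 0]. *)
Lemma local_chow_aux (e : R) : 0 < e -> exists rho J, 0 < rho /\
  forall a x y, from_index J a -> `|x - x0| <= rho -> `|y - x0| <= rho ->
  exists2 T, T <= e & reachX a T x y.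
Proof.
move=> e0; have [al [C [al0 C0 H]]] := movable_ball.
have h0 : 0 < 1 / 2 :> R by rewrite divr_gt0.
have [rho [J [rho0 rho1 {}H]]] := H _ h0.
pose th : R := (1 / 2) `^ al.
have th0 : 0 < th by rewrite powR_gt0.
have th1 : th < 1.
  have <- : 1 `^ al = 1 :> R by rewrite powR1.
  apply: gt0_ltr_powR => //; rewrite ?nnegrE ?ltW//.
  by rewrite ltr_pdivrMr// mul1r ltr1n.
have th1' : 0 < 1 - th by rewrite subr_gt0.
pose K := e * (1 - th) / C.
have K0 : 0 < K by rewrite divr_gt0// mulr_gt0.
pose s := Num.min (rho / 2) (K `^ al^-1).
have s0 : 0 < s by rewrite lt_min divr_gt0//= powR_gt0.
have srho : s <= rho / 2 by rewrite ge_min lexx.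
have sK : s `^ al <= K.
  apply: (@le_trans _ _ ((K `^ al^-1) `^ al)).
    by apply: powR_mono (ltW al0) (ltW s0) _; rewrite ge_min lexx orbT.
  by rewrite -powRrM mulVf ?gt_eqF// powRr1// ltW.
exists (s / 2), J; split; first by rewrite divr_gt0.
move=> a x y aJ xr yr.
have si0 i : 0 < s / 2 ^+ i by rewrite divr_gt0// exprn_gt0.
have sis i : s / 2 ^+ i <= s.
  by rewrite ler_pdivrMr ?exprn_gt0// ler_peMr ?(ltW s0)// exprn_ege1// ler1n.
(* The pair [(0, 0)] is a default outside the regime of the iteration. *)
have /choice[next Hnext] : forall p : nat * 'rV[R]_n, exists q : 'rV[R]_n * R,
    `|p.2 - y| <= s / 2 ^+ p.1 ->
    [/\ reachX a q.2 p.2 q.1, q.2 <= C * (s / 2 ^+ p.1) `^ al & `|q.1 - y| <= s / 2 ^+ p.1.+1].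
  move=> [i p] /=; have [py|py] := pselect (`|p - y| <= s / 2 ^+ i); last by exists (0, 0).
  have [|||x' [T [rT TC xT]]] := H a p (s / 2 ^+ i) (y - p) aJ.
  - rewrite -(subrKA y) (le_trans (ler_normD _ _))//.
    by have := sis i; lra.
  - by rewrite si0 (le_trans (sis i))//; lra.
  - by rewrite /= distrC.
  exists (x', T) => _; split => //=.
  move: xT; rewrite opprB addrA subrK => /le_trans; apply.
  by rewrite exprS invfM mulrCA div1r.
pose p := fix p i := if i is k.+1 then (next (k, p k)).1 else x.
have py i : `|p i - y| <= s / 2 ^+ i.
  elim: i => [|i IH] /=; last by have [] := Hnext (i, p i) IH.
  rewrite expr0 divr1 -(subrKA x0) (le_trans (ler_normD _ _))//.
  by rewrite [`|x0 - y|]distrC; lra.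
pose T i := (next (i, p i)).2.
have HT i : reachX a (T i) (p i) (p i.+1) /\ T i <= C * s `^ al * th ^+ i.
  have [r1 r2 _] := Hnext (i, p i) (py i); split => //; apply: le_trans r2 _.
  have -> : s / 2 ^+ i = s * (1 / 2) ^+ i by rewrite expr_div_n expr1n div1r.
  rewrite (powRM al (ltW s0) (ltW (exprn_gt0 i h0))) -mulrA ler_pM2l//.
  rewrite ler_pM2l ?powR_gt0// /th -!powR_mulrn ?powR_ge0 ?(ltW h0)//.
  by rewrite powRAC.
have sumT i : \sum_(k < i) T k <= e.
  have Cs0 : 0 <= C * s `^ al by rewrite mulr_ge0 ?powR_ge0// ltW.
  apply: (@le_trans _ _ (C * s `^ al * \sum_(k < i) th ^+ k)).
    by rewrite mulr_sumr; apply: ler_sum => k _; case: (HT k).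
  apply: (@le_trans _ _ (C * s `^ al * (1 - th)^-1)).
    rewrite ler_wpM2l// -[leRHS]mul1r ler_pdivlMr// mulrC.
    have := subrX1 th i; have : 0 <= th ^+ i by rewrite exprn_ge0// ltW.
    by set S := \sum_(k < i) _; lra.
  rewrite ler_pdivrMr// mulrC -ler_pdivlMr//.
have [] := @reach_lim _ _ _ (fun i => X i a) M T p y e M0 (fun i => (HT i).1) sumT.
  apply/cvgrPdist_le => d d0; have [N HN] := div_pow2_small (ltW s0) d0.
  by exists N => // i /= Ni; rewrite distrC (le_trans (py i))// HN.
by move=> S Se rS; exists S.
Qed.

End LocalChow.

Lemma local_chow {R : realType} {n m : nat} (X : 'I_m -> option nat -> vfield R n)
    (x0 : 'rV[R]_n) (e : R) :
  (forall i, smooth_vfam (X i)) -> chow_hormander (fun i => X i None) -> 0 < e ->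
  exists M rho J, [/\ 0 <= M, 0 < rho & forall a x y, from_index J a ->
    `|x - x0| <= rho -> `|y - x0| <= rho ->
    exists2 T, T <= e & reach (fun i => X i a) M T x y].
Proof.
move=> sX chow e0; have [M [L [M0 L0 bounds]]] := comb_bounds sX (`|x0| + 2).
have [rho [J [rho0 H]]] := local_chow_aux sX M0 L0 bounds chow e0.
by exists M, rho, J; split.
Qed.

(** * Mean value theorem for absolutely continuous curves *)

(* Cousin's lemma, as an induction principle on intervals. *)
Lemma cousin {R : realType} (Q : R -> R -> Prop) (u v : R) : u <= v ->
  (forall p q r, u <= p -> p <= q -> q <= r -> r <= v -> Q p q -> Q q r -> Q p r) ->
  (forall t, u <= t <= v -> exists2 d, 0 < d & forall p q, u <= p -> p <= t ->
     t <= q -> q <= v -> t - d < p -> q < t + d -> Q p q) -> Q u v.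
Proof.
move=> uv Qadd Qloc; pose A := [set t | u <= t <= v /\ Q u t].
have Au : A u.
  split; first by rewrite lexx.
  have [|d d0 H] := Qloc u; first by rewrite lexx.
  by apply: H => //; rewrite ?ltrBlDr ltrDl.
have hsA : has_sup A by split; [exists u|exists v => t [/andP[]]].
pose c := sup A.
have cv : c <= v by apply: ge_sup; [exists u|move=> t [/andP[]]].
have uc : u <= c by apply: ub_le_sup; [exact: hsA.2|].
have [|d d0 H] := Qloc c; first by rewrite uc.
have [t At tc] : exists2 t, A t & c - d < t.
  by apply: sup_gt; [exists u|rewrite ltrBlDr ltrDl].
have tc' : t <= c by apply: ub_le_sup; [exact: hsA.2|].
have [/andP[ut tv] Qut] := At.
(* This point lies beyond the supremum [c] unless [c = v]; being in [A], it forces [c = v]. *)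
pose q := Num.min v (c + d / 2).
have d20 : 0 < d / 2 by rewrite divr_gt0.
have cq : c <= q by rewrite le_min cv lerDl ltW.
have qv : q <= v by rewrite ge_min lexx.
have qcd : q <= c + d / 2 by rewrite ge_min lexx orbT.
have Qtq : Q t q by apply: H => //; lra.
have Quq : Q u q by apply: (Qadd _ t) => //; exact: le_trans cq.
have Aq : A q by split => //; rewrite qv (le_trans uc).
have qc : q <= c by apply: ub_le_sup; [exact: hsA.2|].
have -> : v = q by rewrite /q min_l//; move: qc; rewrite /q ge_min => /orP[]; lra.
exact: Quq.
Qed.

(** The triangle inequality without square roots: termwise it reduces to (s a - r b)^2 >= 0. It
    bounds the coefficients when adjacent intervals are joined. *)
Lemma minkowski2 {R : realType} m (a b : 'I_m -> R) (r s : R) : 0 <= r -> 0 <= s ->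
  \sum_i a i ^+ 2 <= r ^+ 2 -> \sum_i b i ^+ 2 <= s ^+ 2 ->
  \sum_i (a i + b i) ^+ 2 <= (r + s) ^+ 2.
Proof.
have zero (c : 'I_m -> R) : \sum_i c i ^+ 2 <= 0 ^+ 2 -> c = fun _ => 0.
  rewrite expr0n/= => c0; apply/funext => i; apply/eqP; rewrite -sqrf_eq0.
  rewrite eq_le sqr_ge0 andbT (le_trans _ c0)// (bigD1 i)//= lerDl.
  by rewrite sumr_ge0// => j _; exact: sqr_ge0.
rewrite le_eqVlt => /predU1P[<-|r0].
  by move=> _ /zero -> H; rewrite add0r; under eq_bigr do rewrite add0r.
rewrite le_eqVlt => /predU1P[<-|s0].
  by move=> H /zero ->; rewrite addr0; under eq_bigr do rewrite addr0.
move=> Ha Hb.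
have key i : (a i + b i) ^+ 2 <= (r + s) / r * a i ^+ 2 + (r + s) / s * b i ^+ 2.
  rewrite -subr_ge0.
  have -> : (r + s) / r * a i ^+ 2 + (r + s) / s * b i ^+ 2 - (a i + b i) ^+ 2 =
      (s * a i - r * b i) ^+ 2 / (r * s) by field; rewrite !gt_eqF.
  by rewrite divr_ge0 ?sqr_ge0// mulr_ge0// ltW.
apply: le_trans (ler_sum _ (fun i _ => key i)) _.
rewrite big_split/= -!mulr_sumr.
have -> : (r + s) ^+ 2 = (r + s) / r * r ^+ 2 + (r + s) / s * s ^+ 2.
  by field; rewrite !gt_eqF.
by rewrite lerD// ler_wpM2l// divr_ge0 ?addr_ge0// ltW.
Qed.

(** * Finite families of consecutive intervals *)

Section IntervalChains.
Context {R : realType}.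
Implicit Types (s : seq (R * R)) (p q : R).

(** Disjointness is encoded by the order of the list, gaps being allowed, so that families in
    adjacent intervals are simply concatenated. *)
Fixpoint itv_chain p q s : Prop :=
  if s is cd :: s' then [/\ p <= cd.1, cd.1 <= cd.2 & itv_chain cd.2 q s'] else p <= q.

Lemma itv_chain_cat p q r s1 s2 :
  itv_chain p q s1 -> itv_chain q r s2 -> itv_chain p r (s1 ++ s2).
Proof.
elim: s1 p => [|[c d] s1 IH] p /=; last first.
  by move=> [pc cd H] H2; split => //; exact: IH H H2.
move=> pq; case: s2 => [|[c d] s2] /=; first exact: le_trans.
by move=> [qc cd H]; split => //; exact: le_trans qc.
Qed.

Lemma itv_chain_le p q s : itv_chain p q s -> p <= q.
Proof.
elim: s p => [|[c d] s IH] p //= [pc cd /IH dq].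
exact: le_trans pc (le_trans cd dq).
Qed.

Lemma itv_chain_bounds p q s k : itv_chain p q s -> (k < size s)%N ->
  [/\ p <= (nth (0, 0) s k).1, (nth (0, 0) s k).1 <= (nth (0, 0) s k).2 &
      (nth (0, 0) s k).2 <= q].
Proof.
elim: s p k => [|[c d] s IH] p [|k] //= [pc cd H] ks.
  by split => //; exact: itv_chain_le H.
have [H1 H2 H3] := IH _ _ H ks; split => //.
exact: le_trans pc (le_trans cd H1).
Qed.

Lemma itv_chain_sorted p q s k l : itv_chain p q s -> (k < l)%N -> (l < size s)%N ->
  (nth (0, 0) s k).2 <= (nth (0, 0) s l).1.
Proof.
elim: s p k l => [|[c d] s IH] p k [|l] //= [pc cd H]; rewrite !ltnS.
case: k => [|k] /= kl ls; last exact: IH H kl ls.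
by have [] := itv_chain_bounds H ls.
Qed.

Lemma abs_continuous_chain n (g : R -> 'rV[R]_n) (a b e : R) : abs_continuous a b g ->
  0 < e -> exists2 d : R, 0 < d & forall s, itv_chain a b s ->
    \sum_(cd <- s) (cd.2 - cd.1) < d -> \sum_(cd <- s) `|g cd.2 - g cd.1| < e.
Proof.
move=> ac e0; have [d d0 H] := ac _ e0; exists d => // s cs.
rewrite !(big_nth (0, 0)) !big_mkord => sd.
apply: (H (size s) (fun k => (nth (0, 0) s k).1) (fun k => (nth (0, 0) s k).2)) => //.
  by move=> k; have [] := itv_chain_bounds cs (ltn_ord k).
apply/trivIsetP => k l _ _ kl; apply/seteqP; split => // t [] /=.
rewrite !in_itv/= => /andP[k1 k2] /andP[l1 l2].
have [/itv_chain_sorted H1|/itv_chain_sorted H1|/val_inj/eqP] := ltngtP k l.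
- by have := lt_le_trans k2 (le_trans (H1 _ _ _ cs (ltn_ord l)) (ltW l1)); rewrite ltxx.
- by have := lt_le_trans l2 (le_trans (H1 _ _ _ cs (ltn_ord k)) (ltW k1)); rewrite ltxx.
by rewrite (negbTE kl).
Qed.

Lemma itv_chain_measure (U : set R) p q s : measurable U -> itv_chain p q s ->
  (forall cd, cd \in s -> `[cd.1, cd.2[%classic `<=` U) ->
  ((\sum_(cd <- s) (cd.2 - cd.1))%:E <= lebesgue_measure (U `&` `[p, q[%classic))%E.
Proof.
move=> mU; elim: s p => [|[c d] s IH] p /= => [_ _|[pc cd cs] sU].
  by rewrite big_nil.
rewrite big_cons/= EFinD.
have cdU : `[c, d[%classic `<=` U by exact: (sU (c, d) (mem_head _ _)).
have mI (x y : R) : measurable `[x, y[%classic by exact: measurable_itv.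
apply: (@le_trans _ _ (lebesgue_measure (`[c, d[%classic `|` (U `&` `[d, q[%classic)))%E).
  rewrite measureU//=; last 2 first.
  - exact: measurableI.
  - apply/seteqP; split => // t [] /=.
    rewrite !in_itv/= => /andP[_ td] [_ /andP[dt _]].
    by have := lt_le_trans td dt; rewrite ltxx.
  apply: leeD.
    rewrite lebesgue_measure_itv/= lte_fin; case: ltP => [//|dc].
    by rewrite lee_fin subr_le0.
  by apply: IH => // x xs; apply: sU; rewrite inE xs orbT.
apply: le_measure; rewrite ?inE.
- by apply: measurableU => //; exact: measurableI.
- exact: measurableI.
have dq := itv_chain_le cs.
move=> t [tcd|[Ut]] /=; last first.
  rewrite /= !in_itv/= => /andP[dt ->]; split => //; rewrite andbT.
  exact: le_trans pc (le_trans cd dt).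
split; first exact: cdU.
move: tcd; rewrite /= !in_itv/= => /andP[ct td].
by rewrite (le_trans pc ct) (lt_le_trans td).
Qed.

End IntervalChains.

Lemma negligible_open_cover {R : realType} (E : set R) (d : R) :
  (@lebesgue_measure R).-negligible E -> 0 < d ->
  exists U, [/\ open U, E `<=` U & (lebesgue_measure U < d%:E)%E].
Proof.
move=> [N [mN N0 EN]] d0.
have {}N0 : lebesgue_measure (N : set R) = 0%E := N0.
have [|U [oU NU Ud]] := @lebesgue_regularity_outer R N d mN _ d0.
  by apply: (@eq_ind_r _ 0%E (fun z => (z < +oo)%E) _ _ N0); rewrite ltry.
exists U; split => //; first exact: subset_trans NU.
have mU := open_measurable oU.
have -> : lebesgue_measure U = (lebesgue_measure (N : set R) + lebesgue_measure (U `\` N))%E.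
  rewrite -measureU ?setDUK//; first exact: measurableD.
  by rewrite setDIK.
by rewrite N0 add0e.
Qed.

Section MeanValue.
Context {R : realType} {n m : nat}.
Variables (T : R) (g w : R -> 'rV[R]_n) (h : 'I_m -> R -> R).
Hypothesis acg : abs_continuous 0 T g.
Hypothesis h1 : forall t : R, t \in `[0, T] -> \sum_(i < m) h i t ^+ 2 <= 1.
Hypothesis dg : {ae lebesgue_measure, forall t : R, t \in `[0, T] -> is_derive t 1 g (w t)}.

(* The increment of [g] is an integral of [w]; approximating [w] by combinations
   of the fixed vectors [b i] and averaging keeps the coefficients in the unit ball. *)
Lemma ac_mean_value (b : 'I_m -> 'rV[R]_n) (u v kap e : R) :
  0 <= u -> u <= v -> v <= T -> 0 < e ->
  (forall t, u <= t <= v -> `|w t - \sum_i h i t *: b i| <= kap) ->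
  exists2 a : 'I_m -> R, \sum_i a i ^+ 2 <= 1 &
    `|g v - g u - (v - u) *: \sum_i a i *: b i| <= kap * (v - u) + e.
Proof.
move=> u0 uv vT e0 wb.
have [uv_eq|uv_neq] := eqVneq u v.
  exists (fun _ => 0); first by rewrite big1// => i _; rewrite expr0n.
  by rewrite uv_eq !subrr scale0r subrr normr0 mulr0 add0r ltW.
have uv' : 0 < v - u by rewrite subr_gt0 lt_neqAle uv_neq.
have e20 : 0 < e / 2 by rewrite divr_gt0.
pose eta := e / 2 / (v - u).
have eta0 : 0 < eta by rewrite divr_gt0.
have [d d0 Hd] := abs_continuous_chain acg e20.
have [U [oU EU Ud]] := negligible_open_cover dg d0.
(* An additive predicate for Cousin's lemma: [a] is the integrated control, of norm at most [q - p],
   and [s] lists bad intervals inside the small open set [U], on which the whole variation of [g] is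
   charged to the error. *)
pose Q (p q : R) := exists s (a : 'I_m -> R), [/\ itv_chain p q s,
  forall cd, cd \in s -> `[cd.1, cd.2[%classic `<=` U,
  \sum_i a i ^+ 2 <= (q - p) ^+ 2 &
  `|g q - g p - \sum_i a i *: b i| <=
    (kap + eta) * (q - p) + \sum_(cd <- s) `|g cd.2 - g cd.1|].
have Quv : Q u v.
  apply: cousin => //.
  - move=> p q r up pq qr rv [s1 [a1 [c1 s1U a11 H1]]] [s2 [a2 [c2 s2U a21 H2]]].
    exists (s1 ++ s2), (fun i => a1 i + a2 i); split.
    + exact: itv_chain_cat c1 c2.
    + by move=> cd; rewrite mem_cat => /orP[/s1U|/s2U].
    + have -> : r - p = (q - p) + (r - q) by ring.
      by apply: minkowski2; rewrite ?subr_ge0.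
    have -> : g r - g p - \sum_i (a1 i + a2 i) *: b i =
       (g q - g p - \sum_i a1 i *: b i) + (g r - g q - \sum_i a2 i *: b i).
      under eq_bigr do rewrite scalerDl.
      by rewrite big_split/=; apply/rowP => i; rewrite !mxE; ring.
    rewrite (le_trans (ler_normD _ _))// big_cat/=; lra.
  - move=> t /andP[ut tv].
    (* Near a point of [U] the interval is declared bad, with coefficients 0. At any other point [g]
       is differentiable and the control at [t] is used on the whole interval. *)
    have [Ut|Ut] := pselect (U t).
      have /nbhs_ballP[r /= r0 Hr] := oU t Ut.
      exists r => // p q up pt tq qv tp qt.
      exists [:: (p, q)], (fun _ => 0); split => /=.
      + by split => //; exact: le_trans tq.
      + move=> cd; rewrite inE => /eqP -> x /=; rewrite in_itv/= => /andP[px xq].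
        by apply: Hr; rewrite -ball_normE /= ltr_norml; lra.
      + by rewrite big1 ?sqr_ge0// => i _; rewrite expr0n.
      rewrite big1 => [|i _]; last by rewrite scale0r.
      rewrite subr0 big_seq1/= lerDr mulr_ge0//; last by rewrite subr_ge0 (le_trans pt).
      rewrite addr_ge0 ?(ltW eta0)// (le_trans (normr_ge0 _) (wb u _))//.
      by rewrite lexx.
    have tT : t \in `[0, T] by rewrite in_itv/= (le_trans u0 ut) (le_trans tv).
    have dt : is_derive t 1 g (w t).
      by apply: contrapT => nd; apply: Ut; apply: EU => /= H; exact/nd/H.
    have [r r0 Hr] := increment_of_is_derive dt eta0.
    exists r => // p q up pt tq qv tp qt.
    have pq : 0 <= q - p by rewrite subr_ge0 (le_trans pt).
    exists [::], (fun i => (q - p) * h i t); split => //=.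
    + by rewrite -subr_ge0.
    + under eq_bigr do rewrite exprMn.
      by rewrite -mulr_sumr ler_piMr ?sqr_ge0// h1.
    have Hq := Hr (q - t); have Hp := Hr (p - t).
    rewrite !subrK in Hq Hp; rewrite big_nil addr0.
    have -> : g q - g p - \sum_i ((q - p) * h i t) *: b i =
       (g q - g t - (q - t) *: w t) + - (g p - g t - (p - t) *: w t) +
       (q - p) *: (w t - \sum_i h i t *: b i).
      under eq_bigr do rewrite -scalerA.
      by rewrite -scaler_sumr; apply/rowP => i; rewrite !mxE; ring.
    rewrite (le_trans (ler_norm3 _ _ _))// normrN normrZ [`|q - p|]ger0_norm//.
    have Hw := ler_wpM2l pq (wb t (introT andP (conj ut tv))).
    have nq : `|q - t| = q - t by rewrite ger0_norm// subr_ge0.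
    have np : `|p - t| = t - p by rewrite ler0_norm ?subr_le0// opprB.
    rewrite nq np in Hq Hp.
    have /Hq {}Hq : q - t < r by lra.
    have /Hp {}Hp : t - p < r by lra.
    lra.
have [s [a [cs sU a1 H]]] := Quv.
exists (fun i => a i / (v - u)).
  under eq_bigr do rewrite expr_div_n.
  by rewrite -mulr_suml ler_pdivrMr ?exprn_gt0// mul1r.
have -> : (v - u) *: \sum_i a i / (v - u) *: b i = \sum_i a i *: b i.
  rewrite scaler_sumr; apply: eq_bigr => i _.
  by rewrite scalerA mulrC divfK// gt_eqF.
apply: le_trans H _.
have sT : itv_chain 0 T s.
  have c0 : itv_chain 0 u [::] by [].
  have cT : itv_chain v T [::] by [].
  by have := itv_chain_cat (itv_chain_cat c0 cs) cT; rewrite cats0.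
have mU := open_measurable oU.
have lt_d : \sum_(cd <- s) (cd.2 - cd.1) < d.
  rewrite -lte_fin; apply: le_lt_trans Ud.
  apply: le_trans (itv_chain_measure mU sT sU) _.
  by apply: le_measure; rewrite ?inE//; apply: measurableI => //; exact: measurable_itv.
have := Hd s sT lt_d.
have : eta * (v - u) = e / 2 by rewrite /eta divfK// gt_eqF.
rewrite mulrDl; lra.
Qed.

End MeanValue.

(** * Euler scheme *)

Section AbsolutelyContinuousCurves.
Context {R : realType} {n m : nat}.
Implicit Types (g : R -> 'rV[R]_n).

Lemma abs_continuous_uniform (a b : R) g : abs_continuous a b g ->
  forall e : R, 0 < e -> exists2 d : R, 0 < d & forall s t, a <= s -> s <= t -> t <= b ->
    t - s < d -> `|g t - g s| < e.
Proof.
move=> ac e e0; have [d d0 H] := ac _ e0; exists d => // s t sa st tb ts.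
have := H 1%N (fun _ => s) (fun _ => t) (fun _ => conj sa (conj st tb)).
rewrite !big_ord1; apply => //.
by apply/trivIsetP => i j _ _; rewrite (ord1 i) (ord1 j).
Qed.

Lemma abs_continuous_bounded (a b : R) g : a <= b -> abs_continuous a b g ->
  exists r : R, forall t, a <= t <= b -> `|g t| <= r.
Proof.
move=> ab ac; have [d d0 H] := abs_continuous_uniform ac ltr01.
apply: (@cousin _ (fun p q => exists r : R, forall t, p <= t <= q -> `|g t| <= r)) => //.
  move=> p q r ap pq qr rb [r1 H1] [r2 H2]; exists (Num.max r1 r2) => t /andP[pt tr].
  rewrite le_max; apply/orP; have [tq|/ltW qt] := leP t q.
    by left; rewrite H1// pt.
  by right; rewrite H2// qt.
move=> t /andP[at_ tb]; exists (d / 2); first by rewrite divr_gt0.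
move=> p q ap pt tq qb tp qt; exists (`|g p| + 1) => s /andP[ps sq].
rewrite -(subrKC (g p) (g s)) (le_trans (ler_normD _ _))// lerD2l ltW// H//.
  exact: le_trans qb.
lra.
Qed.

Lemma abs_continuous_restrict (a b c : R) g : c <= b ->
  abs_continuous a b g -> abs_continuous a c g.
Proof.
move=> cb ac e /ac[d d0 H]; exists d => // N u v uv; apply: H => k.
by have [h1 [h2 h3]] := uv k; split => //; split => //; exact: le_trans cb.
Qed.

Variable F : 'I_m -> vfield R n.

Lemma subunit_restrict T T' g : T' <= T -> subunit F T g -> subunit F T' g.
Proof.
move=> TT [ac [h [mh h1 dg]]].
have sub t : t \in `[0, T'] -> t \in `[0, T].
  by rewrite !in_itv/= => /andP[-> /le_trans]; exact.
split; first exact: abs_continuous_restrict ac.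
exists h; split => [i|t /sub|]; [|exact: h1|].
  apply: measurable_funS (mh i); first exact: measurable_itv.
  by move=> t /=; exact: sub.
by apply: negligibleS dg => t /= nd H; apply: nd => /sub; exact: H.
Qed.

(** The mean value estimate with all vectors [b i] equal to 0: the combination disappears and [M]
    serves as the error [kap]. *)
Lemma subunit_lipschitz T g (M r u v : R) : subunit F T g ->
  (forall (c : 'I_m -> R) x, \sum_i c i ^+ 2 <= 1 -> `|x| <= r -> `|\sum_i c i *: F i x| <= M) ->
  0 <= u -> u <= v -> v <= T -> (forall t, u <= t <= v -> `|g t| <= r) ->
  `|g v - g u| <= M * (v - u).
Proof.
move=> [ac [h [_ h1 dg]]] FM u0 uv vT gr; apply/ler_addgt0Pr => e e0.
have [|a _] := ac_mean_value ac h1 dg (b := fun _ => 0) (kap := M) u0 uv vT e0.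
  move=> t tuv; rewrite [X in _ - X]big1 => [|i _]; last by rewrite scaler0.
  rewrite subr0; apply: FM; last exact: gr.
  by apply: h1; rewrite in_itv/=; case/andP: tuv => ut /le_trans ->; rewrite ?(le_trans u0).
by rewrite big1 ?scaler0 ?subr0// => i _; rewrite scaler0.
Qed.

(** The speed is only bounded as long as the curve stays in the larger ball. Uniform continuity lets
    the curve advance by time steps in which it moves by less than the slack [1 - M * tau], so the
    bound propagates step by step. *)
Lemma subunit_confined T g (M r s tau : R) : subunit F T g -> 0 <= M -> 0 < tau ->
  (forall (c : 'I_m -> R) x, \sum_i c i ^+ 2 <= 1 -> `|x| <= r + 1 -> `|\sum_i c i *: F i x| <= M) ->
  0 <= s -> s + tau <= T -> M * tau < 1 -> `|g s| <= r ->
  forall t, s <= t <= s + tau -> `|g t| <= r + 1 /\ `|g t - g s| <= M * (t - s).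
Proof.
move=> sg M0 tau0 FM s0 sT Mt gs.
have lip t : s <= t <= s + tau -> (forall q, s <= q <= t -> `|g q| <= r + 1) ->
    `|g t - g s| <= M * (t - s).
  move=> /andP[st tt]; apply: (subunit_lipschitz sg FM) => //.
  exact: le_trans sT.
have [ac _] := sg.
have Mt0 : 0 < 1 - M * tau by rewrite subr_gt0.
have [d d0 H] := abs_continuous_uniform ac Mt0.
have d20 : 0 < d / 2 by rewrite divr_gt0.
have P k : forall t, s <= t <= s + tau -> t <= s + k%:R * (d / 2) -> `|g t| <= r + 1.
  elim: k => [|k IH] t /andP[st tt].
    rewrite mul0r addr0 => ts; have -> : t = s by apply/eqP; rewrite eq_le ts.
    by rewrite (le_trans gs)// lerDl.
  rewrite -natr1 mulrDl mul1r => tk.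
  have [/IH|kt] := leP t (s + k%:R * (d / 2)); first by apply; rewrite st.
  pose q := s + k%:R * (d / 2).
  have sq : s <= q by rewrite lerDl mulr_ge0// ltW.
  have qt : q <= s + tau by rewrite (le_trans (ltW kt)).
  have gq : `|g q - g s| <= M * (q - s).
    apply: lip; first by rewrite sq.
    by move=> p /andP[sp pq]; apply: IH => //; rewrite sp (le_trans pq).
  have gt : `|g t - g q| < 1 - M * tau.
    apply: H; [exact: le_trans sq|exact: ltW|exact: le_trans sT|].
    by rewrite /q; lra.
  have Mq : M * (q - s) <= M * tau by rewrite ler_wpM2l// lerBlDl.
  have -> : g t = (g t - g q) + (g q - g s) + g s by rewrite subrKA subrK.
  by rewrite (le_trans (ler_norm3 _ _ _))//; lra.
have all t : s <= t <= s + tau -> `|g t| <= r + 1.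
  move=> /andP[st tt]; apply: (P (Num.bound (tau / (d / 2)))); first by rewrite st.
  rewrite (le_trans tt)// lerD2l -ler_pdivrMr//.
  by apply/ltW/archi_boundP; rewrite divr_ge0// ltW.
move=> t tt; split; first exact: all.
apply: lip => // q /andP[sq qt]; apply: all; rewrite sq (le_trans qt)//.
by case/andP: tt.
Qed.

Lemma cc_dist_ge0 x y : (0 <= cc_dist F x y)%E.
Proof. by apply: le_ereal_inf_tmp => _ [T [T0 _] <-]; rewrite lee_fin ltW. Qed.

Lemma cc_dist_lt_subunit x y (t : R) : (cc_dist F x y < t%:E)%E ->
  exists T g, [/\ 0 < T, T < t, subunit F T g, g 0 = x & g T = y].
Proof.
move=> /ereal_inf_lt[_ [T [T0 [g [sg g0 gT]]] <-]]; rewrite lte_fin => Tt.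
by exists T, g.
Qed.

End AbsolutelyContinuousCurves.

Section EulerScheme.
Context {R : realType} {n m : nat}.
Variable X : 'I_m -> option nat -> vfield R n.
Variables (r M L : R).
Hypotheses (M0 : 0 <= M) (L0 : 0 <= L).
Hypothesis bounds : forall a (c : 'I_m -> R), \sum_i c i ^+ 2 <= 1 ->
    (forall x, `|x| <= r + 1 -> `|comb X c a x| <= M) /\
    (forall x y, `|x| <= r + 1 -> `|y| <= r + 1 ->
      `|comb X c a x - comb X c a y| <= L * `|x - y|).
Notation fieldX a := (fun i => X i a).
(** The coefficient of tau^2 in one step: L M for the curvature of the new curve, L M for freezing
    the fields at [g s], and 1 for the free error of the mean value theorem. *)
Let K := 2 * L * M + 1.

(** The averaged control of [g] over the step drives the family of index [b] from [p]. The factor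
    [1 + L * tau] accounts for starting at [p] instead of [g s], and [eta] for changing the
    family. *)
Lemma euler_step a b (g : R -> 'rV[R]_n) (T s tau eta : R) p :
  subunit (fieldX a) T g -> 0 <= s -> s + tau <= T -> 0 < tau ->
  M * tau <= 1 / 2 -> L * tau <= 1 / 2 -> `|g s| <= r -> `|p| <= r ->
  (forall c x, \sum_i c i ^+ 2 <= 1 -> `|x| <= r + 1 ->
    `|comb X c a x - comb X c b x| <= eta) ->
  exists p', reach (fieldX b) M tau p p' /\
    `|p' - g (s + tau)| <= (1 + L * tau) * `|p - g s| + tau * (eta + K * tau).
Proof.
move=> sg s0 sT tau0 Mt Lt gs pr ab.
have Mt1 : M * tau < 1 by lra.
have FM (c : 'I_m -> R) x : \sum_i c i ^+ 2 <= 1 -> `|x| <= r + 1 ->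
    `|\sum_i c i *: X i a x| <= M.
  by move=> c1 xr; exact: (bounds a c1).1.
have conf := subunit_confined sg M0 tau0 FM s0 sT Mt1 gs.
have [ac [h [mh h1 dg]]] := sg.
have r1 (x : 'rV[R]_n) : `|x| <= r -> `|x| <= r + 1 by move=> /le_trans; apply; rewrite lerDl.
have e0 : 0 < tau * tau by rewrite mulr_gt0.
have st : s <= s + tau by rewrite lerDl ltW.
have [|c c1 Hc] := ac_mean_value ac h1 dg (b := fun i => X i a (g s))
    (kap := L * (M * tau)) s0 st sT e0.
  move=> t tst; have [gt1 gt2] := conf t tst.
  have t01 : t \in `[0, T].
    by rewrite in_itv/=; case/andP: tst => ? ?; rewrite (le_trans s0)// (le_trans _ sT).
  have := (bounds a (h1 t t01)).2 _ _ gt1 (r1 _ gs).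
  rewrite /comb => /le_trans; apply.
  rewrite ler_wpM2l// (le_trans gt2)// ler_wpM2l// lerBlDl.
  by case/andP: tst.
have pM : `|p| + M * tau <= r + 1 by lra.
have [q [q0 cq qr dq [rq Hq]]] := comb_flow M0 L0 bounds b c1 tau0 Lt pM.
exists (q tau); split => //.
have Hab := ab c (g s) c1 (r1 _ gs).
have HL := (bounds b c1).2 p (g s) (r1 _ pr) (r1 _ gs).
move: Hc; rewrite -/(comb X c a (g s)) [s + tau - s]addrAC subrr add0r => Hc.
have -> : q tau - g (s + tau) = (q tau - p - tau *: comb X c b p) +
   (- (g (s + tau) - g s - tau *: comb X c a (g s)) + (p - g s)) +
   (tau *: (comb X c b p - comb X c b (g s)) - tau *: (comb X c a (g s) - comb X c b (g s))).
  by apply/rowP => i; rewrite !mxE; ring.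
apply: le_trans (ler_norm3 _ _ _) _.
have H1 := ler_normD (- (g (s + tau) - g s - tau *: comb X c a (g s))) (p - g s).
have H2 := ler_normB (tau *: (comb X c b p - comb X c b (g s)))
  (tau *: (comb X c a (g s) - comb X c b (g s))).
rewrite normrN in H1; rewrite !normrZ gtr0_norm// in H2.
have H3 := ler_wpM2l (ltW tau0) Hab; have H4 := ler_wpM2l (ltW tau0) HL.
rewrite /K; move: Hq Hc H1 H2 H3 H4.
set A := `|q tau - _ - _|; set B := `|g (s + tau) - _ - _|.
set u := `|p - g s|; set w := `|_ + (p - g s)|; set z := `|_ - tau *: _|.
move=> Hq Hc H1 H2 H3 H4.
have -> : (1 + L * tau) * u + tau * (eta + (2 * L * M + 1) * tau) =
  L * M * tau * tau + (L * (M * tau) * tau + tau * tau + u) + (tau * (L * u) + tau * eta) by ring.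
lra.
Qed.

(** A discrete Gronwall argument. Confinement is a hypothesis on pairs of points at distance at most
    1, so that it can be checked on whichever of the two curves is known to be bounded. *)
Lemma euler_chain a b (g : R -> 'rV[R]_n) (T eta : R) N :
  subunit (fieldX a) T g -> 0 < T -> (0 < N)%N -> 0 <= eta ->
  M * (T / N%:R) <= 1 / 2 -> L * (T / N%:R) <= 1 / 2 ->
  (forall c x, \sum_i c i ^+ 2 <= 1 -> `|x| <= r + 1 ->
    `|comb X c a x - comb X c b x| <= eta) ->
  T * (eta + K * (T / N%:R)) * (1 + L * (T / N%:R)) ^+ N <= 1 ->
  (forall t p, 0 <= t <= T -> (p = g 0 \/ reach (fieldX b) M t (g 0) p) ->
    `|p - g t| <= 1 -> `|p| <= r /\ `|g t| <= r) ->
  exists p, reach (fieldX b) M T (g 0) p /\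
    `|p - g T| <= T * (eta + K * (T / N%:R)) * (1 + L * (T / N%:R)) ^+ N.
Proof.
move=> sg T0 N0 eta0 MT LT ab B1 conf; set tau := T / N%:R.
have NR : 0 < N%:R :> R by rewrite ltr0n.
have tau0 : 0 < tau by rewrite divr_gt0.
have tauN : N%:R * tau = T by rewrite mulrC divfK// gt_eqF.
have K0 : 0 <= K by rewrite addr_ge0// !mulr_ge0.
have L1 : 1 <= 1 + L * tau by rewrite lerDl mulr_ge0// ltW.
have eK : 0 <= eta + K * tau by rewrite addr_ge0// mulr_ge0// ltW.
pose E (k : nat) : R := k%:R * tau * (eta + K * tau) * (1 + L * tau) ^+ k.
have EN k : (k <= N)%N -> E k <= 1.
  move=> kN; apply: le_trans B1; rewrite /E -/tau -[X in _ <= X * _ * _]tauN.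
  apply: ler_pM; [|by rewrite exprn_ge0// (le_trans ler01)| |exact: ler_weXn2l].
    by rewrite !mulr_ge0// ltW.
  by rewrite ler_wpM2r// ler_wpM2r ?(ltW tau0)// ler_nat.
(* At [k = 0] equality replaces [reach], which requires a positive duration. *)
suff H k : (k <= N)%N -> exists p, (if k is 0%N then p = g 0 else
    reach (fieldX b) M (k%:R * tau) (g 0) p) /\ `|p - g (k%:R * tau)| <= E k.
  have [p] := H N (leqnn N); rewrite /E tauN; case: N N0 {NR tau0 tauN K0 L1 eK E EN H B1 MT LT} @tau => // N _ tau [rp pE].
  by exists p.
elim: k => [|k IH] kN.
  by exists (g 0); split => //; rewrite mul0r subrr normr0 /E !mul0r.
have [p [rp pE]] := IH (ltnW kN).
have kT : 0 <= k%:R * tau <= T.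
  by rewrite mulr_ge0 ?(ltW tau0)//= -tauN ler_wpM2r ?(ltW tau0)// ler_nat ltnW.
have [||pr gr] := conf _ p kT.
- by case: k rp {IH kN pE kT} => [|k]; [left|right].
- exact: le_trans pE (EN _ (ltnW kN)).
have kT2 : k%:R * tau + tau <= T.
  by rewrite -tauN -[X in _ + X]mul1r -mulrDl natr1 ler_wpM2r ?(ltW tau0)// ler_nat.
have [p' [rp' p'E]] := euler_step sg (proj1 (andP kT)) kT2 tau0 MT LT gr pr ab.
have kS : k.+1%:R * tau = k%:R * tau + tau by rewrite -natr1 mulrDl mul1r.
exists p'; rewrite kS; split.
  case: k rp {IH kN pE kT gr pr kT2 p'E kS} => [rp|k rp].
    by rewrite mul0r add0r -rp.
  exact: reach_trans rp rp'.
apply: le_trans p'E _.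
have H1 : (1 + L * tau) * `|p - g (k%:R * tau)| <= (1 + L * tau) * E k.
  by rewrite ler_wpM2l// (le_trans ler01).
have H2 : tau * (eta + K * tau) <= tau * (eta + K * tau) * (1 + L * tau) ^+ k.+1.
  have tK : 0 <= tau * (eta + K * tau) by rewrite mulr_ge0// ltW.
  by rewrite ler_peMr//; exact: exprn_ege1.
apply: le_trans (lerD H1 H2) _.
by rewrite le_eqVlt; apply/orP; left; apply/eqP; rewrite /E exprS -natr1; ring.
Qed.

End EulerScheme.

(** The Gronwall factor is at most exp(L D). Half of the tolerance goes to [eta], and [N] is taken
    so large that the discretization error fits in the other half. Neither depends on [T], since the
    curve to be approximated is chosen later. *)
Lemma euler_params {R : realType} (D M L K del : R) : 0 < D -> 0 <= M -> 0 <= L ->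
  0 <= K -> 0 < del -> exists N eta, [/\ (0 < N)%N, 0 < eta &
  forall T, 0 < T <= D -> [/\ M * (T / N%:R) <= 1 / 2, L * (T / N%:R) <= 1 / 2 &
    T * (eta + K * (T / N%:R)) * (1 + L * (T / N%:R)) ^+ N <= del]].
Proof.
move=> D0 M0 L0 K0 del0; pose E := expR (L * D).
have E0 : 0 < E by exact: expR_gt0.
pose eta := del / (2 * D * E).
have eta0 : 0 < eta by rewrite divr_gt0// !mulr_gt0.
have Edel : del = D * (eta + eta) * E by rewrite /eta; field; rewrite !gt_eqF.
have [D0' eta0'] := (ltW D0, ltW eta0).
move: (eta) eta0 eta0' Edel => {}eta eta0 eta0' Edel.
pose S := 2 * M * D + 2 * L * D + K * D / eta.
have MD : 0 <= 2 * M * D by rewrite !mulr_ge0.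
have LD : 0 <= 2 * L * D by rewrite !mulr_ge0.
have KD : 0 <= K * D / eta by rewrite divr_ge0 ?mulr_ge0.
have S0 : 0 <= S := addr_ge0 (addr_ge0 MD LD) KD.
pose N := (Num.bound S).+1.
have SN : S <= N%:R.
  by rewrite (le_trans (ltW (archi_boundP S0)))// ler_nat.
have NR : 0 < N%:R :> R by rewrite ltr0n.
exists N, eta; split => // T /andP[T0 TD].
have TN0 : 0 <= T / N%:R by rewrite divr_ge0// ltW.
have TN : T / N%:R <= D / N%:R by rewrite ler_pM2r// invr_gt0.
have sm (A : R) : 0 <= A -> 2 * A * D <= N%:R -> A * (T / N%:R) <= 1 / 2.
  move=> A0 AN; apply: le_trans (ler_wpM2l A0 TN) _.
  by rewrite mulrA ler_pdivrMr//; lra.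
have KT : K * (T / N%:R) <= eta.
  apply: le_trans (ler_wpM2l K0 TN) _.
  rewrite mulrA ler_pdivrMr// [leRHS]mulrC -ler_pdivrMr//.
  by apply: le_trans SN; rewrite /S; lra.
split.
- by apply: sm => //; apply: le_trans SN; rewrite /S; lra.
- by apply: sm => //; apply: le_trans SN; rewrite /S; lra.
rewrite Edel.
have LT0 : 0 <= L * (T / N%:R) by rewrite mulr_ge0.
apply: ler_pM; [| |apply: ler_pM|].
- by rewrite mulr_ge0 ?addr_ge0 ?mulr_ge0// ltW.
- by rewrite exprn_ge0// addr_ge0.
- exact: ltW.
- exact: addr_ge0 eta0' (mulr_ge0 K0 TN0).
- exact: TD.
- by rewrite lerD2l.
apply: (@le_trans _ _ (expR (L * (T / N%:R)) ^+ N)).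
  by rewrite lerXn2r ?nnegrE ?expR_ge0 ?addr_ge0// expR_ge1Dx.
rewrite -expRM_natl ler_expR mulrCA.
have -> : N%:R * (T / N%:R) = T by rewrite mulrC divfK// gt_eqF.
by rewrite ler_wpM2l.
Qed.

(** * Convergence of the distances *)

Section UniformChow.
Context {R : realType} {n m : nat}.
Variable X : 'I_m -> option nat -> vfield R n.
Hypothesis sX : forall i, smooth_vfam (X i).
Hypothesis chow : chow_hormander (fun i => X i None).
Notation fieldX a := (fun i => X i a).

(** Hiding the Lipschitz constant and allowing a shorter duration makes curves from different places
    of a compact set composable. *)
Definition joined a (t : R) x y := exists M T, [/\ 0 <= M, T <= t & reach (fieldX a) M T x y].

Lemma joined_le a t t' x y : t <= t' -> joined a t x y -> joined a t' x y.
Proof. by move=> tt [M [T [M0 Tt r]]]; exists M, T; split => //; exact: le_trans tt. Qed.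

Lemma joined_trans a t1 t2 x y z :
  joined a t1 x y -> joined a t2 y z -> joined a (t1 + t2) x z.
Proof.
move=> [M1 [T1 [M10 T1t r1]]] [M2 [T2 [M20 T2t r2]]].
exists (Num.max M1 M2), (T1 + T2); split; [by rewrite le_max M10|exact: lerD|].
apply: (reach_trans (y := y)); first by rewrite le_max M10.
  by apply: reach_weaken r1; rewrite le_max lexx.
by apply: reach_weaken r2; rewrite le_max lexx orbT.
Qed.

Lemma joined_cc_dist a t x y : joined a t x y -> (cc_dist (fieldX a) x y <= t%:E)%E.
Proof.
move=> [M [T [M0 Tt r]]]; apply: le_trans (reach_cc_dist r) _.
by rewrite lee_fin.
Qed.

(** Compactness of the ball. A single integer [N] controls both the index from which the fields are
    considered and the admissible distance, so that the covering argument runs along one filter. *)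
Lemma uniform_chow (kap e : R) : 0 < e -> exists J (d : R), 0 < d /\
  forall a x y, from_index J a -> `|x| <= kap -> `|x - y| <= d -> joined a e x y.
Proof.
move=> e0.
pose P (N : nat) (x : 'rV[R]_n) := forall a y, from_index N a ->
  `|x - y| <= N.+1%:R^-1 -> joined a e x y.
have nc := (compact_near_coveringP _).1 (@compact_norm_ball R n kap).
have [N _ HN] : \forall N \near \oo, [set x : 'rV[R]_n | `|x| <= kap] `<=` P N.
  apply: nc => x0 _; have [M [rho [J [M0 rho0 H]]]] := local_chow x0 sX chow e0.
  have r20 : 0 < rho / 2 by rewrite divr_gt0.
  exists ([set x | `|x0 - x| < rho / 2], [set N | (J <= N)%N /\ N.+1%:R^-1 <= rho / 2]) => /=.
    split.
      have nx : \forall x \near x0, `|x0 - x| < rho / 2 by apply/nbhs_normP; exists (rho / 2).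
      exact: nx.
    exists (maxn J (Num.bound (rho / 2)^-1)) => // N /=; rewrite geq_max => /andP[JN bN].
    split => //; rewrite invf_ple ?posrE ?ltr0n//.
    rewrite (le_trans (ltW (archi_boundP _)))//; first by rewrite invr_ge0 ltW.
    by rewrite ler_nat (leq_trans bN).
  move=> [x N] /= [xr [JN Nr]] a y aN xy.
  have [||T Te r] := H a x y (from_indexW JN aN).
  - by rewrite distrC; lra.
  - rewrite distrC -(subrKA x) (le_trans (ler_normD _ _))// [rho]splitr lerD//.
      exact: ltW.
    exact: le_trans Nr.
  by exists M, T.
exists N, N.+1%:R^-1; split; first by rewrite invr_gt0 ltr0n.
by move=> a x y aN xk xy; exact: (HN N (leqnn N) x xk a y aN xy).
Qed.

(** The segment from [x] to [y] stays in the ball by convexity and is cut into pieces shorter than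
    the uniform Chow distance; each is bridged in time at most 1. *)
Lemma joined_ball (kap : R) : 0 <= kap -> exists2 D : R, 0 < D &
  forall x y, `|x| <= kap -> `|y| <= kap -> joined None D x y.
Proof.
move=> kap0; have [J [d [d0 H]]] := uniform_chow kap ltr01.
pose N := (Num.bound (2 * kap / d)).+1.
have NR : 0 < N%:R :> R by rewrite ltr0n.
have Nd : (kap + kap) / N%:R <= d.
  rewrite ler_pdivrMr// mulrC -ler_pdivrMr//.
  rewrite (le_trans (ltW (archi_boundP _))) ?ler_nat//; last by rewrite -mulr2n -mulr_natl.
  by rewrite divr_ge0 ?addr_ge0// ltW.
exists (N.+1)%:R; first by rewrite ltr0n.
move=> x y xk yk; pose p k : 'rV[R]_n := x + (k%:R / N%:R) *: (y - x).
have pk k : (k <= N)%N -> `|p k| <= kap.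
  move=> kN; have -> : p k = (1 - k%:R / N%:R) *: x + (k%:R / N%:R) *: y.
    by apply/rowP => i; rewrite !mxE; ring.
  have q0 : 0 <= k%:R / N%:R :> R by rewrite divr_ge0.
  have q1 : 0 <= 1 - k%:R / N%:R :> R by rewrite subr_ge0 ler_pdivrMr// mul1r ler_nat.
  rewrite (le_trans (ler_normD _ _))// !normrZ !ger0_norm//.
  have -> : kap = (1 - k%:R / N%:R) * kap + k%:R / N%:R * kap by ring.
  by rewrite lerD// ler_wpM2l.
have pS k : `|p k - p k.+1| <= d.
  have -> : p k - p k.+1 = - (N%:R^-1 *: (y - x)).
    by rewrite /p -natr1; apply/rowP => i; rewrite !mxE; field; rewrite gt_eqF.
  rewrite normrN normrZ ger0_norm ?invr_ge0 ?ler0n// mulrC (le_trans _ Nd)//.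
  by rewrite ler_wpM2r ?invr_ge0 ?ler0n// (le_trans (ler_normB _ _))// lerD.
have Hk k : (k <= N)%N -> joined None k.+1%:R x (p k).
  elim: k => [|k IH] kN.
    apply: H => //; rewrite /p mul0r scale0r addr0 subrr normr0; exact: ltW.
  rewrite -natr1; apply: joined_trans (IH (ltnW kN)) _.
  by apply: H => //; exact/pk/ltnW.
have := Hk N (leqnn N); rewrite /p divff ?gt_eqF// scale1r subrKC; exact.
Qed.

Hypothesis balls : forall (x : 'rV[R]_n) (r : R), bounded_set (cc_ball (fieldX None) x r).

(** One ball centred at 0 is enough: 0 is first joined to [x] in bounded time. The summand 1 in its
    radius makes the inequality strict. *)
Lemma joined_bounded (kap t : R) : 0 <= kap -> exists2 r : R, kap <= r &
  forall x y, `|x| <= kap -> joined None t x y -> `|y| <= r.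
Proof.
move=> kap0; have [D D0 HD] := joined_ball kap0.
have [B [_ HB]] := balls 0 (D + t + 1).
exists (Num.max kap (`|B| + 1)); first by rewrite le_max lexx.
move=> x y xk xy; rewrite le_max; apply/orP; right.
apply: (HB (`|B| + 1)); first by rewrite (le_lt_trans (ler_norm _))// ltrDl.
rewrite /= /cc_ball /=; apply: le_lt_trans (joined_cc_dist _) _.
  by apply: joined_trans xy; apply: HD; rewrite ?normr0.
by rewrite lte_fin ltrDl.
Qed.

(** A subunit curve is not prolonged directly; at time [s] it is approximated within 1 by the
    endpoint of a horizontal curve, to which the previous bound applies. The Euler scheme uses a
    bound [r1] special to [g], but the resulting radius [r + 1] does not depend on [g]. *)
Lemma subunit_bounded (kap t : R) : 0 <= kap -> 0 < t -> exists2 r : R, kap <= r &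
  (forall x y s, `|x| <= kap -> s <= t -> joined None s x y -> `|y| <= r) /\
  (forall g T s, subunit (fieldX None) T g -> `|g 0| <= kap -> T <= t -> 0 <= s <= T ->
    `|g s| <= r + 1).
Proof.
move=> kap0 t0; have [r kr Hr] := joined_bounded t kap0.
exists r => //; split=> [x y s xk st xy|g T s sg gk Tt /andP[s0 sT]].
  by apply: Hr xk _; exact: joined_le st xy.
move: s0; rewrite le_eqVlt => /predU1P[<-|s0].
  by rewrite (le_trans gk)// (le_trans kr)// lerDl.
have {}sg : subunit (fieldX None) s g by exact: subunit_restrict sg.
have [ac _] := sg; have [r1 Hr1] := abs_continuous_bounded (ltW s0) ac.
have [M [L [M0 L0 bounds]]] := comb_bounds sX (r1 + 1 + 1).
have K0 : 0 <= 2 * L * M + 1 by rewrite addr_ge0// !mulr_ge0.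
have [N [eta [N0 eta0 HN]]] := euler_params s0 M0 L0 K0 ltr01.
have [|Ms Ls Es] := HN s; first by rewrite s0 lexx.
(* The scheme compares the family with itself, so the discrepancy of the fields is 0. *)
have [||p [rp pE]] := euler_chain M0 L0 bounds (b := None) sg s0 N0 (ltW eta0) Ms Ls _ Es.
- by move=> c x _ _; rewrite subrr normr0 ltW.
- move=> q p qs _ pq; have gq := Hr1 q qs.
  split; last by rewrite (le_trans gq)// lerDl.
  by rewrite -(subrK (g q) p) (le_trans (ler_normD _ _))// addrC lerD.
have pr : `|p| <= r by apply: Hr gk _; exists M, s; split => //; exact: le_trans Tt.
rewrite -(subrK p (g s)) (le_trans (ler_normD _ _))// addrC lerD// distrC.
exact: le_trans Es.
Qed.

End UniformChow.

(** The infimum need not be attained: the comparison is made for times slightly above [u], but still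
    below [t + e], the horizon up to which it is available. *)
Lemma cc_dist_le_of_lt {R : realType} (u v : \bar R) (e t : R) :
  (u <= t%:E)%E -> 0 < e ->
  (forall T : R, (u < T%:E)%E -> T < t + e -> (v <= (T + e)%:E)%E) -> (0 <= u)%E ->
  (v <= u + (2 * e)%:E)%E.
Proof.
case: u => [u| |]//= ut e0 H u0; rewrite -EFinD.
have ut' : u <= t by rewrite -lee_fin.
apply/lee_addgt0Pr => d d0.
pose c := Num.min d e / 2.
have m0 : 0 < Num.min d e by rewrite lt_min d0.
have c0 : 0 < c by rewrite divr_gt0.
have [cd ce] : c <= d /\ c < e.
  have : Num.min d e <= d by rewrite ge_min lexx.
  have : Num.min d e <= e by rewrite ge_min lexx orbT.
  by rewrite /c; lra.
apply: le_trans (H (u + c) _ _) _.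
- by rewrite lte_fin ltrDl.
- lra.
by rewrite -EFinD lee_fin; lra.
Qed.

Theorem theorem3p4 (R : realType) (m n : nat) (hm : (2 <= m)%N) (hmn : (m <= n)%N)
    (X : 'I_m -> vfield R n) (Xj : nat -> 'I_m -> vfield R n)
    (smoothX : forall i, smooth (X i))
    (indepX : lin_indep X)
    (smoothXj : forall j i, smooth (Xj j i))
    (indepXj : forall j, lin_indep (Xj j))
    (chowX : chow_hormander X)
    (bounded_balls : forall (x : 'rV[R]_n) (r : R), bounded_set (cc_ball X x r))
    (cvgX : forall i, cvg_smooth_loc (fun j => Xj j i) (X i)) :
  cvg_Linfty_loc (fun j => cc_dist (Xj j)) (cc_dist X).
Proof.
pose Y (i : 'I_m) := fam_of (fun j => Xj j i) (X i).
have sY i : smooth_vfam (Y i) by exact: smooth_vfam_of.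
(* The final error is [2 * e]; [3 * e <= 1] keeps the second comparison, of times below
   [D + 2 * e + e], within the horizon [D + 1]. *)
move=> C cC e0' e0'0; pose e := Num.min e0' 1 / 3.
have m0 : 0 < Num.min e0' 1 by rewrite lt_min e0'0 ltr01.
have e_gt0 : 0 < e by rewrite divr_gt0.
have [ee0 e1] : 2 * e <= e0' /\ 3 * e <= 1.
  have : Num.min e0' 1 <= e0' by rewrite ge_min lexx.
  have : Num.min e0' 1 <= 1 by rewrite ge_min lexx orbT.
  by rewrite /e; lra.
have [kap kap0 Ckap] : exists2 kap : R, 0 <= kap & forall x, C x -> `|x| <= kap.
  have [B [_ HB]] := compact_bounded cC.
  exists (`|B| + 1); first by rewrite addr_ge0.
  by move=> x Cx; apply: (HB (`|B| + 1)) => //; rewrite (le_lt_trans (ler_norm _))// ltrDl.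
have [D D0 HD] := joined_ball sY chowX kap0.
have D10 : 0 < D + 1 by rewrite addr_gt0.
have [r kr [Hr1 Hr2]] := subunit_bounded sY chowX bounded_balls kap0 D10.
(* Both curves of a comparison will stay within radius [r + 2], and one Euler step needs bounds on a
   ball of radius one more. *)
have [M [L [M0 L0 bounds]]] := comb_bounds sY (r + 2 + 1).
have K0 : 0 <= 2 * L * M + 1 by rewrite addr_ge0// !mulr_ge0.
have [J1 [d [d0 Hd]]] := uniform_chow sY chowX (r + 2) e_gt0.
have md0 : 0 < Num.min d 1 by rewrite lt_min d0 ltr01.
(* Accuracy [d] lets Chow close the final gap, accuracy 1 serves confinement. *)
have [N [eta [N0 eta0 HN]]] := euler_params D10 M0 L0 K0 md0.
have [J2 HJ2] := comb_cvg sY (r + 2 + 1) eta0.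
have rle : r <= r + 2 by rewrite lerDl.
have compare a b g T : from_index J1 b ->
    subunit (fun i => Y i a) T g -> 0 < T -> T <= D + 1 -> `|g 0| <= kap -> `|g T| <= kap ->
    (forall c x, \sum_i c i ^+ 2 <= 1 -> `|x| <= r + 2 + 1 ->
      `|comb Y c a x - comb Y c b x| <= eta) ->
    a = None \/ b = None -> joined Y b (T + e) (g 0) (g T).
  move=> bJ sg T0 TD g0k gTk ab ab0.
  have [|MT LT ET] := HN T; first by rewrite T0.
  have E1 : T * (eta + (2 * L * M + 1) * (T / N%:R)) * (1 + L * (T / N%:R)) ^+ N <= 1.
    by rewrite (le_trans ET)// ge_min lexx orbT.
  have [|p [rp pE]] := euler_chain M0 L0 bounds sg T0 N0 (ltW eta0) MT LT ab E1.
    (* If the given curve belongs to [X], it is bounded by [r + 1]; otherwise the approximating one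
       does and is bounded by [r]. The other curve is within 1 in both cases. *)
    move=> t p tT pg pgt; case: ab0 => [aN|bN].
      rewrite aN in sg; have gt1 := Hr2 _ _ _ sg g0k TD tT.
      by split; first rewrite -(subrK (g t) p) (le_trans (ler_normD _ _))//; lra.
    have pr : `|p| <= r.
      case: pg => [->|rp]; first exact: le_trans kr.
      case/andP: tT => _ tT; apply: (Hr1 (g 0) p t) => //; first exact: le_trans TD.
      by exists M, t; split => //; rewrite bN in rp.
    split; first exact: le_trans rle.
    by rewrite -(subrK p (g t)) (le_trans (ler_normD _ _))// distrC; lra.
  have pd := le_trans pE ET; have [pd1 pd2] : `|p - g T| <= d /\ `|p - g T| <= 1.
    by move: pd; rewrite le_min => /andP.
  apply: (joined_trans (y := p)); first by exists M, T.
  (* The gap between [p] and the desired endpoint is closed by the uniform Chow theorem for the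
     family [b], at the cost of a time [e]. *)
  apply: Hd => //; rewrite -(subrK (g T) p) (le_trans (ler_normD _ _))//; lra.
exists (maxn J1 J2) => j; rewrite geq_max => /andP[jJ1 jJ2] x y Cx Cy.
have xk := Ckap _ Cx; have yk := Ckap _ Cy.
have close c z : \sum_i c i ^+ 2 <= 1 -> `|z| <= r + 2 + 1 ->
    `|comb Y c (Some j) z - comb Y c None z| <= eta by exact: HJ2.
pose dist a := cc_dist (fun i => Y i a) x y.
have step a b (t : R) : (a = Some j /\ b = None) \/ (a = None /\ b = Some j) ->
    t + e <= D + 1 -> (dist a <= t%:E)%E -> (dist b <= dist a + (2 * e)%:E)%E.
  move=> ab tD da; apply: cc_dist_le_of_lt da e_gt0 _ (cc_dist_ge0 _ _ _) => T0 dT0 T0t.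
  have [T [g [T_gt0 TT0 sg g0 gT]]] := cc_dist_lt_subunit dT0.
  have jb : joined Y b (T + e) (g 0) (g T).
    apply: (compare a b) => //; rewrite ?g0 ?gT//.
    - by case: ab => [[_ ->]|[_ ->]].
    - by lra.
    - move=> c z c1 zr; case: ab => [[-> ->]|[-> ->]]; first exact: close.
      by rewrite distrC; exact: close.
    - by case: ab => [[_ ->]|[-> _]]; [right|left].
  rewrite g0 gT in jb; apply: le_trans (joined_cc_dist jb) _.
  by rewrite lee_fin; lra.
have dX : (dist None <= D%:E)%E by exact: joined_cc_dist (HD _ _ xk yk).
(* Only the limit distance is bounded beforehand, by [D]. This comparison makes the other one finite
   and bounds it by [D + 2 * e], which the reverse comparison needs. *)
have H1 : (dist (Some j) <= dist None + (2 * e)%:E)%E.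
  by apply: (step None (Some j) D); [right|lra|].
have dj : (dist (Some j) <= (D + 2 * e)%:E)%E.
  by apply: le_trans H1 _; rewrite EFinD leeD2r.
have H2 : (dist None <= dist (Some j) + (2 * e)%:E)%E.
  by apply: (step (Some j) None (D + 2 * e)); [left|lra|].
have -> : cc_dist (Xj j) x y = dist (Some j) by [].
have -> : cc_dist X x y = dist None by [].
have := cc_dist_ge0 (fun i => Y i None) x y; rewrite -/(dist None).
have := cc_dist_ge0 (fun i => Y i (Some j)) x y; rewrite -/(dist (Some j)).
case: (dist (Some j)) dj H1 H2 => [u| |]//=.
case: (dist None) dX => [v| |]//= _ _.
rewrite -!EFinD !lee_fin => uv vu _ _; split => //.
by rewrite ler_norml; lra.
Qed.
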